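(* Let $\alpha>0$ and let $\lambda\ne0$ be a finite measure on $\mathcal{P}^*_+$ with $c(\lambda):=\int_{\mathcal{P}^*_+}\sum_{k\ge1}x_k^{-\alpha}\lambda(d\mathbf{x})<\infty$, normalized so that $c(\lambda)\Gamma(\alpha)=1$, and let $(\mathbf{Z}_n)_{n\ge0}$ be the associated branching random walk on $\mathbb{R}_+^2$. Define $$\mathfrak{z}_n:=\sup\{z:\ \mathbf{Z}_n([0,1]\times[0,z])=0\}.$$ Then $$\lim_{n\to\infty}\frac{\mathfrak{z}_n}{n^{(\alpha+1)/\alpha}}=c_\alpha\quad\text{in probability},\qquad\text{with } c_\alpha:=\alpha\,e^{-(\alpha+1)/\alpha}.$$
   Context: $\mathcal{P}^*_+$ is the space of non-decreasing sequences $\mathbf{x}=(x_k)_{k\ge1}$ in $(0,\infty]$ with $x_1<\infty$ and $\lim_{k\to\infty}x_k=\infty$, with the topology of pointwise convergence; entries equal to $\infty$ are not counted as atoms, and $\infty^{-\alpha}=0$. For $c>0$, $c\mathbf{x}=(cx_k)_{k\ge1}$. Define the measure $\Lambda^*$ on $\mathcal{P}^*_+$ by $\int F(\mathbf{x})\,\Lambda^*(d\mathbf{x})=\int_0^\infty y^{\alpha-1}\int_{\mathcal{P}^*_+}F(y\mathbf{x})\,\lambda(d\mathbf{x})\,dy$ for measurable $F\ge0$. Let $\mathbf{N}$ be a Poisson point process on $(0,\infty)\times\mathcal{P}^*_+$ with intensity $dt\times\Lambda^*(d\mathbf{x})$, and let $\mathbf{Z}_1$ be the point process on $(0,\infty)^2$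 obtained by replacing each atom $(t,\mathbf{x})$ of $\mathbf{N}$ by the atoms $(t,x_k)$, $k\ge1$, $x_k<\infty$. The branching random walk $(\mathbf{Z}_n)_{n\ge0}$ on $\mathbb{R}_+^2$ with reproduction law $\mathbf{Z}_1$ is defined by $\mathbf{Z}_0=\delta_{(0,0)}$, and $\mathbf{Z}_{n+1}$ is obtained from $\mathbf{Z}_n$ by replacing each atom $z$ of $\mathbf{Z}_n$ by the translate by $z$ of an independent copy of $\mathbf{Z}_1$. *)

(* Defs.v *)
From HB Require Import structures.
From mathcomp Require Import all_boot all_order all_algebra.
From mathcomp Require Import all_classical all_reals all_analysis.
From mathcomp Require Import measurable_realfun.

Set Implicit Arguments.
Unset Strict Implicit.
Unset Printing Implicit Defensive.

Import Order.TTheory GRing.Theory Num.Theory.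
Import numFieldNormedType.Exports.

Local Open Scope classical_set_scope.
Local Open Scope ring_scope.

Section sequence_space.
Context (R : realType).

(* Indices are shifted: [x k] is the entry usually written x_(k+1). *)
Definition pstar_set : set {ptws nat -> \bar R} :=
  [set x | [/\ forall k, (0%:E < x k)%E,
               nondecreasing_seq (x : nat -> \bar R),
               (x 0%N < +oo)%E &
               (x : nat -> \bar R) @ \oo --> +oo%E]].

(* [set_type] carries the topology induced by pointwise convergence. *)
Definition pstar : Type := set_type pstar_set.

HB.instance Definition _ := Topological.on pstar.
HB.instance Definition _ := SubType.on pstar.

Lemma pstar_nat_subproof :
  ((fun k => k.+1%:R%:E) : {ptws nat -> \bar R}) \in pstar_set.
Proof.
apply/mem_set; split=> /=.
- by move=> k; rewrite lte_fin ltr0n.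
- by move=> m n mn; rewrite lee_fin ler_nat ltnS.
- exact: ltry.
- apply/cvgeryP/cvgryPge => A; near=> n.
  have An : A <= n%:R by near: n; exact: nbhs_infty_ger.
  by rewrite (le_trans An)// ler_nat.
Unshelve. all: by end_near. Qed.

HB.instance Definition _ :=
  isPointed.Build pstar
    (exist (fun x => x \in pstar_set) _ pstar_nat_subproof).

HB.instance Definition _ :=
  Measurable.copy pstar (g_sigma_algebraType (@open pstar)).

Definition pseq (x : pstar) : nat -> \bar R := val x.

(* Only used for [0 < y], see [pseq_scale]. *)
Definition scale (y : R) (x : pstar) : pstar :=
  insubd x ((fun k => y%:E * pseq x k)%E : {ptws nat -> \bar R}).

Lemma pseq_scale (y : R) (x : pstar) : 0 < y ->
  pseq (scale y x) = (fun k => y%:E * pseq x k)%E.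
Proof.
move=> y0; rewrite /pseq /scale insubdK//; apply/mem_set.
have /set_mem[x0 xnd xfin xoo] := valP x; split=> /=.
- by move=> k; rewrite mule_gt0.
- by move=> m n mn; rewrite lee_pmul2l//; exact: xnd.
- by rewrite lte_mul_pinfty// ?lee_fin ?ltW.
- have -> : (+oo = y%:E * +oo :> \bar R)%E by rewrite gt0_muley.
  exact: cvgeZl.
Qed.

(* [poweR] is not suitable here since it sends +oo to +oo. *)
Definition inv_power (alpha : R) (x : \bar R) : \bar R :=
  if x is r%:E then (r `^ (- alpha))%:E else 0%E.

Definition c_const (alpha : R) (lambda : set pstar -> \bar R) : \bar R :=
  (\int[lambda]_x \sum_(0 <= k <oo) inv_power alpha (pseq x k))%E.

(* The integral of F against the measure Lambda^*. *)
Definition Lambda_star_integral (alpha : R) (lambda : set pstar -> \bar R)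
    (F : pstar -> \bar R) : \bar R :=
  (\int[lebesgue_measure]_(y in `]0%R, +oo[)
     ((y `^ (alpha - 1))%:E * \int[lambda]_x F (scale y x)))%E.

Definition Lambda_star (alpha : R) (lambda : set pstar -> \bar R)
    (A : set pstar) : \bar R :=
  Lambda_star_integral alpha lambda (EFin \o \1_A).

Definition intensity (alpha : R) (lambda : set pstar -> \bar R) :
    set (R * pstar) -> \bar R :=
  (mrestr lebesgue_measure (@measurable_itv R `]0%R, +oo[)
     \x Lambda_star alpha lambda)%E.

End sequence_space.

Definition Gamma (R : realType) (a : R) : \bar R :=
  (\int[lebesgue_measure]_(x in `]0%R, +oo[)
     (x `^ (a - 1) * expR (- x))%:E)%E.

Definition independent d (Omega : measurableType d) (R : realType)
    (P : probability Omega R) (J : eqType) (F : J -> set (set Omega)) : Prop :=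
  forall (s : seq J) (E : J -> set Omega), uniq s ->
    (forall j, j \in s -> F j (E j)) ->
    P (\bigcap_(j in [set` s]) E j) = (\prod_(j <- s) P (E j))%E.

(* A point process on T is given by an enumeration of its atoms, repeated
   according to their multiplicities: a configuration is a map I -> option T,
   where None means that the label carries no atom. *)
Definition atoms_in (I T : Type) (a : I -> option T) (B : set T) : set I :=
  [set i | exists2 x, B x & a i = Some x].

Definition count_atoms (R : realType) (I : choiceType) (T : Type)
    (a : I -> option T) (B : set T) : \bar R :=
  counting (atoms_in a B).

Section point_process.
Context d (Omega : measurableType d) (R : realType) (P : probability Omega R).
Context d' (T : measurableType d') (I : choiceType).
Implicit Types xi : Omega -> I -> option T.

Definition atom_events xi : set (set Omega) :=
  [set E | exists i B, measurable B /\ E = [set w | atoms_in (xi w) B i]].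

(* The sigma-algebra generated by the enumeration. *)
Definition sigma_atoms xi : set (set Omega) := <<s atom_events xi >>.

Record poisson_process xi (mu : set T -> \bar R) : Prop := {
  poisson_measurable : atom_events xi `<=` measurable ;
  (* the second argument of [poisson_prob] is a dummy *)
  poisson_fin : forall B, measurable B -> (mu B < +oo)%E -> forall n : nat,
    P [set w | count_atoms R (xi w) B = n%:R%:E] =
    poisson_prob (fine (mu B)) 0%N [set n] ;
  poisson_infty : forall B, measurable B -> mu B = +oo%E ->
    P [set w | count_atoms R (xi w) B = +oo%E] = 1%E ;
  poisson_indep : forall (m : nat) (B : 'I_m -> set T),
    (forall j, measurable (B j)) -> trivIset setT B ->
    independent P (fun j => preimage_set_system setT
      (fun w => count_atoms R (xi w) (B j)) (@measurable _ (\bar R))) }.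

End point_process.

Section branching_random_walk.
Context (R : realType).

(* Replaces each atom (t, x) by the atoms (t, x_k) with x_k < +oo. *)
Definition spread (a : nat -> option (R * pstar R)) (ik : nat * nat) :
    option (R * R) :=
  if a ik.1 is Some tx then
    if pseq tx.2 ik.2 is r%:E then Some (tx.1, r) else None
  else None.

(* [off u] enumerates the displacements of the children of the individual u.
   Individuals are words, [i :: v] being the i-th child of v (so words are read
   from right to left); None means that the individual does not exist. *)
Fixpoint position (I : Type) (off : seq I -> I -> option (R * R))
    (u : seq I) : option (R * R) :=
  if u is i :: v then
    if (position off v, off v i) is (Some p, Some q) then
      Some (p.1 + q.1, p.2 + q.2)
    else None
  else Some (0, 0).

Definition brw (I : choiceType) (off : seq I -> I -> option (R * R)) (n : nat) :
    set (R * R) -> \bar R :=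
  count_atoms R (fun u : n.-tuple I => position off u).

Definition frontier (Z : set (R * R) -> \bar R) : \bar R :=
  ereal_sup [set z%:E | z in
    [set z : R | Z (`[0, 1]%classic `*` `[0, z]%classic) = 0%E]].

End branching_random_walk.

Definition cvg_in_probability d (Omega : measurableType d) (R : realType)
    (P : probability Omega R) (X : nat -> Omega -> \bar R) (l : R) : Prop :=
  (forall n, measurable_fun setT (X n)) /\
  forall e : R, 0 < e ->
    P [set w | (e%:E < `|X n w - l%:E|)%E] @[n --> \oo] --> 0%E.

(* Main.v *)
Require Import Defs.
From HB Require Import structures.
From mathcomp Require Import all_boot all_order all_algebra.
From mathcomp Require Import all_classical all_reals all_analysis.
From mathcomp Require Import measurable_realfun.
From mathcomp Require Import ring lra zify.

(* Round the displacements of individuals to a grid of mesh [ht * hz]. A cell of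
   the grid contains on average [ht * hz ^ alpha * omega b / alpha * e_k] atoms
   [(t, x_k)], where [omega b = (b + 1) ^ alpha - b ^ alpha], and the [e_k] sum to
   [c(lambda) = 1 / Gamma(alpha)].

   Rounding down, a union bound over the genealogy and a Chernoff bound with tilts
   [theta = n], [vt = n alpha / z] give
   [P (Z_n ([0, 1] * [0, z]) > 0) <= (e^(1 + alpha) / (theta vt ^ alpha)) ^ n], up to
   rounding, which decays geometrically for [z = C n ^ ((alpha + 1) / alpha)] and
   [C < c_alpha].

   Rounding up, for [C > c_alpha] a Cramer lower bound shows that over [m]
   generations, in a box of [m A * m B] cells with the mesh corresponding to [C],
   the mean number of descendants is at least 2. The probability [eta] that a
   subtree succeeds then satisfies [eta' >= 2 eta - O(eta ^ 2)] after [m] more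
   generations, so it stays bounded away from 0. The root has many children in a
   small box, their subtrees are independent, and so one of them succeeds with
   probability close to 1. *)

Import Order.TTheory GRing.Theory Num.Theory.
Import numFieldNormedType.Exports.

Local Open Scope classical_set_scope.
Local Open Scope ring_scope.

Set Implicit Arguments.
Unset Strict Implicit.
Unset Printing Implicit Defensive.

(** * Incomplete Gamma integrals *)

(** The grid keeps everything countable: the event that atom [i] of an individual lies in a given
    cell belongs to the sigma-algebra of that individual, so events on rounded subtrees are built
    from countable unions, and independence is applied to disjoint families of individuals without
    conditioning on positions. The Poisson law enters through moments of the count of a single set,
    summed over the labels of an arbitrary enumeration.

    The mean content of a cell depends on the mesh only through [kappa = ht * hz ^ alpha]. If [n A]
    cells fill a unit of time and [n B] cells fill [C n ^ ((alpha + 1) / alpha)], then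
    [kappa = C ^ alpha / (A B ^ alpha)] is free of [n]; hence the exponent, and survival bounds
    uniform in [n]. For fine grids the growth rate per generation tends to [C ^ alpha e ^ (1 +
    alpha) / alpha ^ alpha], and [c_alpha] makes it equal to 1.

    Since [c(lambda) < oo] is only a first moment condition, the number of children in a box may
    have infinite variance. The lower bound therefore keeps [K] entries of each sequence, so that
    the number of trials is at most [K] times a Poisson count. *)

Lemma integral_powRB1 (R : realType) (a u v : R) : 0 < a -> 0 <= u <= v ->
  (\int[lebesgue_measure]_(x in `]u, v]) (x `^ (a - 1))%:E =
   ((v `^ a - u `^ a) / a)%:E)%E.
Proof.
move=> a0.
have mp (D : set R) : measurable_fun D (fun x : R => (x `^ (a - 1))%:E).
  apply: measurable_funTS; apply/measurable_EFinP; exact: measurable_powR.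
have dpow (x : R) : 0 < x -> derivable (fun x : R => x `^ a / a) x 1.
  by move=> x0; apply: derivableM => //; apply: derivable_powR; rewrite in_itv/= x0 //.
have cont' (b x : R) : 0 < x -> {for x, continuous (fun x : R => x `^ b)}.
  move=> x0; apply: differentiable_continuous; apply/derivable1_diffP.
  apply: derivable_powR; rewrite in_itv/= x0 //.
have pos w : 0 < w <= v ->
  (\int[lebesgue_measure]_(x in `]w, v]) (x `^ (a - 1))%:E =
   ((v `^ a - w `^ a) / a)%:E)%E.
  move=> /andP[w0]; rewrite le_eqVlt => /orP[/eqP <-|wv].
    by rewrite set_itvoc0 integral_set0 subrr mul0r.
  rewrite integral_itv_obnd_cbnd; last exact: mp.
  have wvx (x : R) : x \in `[w, v] -> 0 < x.
    by rewrite in_itv/= => /andP[wx _]; exact: lt_le_trans wx.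
  rewrite (@continuous_FTC2 _ _ (fun x => x `^ a / a))//.
  - by rewrite -EFinB mulrBl.
  - apply: continuous_in_subspaceT => x /[!inE]/= xw.
    by apply: cont'; exact: wvx.
  - split.
    + move=> x xwv; apply: dpow; apply: wvx; exact: subset_itv_oo_cc xwv.
    + apply: cvg_at_right_filter; apply: cvgMl.
      by apply: cont'.
    + apply: cvg_at_left_filter; apply: cvgMl.
      by apply: cont'; exact: lt_trans wv.
  - move=> x xwv; have x0 : 0 < x by apply: wvx; exact: subset_itv_oo_cc xwv.
    rewrite derive1E deriveM//; last by apply: derivable_powR; rewrite in_itv/= x0.
    rewrite derive_cst scaler0 add0r.
    have [_ ->] := is_derive1_powR a x0.
    by rewrite /GRing.scale/= mulrA mulVf ?gt_eqF// mul1r.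
move=> /andP[]; rewrite le_eqVlt => /orP[/eqP <- v0|u0 uv]; last first.
  by apply: pos; rewrite u0.
move: v0; rewrite le_eqVlt => /orP[/eqP <-|v0].
  by rewrite set_itvoc0 integral_set0 subrr mul0r.
(* For [a < 1] the integrand is unbounded at 0: the fundamental theorem is applied away from 0, and
   [u = 0] follows by monotone convergence. *)
pose F n : set R := `]v / n.+1%:R, v]%classic.
have FE : `]0, v]%classic = \bigcup_n F n.
  apply/seteqP; split=> [x/=|x [n _]]; rewrite ?/F/= !in_itv/=.
    move=> /andP[x0 xv]; exists (Num.trunc (v / x)) => //; rewrite /F/= in_itv/= xv andbT.
    rewrite ltr_pdivrMr// mulrC -ltr_pdivrMr//.
    exact: truncnS_gt.
  by move=> /andP[vx ->]; rewrite andbT (lt_trans _ vx)// divr_gt0.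
have ndF : nondecreasing_seq F.
  move=> m n mn; apply/subsetPset; rewrite /F => x /=; rewrite !in_itv/= => /andP[+ ->].
  rewrite andbT; apply: le_lt_trans.
  by rewrite ler_pM2l// lef_pV2 ?posrE// ler_nat.
rewrite FE; apply/esym.
pose I n := (\int[lebesgue_measure]_(x in F n) (x `^ (a - 1))%:E)%E.
suff [c1 c2] : (I n @[n --> \oo] --> ((v `^ a - 0 `^ a) / a)%:E) /\
   (I n @[n --> \oo] --> (\int[lebesgue_measure]_(x in \bigcup_n F n) (x `^ (a - 1))%:E)%E).
  by rewrite -(cvg_lim _ c1)// -(cvg_lim _ c2).
split; last first.
  apply: (@ge0_nondecreasing_set_cvg_integral _ (measurableTypeR R) R F) => //.
    by move=> i; exact: measurable_itv.
  by move=> i; exact: mp.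
  by move=> n x _; rewrite lee_fin powR_ge0.
have -> : I =
   (fun n => ((v `^ a - (v / n.+1%:R) `^ a) / a)%:E).
  apply/funext => n; rewrite /I pos// divr_gt0//=.
  by rewrite ler_pdivrMr// ler_pMr// ler1n.
apply: cvg_EFin; first by near=> n.
apply: cvgMl; apply: cvgB; first exact: cvg_cst.
rewrite powR0 ?gt_eqF//.
have /cvg_at_rightP := powR_cvg0 a0; apply; split.
  by move=> n; rewrite divr_gt0.
rewrite -[X in _ --> X](mulr0 v); apply: cvgMr.
exact: cvg_harmonic.
Unshelve. all: by end_near. Qed.

Ltac nonneg := repeat first
  [ assumption | exact: expR_ge0 | exact: powR_ge0 | exact: ler0n
  | apply: ltW; assumption | apply: mulr_ge0 | apply: exprn_ge0
  | rewrite invr_ge0 ].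

Lemma powRV (R : realType) (x a : R) : 0 <= x -> x^-1 `^ a = (x `^ a)^-1.
Proof. by move=> x0; rewrite -powR_inv1// powRAC powR_inv1 ?powR_ge0. Qed.

Definition incr_powR (R : realType) (alpha : R) (b : nat) : R :=
  b.+1%:R `^ alpha - b%:R `^ alpha.

(** Lower approximation of the Gamma integral on []0, n h]]: on each cell the power is integrated
    exactly and the exponential is frozen at the right end. *)
Definition gamma_sum (R : realType) (alpha h : R) (n : nat) : R :=
  (\sum_(b < n) incr_powR alpha b * expR (- (b.+1%:R * h))) * (h `^ alpha / alpha).

Lemma incr_powR_ge0 (R : realType) (alpha : R) b : 0 < alpha ->
  0 <= incr_powR alpha b.
Proof.
move=> a0; rewrite /incr_powR subr_ge0 ge0_ler_powR ?nnegrE ?ler_nat//; exact: ltW.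
Qed.

Section gamma_sum.
Context (R : realType) (alpha h : R).
Hypotheses (alpha0 : 0 < alpha) (h0 : 0 < h).

Let g (x : R) : \bar R := (x `^ (alpha - 1) * expR (- x))%:E.
Let J n : \bar R := (\int[lebesgue_measure]_(x in `]0%R, (n%:R * h)%R]) g x)%E.

Let mg (D : set R) : measurable_fun D g.
Proof.
apply: measurable_funTS; apply/measurable_EFinP; apply: measurable_funM.
  exact: measurable_powR.
by apply: measurableT_comp => //; exact: measurableT_comp.
Qed.

Let g0 x : (0 <= g x)%E.
Proof. by rewrite lee_fin mulr_ge0 ?powR_ge0 ?expR_ge0. Qed.

Let cell_int b :
  (\int[lebesgue_measure]_(x in `](b%:R * h)%R, (b.+1%:R * h)%R]) (x `^ (alpha - 1))%:E =
   (incr_powR alpha b * (h `^ alpha / alpha))%:E)%E.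
Proof.
rewrite integral_powRB1//; last first.
  by rewrite ler_pM2r// ler_nat leqnSn mulr_ge0// ltW.
congr EFin; rewrite !powRM ?(ltW h0)//.
by rewrite /incr_powR -mulrBl -mulrA.
Qed.

Let JS n : (J n.+1 = J n +
  \int[lebesgue_measure]_(x in `](n%:R * h)%R, (n.+1%:R * h)%R]) g x)%E.
Proof.
rewrite /J -ge0_integral_setU//=.
- by rewrite -itv_bndbnd_setU// bnd_simp ?mulr_ge0 ?ler_pM2r ?ler_nat// ltW.
- exact: mg.
- rewrite disj_set2E; apply/eqP/seteqP; split=> // x/= [].
  rewrite !in_itv/= => /andP[_ xn] /andP[nx _].
  by move: (le_lt_trans xn nx); rewrite ltxx.
Qed.

(** On a cell of length [h] the exponential varies by a factor at most [e ^ h]. *)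
Lemma gamma_partial n :
  ((gamma_sum alpha h n)%:E <= J n /\ J n <= (expR h * gamma_sum alpha h n)%:E)%E.
Proof.
elim: n => [|n [ih1 ih2]].
  rewrite /J /gamma_sum big_ord0 mul0r mulr0 mul0r set_itvoc0 integral_set0.
  by split.
have S : gamma_sum alpha h n.+1 = gamma_sum alpha h n +
    incr_powR alpha n * (h `^ alpha / alpha) * expR (- (n.+1%:R * h)).
  by rewrite /gamma_sum big_ord_recr/= mulrDl; congr +%R; ring.
have mpw (D : set R) (c : R) : measurable_fun D (fun x => (c%:E * (x `^ (alpha - 1))%:E)%E).
  apply: measurable_funTS; apply: emeasurable_funM => //.
  by apply/measurable_EFinP; exact: measurable_powR.
have intc (c : R) : 0 <= c ->
  (\int[lebesgue_measure]_(x in `](n%:R * h)%R, (n.+1%:R * h)%R]) (c%:E * (x `^ (alpha - 1))%:E) =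
  (incr_powR alpha n * (h `^ alpha / alpha) * c)%:E)%E.
  move=> c0; rewrite ge0_integralZl_EFin//.
  - by rewrite cell_int -EFinM mulrC.
  - by move=> x _; rewrite lee_fin powR_ge0.
  - by apply: measurable_funTS; apply/measurable_EFinP; exact: measurable_powR.
rewrite JS S; split.
  rewrite EFinD leeD// -intc ?expR_ge0//.
  apply: ge0_le_integral => //=; [|exact: mpw|exact: mg|].
  - by move=> x _; rewrite -EFinM lee_fin mulr_ge0 ?expR_ge0 ?powR_ge0.
  - move=> x; rewrite in_itv/= => /andP[_ xn]; rewrite -EFinM lee_fin mulrC.
    by rewrite ler_wpM2l ?powR_ge0// ler_expR lerN2.
rewrite mulrDr EFinD leeD// mulrCA -expRD -intc ?expR_ge0//.
apply: ge0_le_integral => //=; [exact: mg|exact: mpw|].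
move=> x; rewrite in_itv/= => /andP[xn _]; rewrite -EFinM lee_fin mulrC.
  rewrite ler_wpM2r ?powR_ge0// ler_expR lerNl opprD opprK -natr1 mulrDl mul1r.
  by rewrite addrCA addNr addr0 ltW.
Qed.

Lemma gamma_sum_le n : ((gamma_sum alpha h n)%:E <= Gamma alpha)%E.
Proof.
apply: (le_trans (gamma_partial n).1); apply: ge0_subset_integral => //=; first exact: mg.
by move=> x/=; rewrite !in_itv/= => /andP[-> _].
Qed.

Lemma gamma_sum_ge (c : R) : (c%:E < Gamma alpha)%E ->
  \forall n \near \oo, c < expR h * gamma_sum alpha h n.
Proof.
move=> cG.
have FE : `]0, +oo[%classic = \bigcup_n `]0, n%:R * h]%classic.
  apply/seteqP; split=> [x/=|x [n _]/=]; rewrite !in_itv/= ?andbT; last by case/andP.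
  move=> x0; exists (Num.trunc (x / h)).+1 => //=; rewrite in_itv/= x0/=.
  by rewrite -ler_pdivrMr// ltW// truncnS_gt.
have cJ : J n @[n --> \oo] --> Gamma alpha.
  rewrite /Gamma FE.
  apply: (@ge0_nondecreasing_set_cvg_integral _ (measurableTypeR R) R
    (fun n => `]0, n%:R * h]%classic)) => //.
    move=> m n mn; apply/subsetPset => x /=; rewrite !in_itv/= => /andP[->/=].
    by move=> /le_trans; apply; rewrite ler_pM2r// ler_nat.
  by move=> i; exact: mg.
have cnJ : \forall n \near \oo, (c%:E < J n)%E := cJ _ (open_ereal_gt' cG).
near=> n; rewrite -lte_fin; apply: lt_le_trans (gamma_partial n).2.
by near: n.
Unshelve. all: by end_near. Qed.

End gamma_sum.

(** * The intensity measure *)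

Section intensity.
Context (R : realType).

Lemma measurable_pseq k : measurable_fun setT (fun x : pstar R => pseq x k).
Proof.
apply: (measurability _ (ErealGenOInfty.measurableE R)) => //= _ [_ [a ->] <-].
rewrite setTI; apply: sub_sigma_algebra.
have cpr : continuous (fun x : {ptws nat -> \bar R} => x k) by exact: proj_continuous.
have cval : continuous (val : pstar R -> {ptws nat -> \bar R}).
  exact: initial_continuous.
have oU : open [set y : \bar R | (a%:E < y)%E] by exact: open_ereal_gt_ereal.
have -> : (fun x : pstar R => pseq x k) @^-1` `]a%:E, +oo[ =
  val @^-1` ((fun x : {ptws nat -> \bar R} => x k) @^-1` [set y : \bar R | (a%:E < y)%E]).
  by rewrite /preimage; apply/seteqP; split=> x /=; rewrite in_itv/= andbT.
apply: open_comp => [x _|]; first exact: cval.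
by apply: open_comp => // x _; exact: cpr.
Qed.

Lemma pseq_gt0 (x : pstar R) k : (0 < pseq x k)%E.
Proof. by have /set_mem[+ _ _ _] := valP x; apply. Qed.

Lemma pseq_nd (x : pstar R) m n : (m <= n)%N -> (pseq x m <= pseq x n)%E.
Proof. by have /set_mem[_ nd _ _] := valP x; exact: nd. Qed.

Lemma pseq0_fin (x : pstar R) : (pseq x 0 < +oo)%E.
Proof. by have /set_mem[] := valP x. Qed.

Definition layer (k : nat) (u v : R) : set (pstar R) :=
  [set x | (u%:E < pseq x k <= v%:E)%E].

Lemma measurable_layer k u v : measurable (layer k u v).
Proof.
have -> : layer k u v = (fun x : pstar R => pseq x k) @^-1` `]u%:E, v%:E].
  by apply/seteqP; split=> x /=; rewrite in_itv.
by rewrite -[X in measurable X]setTI; apply: measurable_pseq => //; exact: emeasurable_itv.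
Qed.

Context (alpha : R) (lambda : {finite_measure set (pstar R) -> \bar R}).
Hypothesis alpha0 : 0 < alpha.

Lemma measurable_inv_power : measurable_fun setT (inv_power alpha).
Proof.
have -> : inv_power alpha = (fun x : \bar R => if x == +oo%E then 0%E else
    if x == -oo%E then 0%E else (fine x `^ (- alpha))%:E).
  by apply/funext => -[].
apply: measurable_fun_ifT => //.
  by apply: measurable_fun_eqe.
apply: measurable_fun_ifT => //.
  by apply: measurable_fun_eqe.
apply/measurable_EFinP.
exact: (@measurableT_comp _ _ _ _ _ _ (@powR R ^~ (- alpha)) _ fine).
Qed.

Lemma inv_power_ge0 x : (0 <= inv_power alpha x)%E.
Proof. by case: x => [r| |]//=; rewrite lee_fin powR_ge0. Qed.

Definition emean k : \bar R := (\int[lambda]_x inv_power alpha (pseq x k))%E.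

Lemma c_constE : c_const alpha lambda = (\sum_(0 <= k <oo) emean k)%E.
Proof.
rewrite /c_const integral_nneseries//.
- by move=> k; apply: measurableT_comp; [exact: measurable_inv_power|exact: measurable_pseq].
- by move=> k x _; exact: inv_power_ge0.
Qed.

(** By Tonelli, for fixed [x] the scales [y] with [u < y x_k <= v] form []u / x_k, v / x_k]], whose
    mass under [y ^ (alpha - 1) dy] is proportional to [x_k ^ (- alpha)]; there are none when
    [x_k = +oo]. *)
Lemma Lambda_star_layer k (u v : R) : 0 <= u <= v ->
  (Lambda_star alpha lambda (layer k u v) = ((v `^ alpha - u `^ alpha) / alpha)%:E * emean k)%E.
Proof.
move=> uv; have [u0 _] := andP uv.
(* Written with [y * pseq x k] instead of [scale y x], the integrand is visibly jointly measurable;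
   the test [0 < y] excludes the scales at which [scale] is a default value. *)
pose f (z : R * pstar R) : \bar R :=
  (if (0 < z.1)%R && ((u%:E < z.1%:E * pseq z.2 k)%E && (z.1%:E * pseq z.2 k <= v%:E)%E)
   then (z.1 `^ (alpha - 1))%:E else 0)%E.
have mf : measurable_fun setT f.
  have mm : measurable_fun setT (fun z : R * pstar R => z.1%:E * pseq z.2 k)%E.
    apply: emeasurable_funM; first by apply/measurable_EFinP; exact: measurable_fst.
    have ms : measurable_fun setT (snd : R * pstar R -> pstar R) by exact: measurable_snd.
    exact: (measurableT_comp (measurable_pseq k) ms).
  apply: measurable_fun_ifT => //.
    apply: measurable_and; first by apply: measurable_fun_ltr => //; exact: measurable_fst.
    by apply: measurable_and; [exact: measurable_fun_lte|exact: measurable_fun_lee].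
  apply/measurable_EFinP.
  exact: (@measurableT_comp _ _ _ _ _ _ (@powR R ^~ (alpha - 1)) _ fst).
have f0 z : (0 <= f z)%E by rewrite /f; case: ifP => // _; rewrite lee_fin powR_ge0.
have -> : Lambda_star alpha lambda (layer k u v) =
  (\int[lebesgue_measure]_y \int[lambda]_x f (y, x))%E.
  rewrite /Lambda_star /Lambda_star_integral integral_mkcond/=.
  apply: eq_integral => y _; rewrite patchE; case: ifPn; rewrite ?inE ?notin_setE/= in_itv/= andbT.
    move=> y0; rewrite -ge0_integralZl_EFin ?powR_ge0//.
      apply: eq_integral => x _; rewrite /f /= y0/= indicE.
      have -> : (scale y x \in layer k u v) = ((u%:E < y%:E * pseq x k)%E && (y%:E * pseq x k <= v%:E)%E).
        by apply/idP/idP => [/set_mem|h]; [|apply/mem_set]; rewrite /layer/= pseq_scale.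
      by case: ifP => _; rewrite ?mule1 ?mule0.
    apply/measurable_EFinP.
    have -> : (fun x => \1_(layer k u v) (scale y x)) =
        (\1_((fun x => y%:E * pseq x k)%E @^-1` `]u%:E, v%:E]) : pstar R -> R).
      apply/funext => x; rewrite !indicE; congr (nat_of_bool _)%:R.
      by apply/idP/idP => /set_mem h; apply/mem_set; move: h; rewrite /layer/= pseq_scale// in_itv.
    apply: measurable_indic; rewrite -[X in measurable X]setTI.
    have my : measurable_fun setT (fun x : pstar R => y%:E * pseq x k)%E.
      by apply: emeasurable_funM => //; exact: measurable_pseq.
    by apply: my => //; exact: emeasurable_itv.
  by move=> /negP y0; rewrite integral0_eq// => x _; rewrite /f/=; case: ltP y0.
rewrite (@fubini_tonelli _ _ _ _ R lebesgue_measure lambda f mf f0).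
rewrite muleC /emean -ge0_integralZr//; last 3 first.
- by apply: measurableT_comp; [exact: measurable_inv_power|exact: measurable_pseq].
- by move=> x _; exact: inv_power_ge0.
- by rewrite lee_fin divr_ge0 ?(ltW alpha0)// subr_ge0 ge0_ler_powR ?nnegrE ?(ltW alpha0)//; case/andP: uv => // _; exact: le_trans.
apply: eq_integral => x _.
have := pseq_gt0 x k; case xk : (pseq x k) => [r| |]//; rewrite ?lte_fin => r0.
  rewrite /=; have -> : (\int[lebesgue_measure]_y f (y, x) =
      \int[lebesgue_measure]_(y in `](u / r)%R, (v / r)%R]) (y `^ (alpha - 1))%:E)%E.
    rewrite [RHS]integral_mkcond; apply: eq_integral => y _; rewrite patchE /f/= xk -EFinM !lte_fin lee_fin.
    have -> : (y \in `](u / r)%R, (v / r)%R]%classic) = (u < y * r) && (y * r <= v).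
      by rewrite mem_setE in_itv/= ltr_pdivrMr// ler_pdivlMr.
    have [y0|y0] := ltP 0 y => //=.
    rewrite ifF//; apply/negP => /andP[uy _].
    by have := lt_le_trans uy (mulr_le0_ge0 y0 (ltW r0)); rewrite ltNge u0.
  rewrite integral_powRB1//; last by rewrite divr_ge0 ?(ltW r0)// ler_pM2r ?invr_gt0//; case/andP: uv.
  rewrite -EFinM; congr EFin.
  rewrite !powRM ?invr_ge0 ?(ltW r0)//; last by case/andP: uv; exact: le_trans.
  by rewrite powRV ?(ltW r0)// powRN; ring.
rewrite /= mul0e integral0_eq// => y _; rewrite /f/= xk.
by have [y0|//] := ltP 0 y; rewrite /= gt0_muley ?lte_fin// leye_eq andbF.
Qed.

(** [Lambda_star] is a bare set function, so the product is evaluated by sections; the proof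
    evaluates intensities on rectangles only. *)
Lemma intensityX (A : set R) (B : set (pstar R)) : measurable A ->
  (intensity alpha lambda (A `*` B) =
   lebesgue_measure (A `&` `]0%R, +oo[%classic) * Lambda_star alpha lambda B)%E.
Proof.
move=> mA; rewrite /intensity /product_measure1/=.
have L0 : Lambda_star alpha lambda set0 = 0%E.
  rewrite /Lambda_star /Lambda_star_integral integral0_eq// => y _.
  by rewrite integral0_eq ?mule0// => x _; rewrite /= indic0.
have LB : (0 <= Lambda_star alpha lambda B)%E.
  apply: integral_ge0 => y _; rewrite mule_ge0// ?lee_fin ?powR_ge0//.
  by apply: integral_ge0 => x _; rewrite lee_fin.
transitivity (\int[mrestr lebesgue_measure (@measurable_itv R `]0%R, +oo[)]_x
    ((\1_A x)%:E * Lambda_star alpha lambda B))%E.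
  apply: eq_integral => x _; rewrite indicE; have [xA|xA] /= := boolP (x \in A).
    by rewrite in_xsectionX// mul1e.
  by rewrite notin_xsectionX// mul0e.
rewrite ge0_integralZr//=; last by apply/measurable_EFinP; exact: measurable_indic.
by rewrite integral_indic// setIT.
Qed.

End intensity.

(** * Moments of Poisson counts *)

Section poisson_series.
Context (R : realType).

Definition poisson_weight (m : R) (n : nat) : R := m ^+ n / n`!%:R * expR (- m).

Lemma poisson_weight_ge0 m n : 0 <= m -> 0 <= poisson_weight m n.
Proof. by move=> m0; rewrite /poisson_weight !mulr_ge0 ?invr_ge0 ?exprn_ge0 ?expR_ge0. Qed.

Lemma poisson_weightS m n : n.+1%:R * poisson_weight m n.+1 = m * poisson_weight m n.
Proof.
rewrite /poisson_weight factS natrM exprS; field.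
by rewrite !(nat1r, pnatr_eq0) -!lt0n fact_gt0.
Qed.

Lemma poisson_prob1 m n : 0 <= m -> poisson_prob m 0%N [set n] = (poisson_weight m n)%:E.
Proof.
rewrite le_eqVlt => /orP[/eqP <-|m0]; rewrite /poisson_prob.
  rewrite ltxx /poisson_weight diracE oppr0 expR0 mulr1 expr0n.
  by case: n => [|n]; [rewrite mem_set// fact0 invr1 mulr1|rewrite memNset// mul0r].
by rewrite m0 esum_set1 ?lee_fin ?poisson_pmf_ge0// /poisson_pmf m0.
Qed.

Lemma sum_poisson m : 0 <= m -> (\sum_(0 <= n <oo) (poisson_weight m n)%:E = 1)%E.
Proof.
move=> m0.
under eq_eseriesr do rewrite /poisson_weight mulrC EFinM.
rewrite nneseriesZl/=; last by move=> n _; rewrite lee_fin divr_ge0// exprn_ge0.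
rewrite [RHS](_ : _ = (expR (- m))%:E * (expR m)%:E)%E; last first.
  by rewrite -EFinM -expRD addNr expR0.
congr (_ * _)%E; rewrite expRE -EFin_lim; last first.
  rewrite /pseries/=; under eq_fun do rewrite mulrC.
  exact: is_cvg_series_exp_coeff.
apply/congr_lim/funext => n/=; rewrite /pseries/= /series/= -sumEFin//.
by under eq_bigr do rewrite mulrC.
Qed.

Lemma mean_poisson m : 0 <= m ->
  (\sum_(0 <= n <oo) (n%:R * poisson_weight m n)%:E = m%:E)%E.
Proof.
move=> m0; rewrite nneseries_recl//; last first.
  by move=> n _; rewrite lee_fin mulr_ge0 ?poisson_weight_ge0.
rewrite mul0r add0e -(@nneseries_addn _ _ 1); last first.
  by move=> n; rewrite lee_fin mulr_ge0 ?poisson_weight_ge0.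
under eq_eseriesr do rewrite addn1 poisson_weightS EFinM.
rewrite nneseriesZl ?sum_poisson ?mule1// => n _.
by rewrite lee_fin poisson_weight_ge0.
Qed.

Lemma sqr_mean_poisson m : 0 <= m ->
  (\sum_(0 <= n <oo) (n%:R ^+ 2 * poisson_weight m n)%:E = (m + m ^+ 2)%:E)%E.
Proof.
move=> m0; rewrite nneseries_recl//; last first.
  by move=> n _; rewrite lee_fin mulr_ge0 ?exprn_ge0 ?poisson_weight_ge0.
rewrite expr0n mul0r add0e -(@nneseries_addn _ _ 1); last first.
  by move=> n; rewrite lee_fin mulr_ge0 ?exprn_ge0 ?poisson_weight_ge0.
transitivity (\sum_(0 <= n <oo) (m%:E * (poisson_weight m n)%:E + m%:E * (n%:R * poisson_weight m n)%:E))%E.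
  apply: eq_eseriesr => n _.
  by rewrite addn1 expr2 -mulrA poisson_weightS -!EFinM -EFinD -natr1; congr EFin; ring.
rewrite nneseriesD; last 2 first.
- by move=> n _ _; rewrite -EFinM lee_fin mulr_ge0 ?poisson_weight_ge0.
- by move=> n _ _; rewrite -EFinM lee_fin mulr_ge0// mulr_ge0 ?poisson_weight_ge0.
rewrite !nneseriesZl; last 2 first.
- by move=> n _; rewrite lee_fin mulr_ge0 ?poisson_weight_ge0.
- by move=> n _; rewrite lee_fin poisson_weight_ge0.
by rewrite sum_poisson// mean_poisson// mule1 -EFinM -EFinD expr2.
Qed.

Lemma expR_ge_coeff (m : R) k : 0 <= m -> m ^+ k / k`!%:R <= expR m.
Proof.
move=> m0.
have w0 n : 0 <= poisson_weight m n by exact: poisson_weight_ge0.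
have : ((poisson_weight m k)%:E <= 1)%E.
  rewrite -(sum_poisson m0) (@nneseriesD1 _ _ k)//; last by move=> n _; rewrite lee_fin.
  by rewrite leeDl// nneseries_ge0// => n _ _; rewrite lee_fin.
rewrite lee_fin /poisson_weight expRN ler_pdivrMr ?expR_gt0// mul1r.
exact.
Qed.

(** Crude, but it tends to 0 as [m] grows: for [j < k], [m ^ j <= m ^ (k - 1)] and
    [m ^ k / k! <= e ^ m], so each weight is at most [k! / m]. *)
Lemma poisson_tail (m : R) k : 1 <= m ->
  \sum_(j < k) poisson_weight m j <= k%:R * (k`!%:R / m).
Proof.
move=> m1; have m0 : 0 < m by exact: lt_le_trans m1.
apply: (@le_trans _ _ (\sum_(j < k) (k`!%:R / m))); last first.
  by rewrite sumr_const card_ord -[leLHS]mulr_natl.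
apply: ler_sum => j _; rewrite /poisson_weight expRN.
rewrite ler_pdivrMr ?expR_gt0//.
have := expR_ge_coeff k (ltW m0) => h.
apply: (@le_trans _ _ (k`!%:R / m * (m ^+ k / k`!%:R))); last first.
  by rewrite ler_wpM2l// divr_ge0 ?(ltW m0).
have -> : k`!%:R / m * (m ^+ k / k`!%:R) = m ^+ k.-1.
  have f0 : k`!%:R != 0 :> R by rewrite pnatr_eq0 -lt0n fact_gt0.
  case: k j h f0 => [[]//|k] _ _; set f := k.+1`!%:R => f0; rewrite [m ^+ k.+1]exprS.
  by rewrite /=; field; rewrite f0 gt_eqF.
apply: (@le_trans _ _ (m ^+ j)).
  by rewrite ler_pdivrMr ?ltr0n ?fact_gt0// ler_peMr ?exprn_ge0 ?(ltW m0)// ler1n fact_gt0.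
by apply: ler_weXn2l => //; case: k j {h} => [[]//|k j]; rewrite -ltnS.
Qed.

End poisson_series.

Section poisson_count.
Context d (Omega : measurableType d) (R : realType) (P : probability Omega R).
Context d' (T : measurableType d') (xi : Omega -> nat -> option T) (mu : set T -> \bar R).
Hypothesis ppp : poisson_process P xi mu.

Definition atom_event (B : set T) (i : nat) : set Omega := [set w | atoms_in (xi w) B i].

Lemma measurable_atom_event B i : measurable B -> measurable (atom_event B i).
Proof. by move=> mB; apply: (poisson_measurable ppp); exists i, B. Qed.

(** Restricting to labels below [I] gives a finite real sum, to which bounds for finitely many
    trials apply before [I] tends to infinity. *)
Definition truncated_count (B : set T) (I : nat) (w : Omega) : R :=
  \sum_(i < I) \1_(atom_event B i) w.

Lemma measurable_truncated_count B I : measurable B ->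
  measurable_fun setT (truncated_count B I).
Proof.
move=> mB; apply: measurable_sum => i.
by apply: measurable_indic; exact: measurable_atom_event.
Qed.

Lemma truncated_count_ge0 B I w : 0 <= truncated_count B I w.
Proof. by apply: sumr_ge0 => i _; rewrite indicE. Qed.

Lemma count_atomsE B w :
  count_atoms R (xi w) B = (\sum_(0 <= i <oo) (\1_(atom_event B i) w)%:E)%E.
Proof.
rewrite /count_atoms counting_dirac; apply: eq_eseriesr => i _.
by rewrite diracE indicE; congr (_%:R%:E).
Qed.

Lemma truncated_count_le B I w : ((truncated_count B I w)%:E <= count_atoms R (xi w) B)%E.
Proof.
rewrite count_atomsE /truncated_count -sumEFin -(big_mkord xpredT (fun i => (\1_(atom_event B i) w)%:E)).
by apply: nneseries_lim_ge => i _; rewrite lee_fin indicE.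
Qed.

Context (B : set T) (m : R).
Hypotheses (mB : measurable B) (muB : mu B = m%:E) (m0 : 0 <= m).
Let N w := count_atoms R (xi w) B.
Let D n := [set w | N w = n%:R%:E].

Let mN : measurable_fun setT N.
Proof.
rewrite (_ : N = fun w => (\sum_(0 <= i <oo) (\1_(atom_event B i) w)%:E)%E); last first.
  by apply/funext => w; exact: count_atomsE.
apply: (ge0_emeasurable_sum (P := xpredT)) => [i w _ _|i _]; first by rewrite lee_fin.
apply/measurable_EFinP; apply: measurable_indic; exact: measurable_atom_event.
Qed.

Let mD n : measurable (D n).
Proof.
have -> : D n = setT `&` N @^-1` [set n%:R%:E] by rewrite setTI.
exact: mN.
Qed.

Let PD n : P (D n) = (poisson_weight m n)%:E.
Proof.
have := poisson_fin ppp mB; rewrite muB => /(_ (ltry _) n) /=.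
by rewrite /D poisson_prob1.
Qed.

Let tD : trivIset setT D.
Proof.
apply/trivIsetP => i j _ _ ij; apply/seteqP; split => // w [].
by rewrite /D/= => -> [] /eqP; rewrite eqr_nat (negbTE ij).
Qed.

(** The Poisson weights sum to 1, so the events [D n] carry the full mass, an infinite count is a
    null event, and expectations become series. *)
Let integral_count (f : Omega -> \bar R) (c : nat -> R) :
  measurable_fun setT f -> (forall w, 0 <= f w)%E ->
  (forall n w, N w = n%:R%:E -> f w = (c n)%:E) ->
  (\int[P]_w f w = \sum_(0 <= n <oo) (c n * poisson_weight m n)%:E)%E.
Proof.
move=> mf f0 fc.
have mDD : measurable (\bigcup_n D n) by exact: bigcupT_measurable.
have PDD : P (\bigcup_n D n) = 1%E.
  rewrite measure_bigcup//.
  rewrite -(sum_poisson m0) eseries_mkcond; apply: eq_eseriesr => n _.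
  by rewrite mem_set//; exact: PD.
have PC : P (~` \bigcup_n D n) = 0%E by rewrite probability_setC// PDD subee.
rewrite -(setUv (\bigcup_n D n)) ge0_integral_setU//=; last 3 first.
- exact: measurableC.
- by rewrite setUv.
- by rewrite disj_set2E setICr.
rewrite [X in (_ + X)%E](_ : _ = 0%E) ?adde0; last first.
  apply: null_set_integral => //; first exact: measurableC.
  by apply: measurable_funTS.
rewrite ge0_integral_bigcup//; last by apply: measurable_funTS.
apply: eq_eseriesr => n _.
rewrite (eq_integral (cst (c n)%:E)); last by move=> w /set_mem; exact: fc.
by rewrite integral_cst// EFinM -PD.
Qed.

(** The mean count is computed in two ways, label by label and from the Poisson law. This first
    moment formula turns sums over labels into intensities, whatever the enumeration. *)
Lemma sum_atom_event : (\sum_(0 <= i <oo) P (atom_event B i) = m%:E)%E.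
Proof.
transitivity (\int[P]_w N w)%E.
  rewrite (eq_integral (fun w => (\sum_(0 <= i <oo) (\1_(atom_event B i) w)%:E)%E)); last first.
    by move=> w _; exact: count_atomsE.
  rewrite integral_nneseries//.
  - apply: eq_eseriesr => i _; rewrite integral_indic ?setIT//.
    exact: measurable_atom_event.
  - by move=> i; apply/measurable_EFinP; apply: measurable_indic; exact: measurable_atom_event.
by rewrite (integral_count mN (c := fun n => n%:R))// mean_poisson.
Qed.

Lemma integral_truncated_count_sqr I :
  (\int[P]_w (truncated_count B I w ^+ 2)%:E <= (m + m ^+ 2)%:E)%E.
Proof.
have N0 w : (0 <= N w)%E by exact: measure_ge0.
rewrite -(sqr_mean_poisson m0) -(@integral_count (fun w => N w * N w)%E (fun n => n%:R ^+ 2)).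
- apply: ge0_le_integral => //.
  + by move=> w _; rewrite lee_fin sqr_ge0.
  + apply/measurable_EFinP; apply: measurable_funX; exact: measurable_truncated_count.
  + exact: emeasurable_funM.
  + move=> w _; rewrite expr2 EFinM lee_pmul ?lee_fin ?truncated_count_ge0//; exact: truncated_count_le.
- exact: emeasurable_funM.
- by move=> w; rewrite mule_ge0.
- by move=> n w ->; rewrite -EFinM expr2.
Qed.

(** Continuity from above: as [I] grows, the events decrease to the event that the full count is
    less than [k]. *)
Lemma truncated_count_lt (k : nat) (e : R) : 0 < e ->
  exists I, (P [set w | (truncated_count B I w < k%:R)%R] <=
    (\sum_(j < k) poisson_weight m j + e)%:E)%E.
Proof.
move=> e0; pose A I := [set w | truncated_count B I w < k%:R].
have mA I : measurable (A I).
  rewrite -[A I]setTI; have -> : A I = truncated_count B I @^-1` `]-oo, k%:R[.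
    by apply/seteqP; split=> w /=; rewrite in_itv.
  by apply: measurable_truncated_count.
have niA : nonincreasing_seq A.
  move=> I J IJ; apply/subsetPset => w; rewrite /A/=; apply: le_lt_trans.
  rewrite /truncated_count -!(big_mkord xpredT (fun i => \1_(atom_event B i) w)).
  rewrite [leRHS](@big_cat_nat _ _ _ I)//= lerDl.
  by apply: sumr_ge0 => i _; rewrite indicE.
have cA : P (A I) @[I --> \oo] --> P (\bigcap_I A I).
  apply: nonincreasing_cvg_mu => //.
  - by rewrite (le_lt_trans (probability_le1 _ _)) ?ltry.
  - exact: bigcapT_measurable.
have PA : (P (\bigcap_I A I) <= (\sum_(j < k) poisson_weight m j)%:E)%E.
  apply: (@le_trans _ _ (P (\big[setU/set0]_(j < k) D j))).
    apply: le_measure; rewrite ?inE.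
    - exact: bigcapT_measurable.
    - exact: bigsetU_measurable.
    move=> w Aw; rewrite -bigcup_mkord.
    have Nk : (N w <= k.-1%:R%:E)%E.
      rewrite /N count_atomsE; apply: lime_le; first by apply: is_cvg_nneseries => i _ _; rewrite lee_fin.
      apply: nearW => I; rewrite big_mkord sumEFin lee_fin.
      have := Aw I Logic.I; rewrite /A/= /truncated_count.
      under eq_bigr do rewrite indicE.
      rewrite -natr_sum ltr_nat ler_nat; case: k {Aw A mA niA cA} => // k.
    (* A finite value of [counting] is the cardinal of a finite set, which exhibits the index [j] of
       the event [D j]. *)
    have : N w \is a fin_num by rewrite ge0_fin_numE ?(le_lt_trans Nk) ?ltry//; exact: measure_ge0.
    move: Nk; rewrite {1 2}/N /count_atoms /counting; case: ifPn => [/asboolP fA|//] Nk _.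
    exists (size (finmap.enum_fset (fset_set (atoms_in (xi w) B)))) => /=; last first.
      by rewrite /D/= /N /count_atoms /counting asboolT.
    have k0 : (0 < k)%N.
      have := Aw 0%N Logic.I; rewrite /A/= /truncated_count big_ord0 ltr0n.
      exact.
    move: Nk; rewrite lee_fin ler_nat => h; rewrite (leq_ltn_trans h)// prednK//.
  rewrite measure_semi_additive_ord//; last exact: bigsetU_measurable.
    rewrite -sumEFin; apply: lee_sum => j _.
    by rewrite le_eqVlt; apply/orP; left; apply/eqP; exact: PD.
  apply/trivIsetP => i j _ _ ij; move/trivIsetP : tD; apply => //.
have lt1 : (P (\bigcap_I A I) < (\sum_(j < k) poisson_weight m j + e)%:E)%E.
  by apply: le_lt_trans PA _; rewrite lte_fin ltrDl.
have [I0 _ hI] := cA _ (open_ereal_lt' lt1).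
by exists I0; apply: ltW; apply: hI => /=.
Qed.

End poisson_count.

(** * Independence of blocks of individuals *)

Section independent_blocks.
Context d (Omega : measurableType d) (R : realType) (P : probability Omega R).
Context (J : eqType) (F : J -> set (set Omega)).
Hypotheses (Fm : forall j, F j `<=` measurable) (FT : forall j, F j setT)
  (FI : forall j, setI_closed (F j)) (indF : independent P F).

Definition block (S : set J) : set (set Omega) := <<s \bigcup_(j in S) F j >>.

Lemma block_measurable S : block S `<=` measurable.
Proof.
apply: smallest_sub; first exact: sigma_algebra_measurable.
by move=> A [j _ FA]; exact: Fm FA.
Qed.

Lemma sub_block (S S' : set J) : S `<=` S' -> block S `<=` block S'.
Proof.
move=> SS'; apply: smallest_sub; first exact: smallest_sigma_algebra.
by move=> A [j Sj FA]; apply: sub_sigma_algebra; exists j => //; exact: SS'.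
Qed.

Lemma block_gen S j A : S j -> F j A -> block S A.
Proof. by move=> Sj FA; apply: sub_sigma_algebra; exists j. Qed.

Lemma blockT S : block S setT.
Proof. by rewrite -setC0; have [? + _] := smallest_sigma_algebra setT (\bigcup_(j in S) F j); rewrite -setTD; exact. Qed.

Lemma blockC S A : block S A -> block S (~` A).
Proof. by have [_ + _] := smallest_sigma_algebra setT (\bigcup_(j in S) F j); rewrite -setTD; exact. Qed.

Lemma block_bigcup S (A : nat -> set Omega) :
  (forall n, block S (A n)) -> block S (\bigcup_n A n).
Proof. by have [_ _] := smallest_sigma_algebra setT (\bigcup_(j in S) F j); exact. Qed.

Lemma blockU S A B : block S A -> block S B -> block S (A `|` B).
Proof.
move=> SA SB; rewrite -bigcup2E; apply: block_bigcup => -[|[|n]]//=.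
by rewrite -setCT; apply: blockC; exact: blockT.
Qed.

Lemma blockI S A B : block S A -> block S B -> block S (A `&` B).
Proof.
by move=> SA SB; rewrite -[X in block S X]setCK setCI; apply: blockC; apply: blockU; exact: blockC.
Qed.

(** The pi-system generating [block S], on which [independent] gives the product formula
    directly. *)
Let rect (S : set J) : set (set Omega) := [set A | exists (s : seq J) (E : J -> set Omega),
  [/\ uniq s, forall j, j \in s -> S j, forall j, F j (E j) & A = \bigcap_(j in [set` s]) E j]].

Let rectI S : setI_closed (rect S).
Proof.
move=> A B [s [E [us sS EF ->]]] [t [G [ut tS GF ->]]].
exists (undup (s ++ t)), (fun j => (if j \in s then E j else setT) `&` (if j \in t then G j else setT)).
split.
- exact: undup_uniq.
- by move=> j; rewrite mem_undup mem_cat => /orP[/sS|/tS].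
- by move=> j; apply: FI; case: ifP.
- apply/seteqP; split => w.
    move=> [Ew Gw] j /=; rewrite mem_undup mem_cat => _.
    by split; case: ifP => // js; [exact: Ew|exact: Gw].
  move=> h; split => j /= js; have := h j; rewrite /= mem_undup mem_cat js ?orbT => /(_ isT)[];
    by [].
Qed.

Let rect_indep (S S' : set J) A B : (forall j, S j -> ~ S' j) ->
  rect S A -> rect S' B -> P (A `&` B) = (P A * P B)%E.
Proof.
move=> SS' [s [E [us sS EF ->]]] [t [G [ut tS GF ->]]].
have st : uniq (s ++ t).
  rewrite cat_uniq us ut andbT; apply/hasPn => j jt; apply/negP => /sS Sj.
  exact: (SS' j Sj (tS j jt)).
have -> : \bigcap_(j in [set` s]) E j `&` \bigcap_(j in [set` t]) G j =
    \bigcap_(j in [set` s ++ t]) (if j \in s then E j else G j).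
  apply/seteqP; split => w.
    move=> [Ew Gw] j /=; rewrite mem_cat; case: ifP => [js _|_ jt]; [exact: Ew|exact: Gw].
  move=> h; split => j /= jst; have := h j; rewrite /= mem_cat jst ?orbT => /(_ isT)//.
  by case: ifP => // js; case: (SS' j (sS _ js) (tS _ jst)).
rewrite indF//; last by move=> j _; case: ifP.
rewrite big_cat/= [in RHS]indF// [in RHS]indF//; congr (_ * _)%E.
  by rewrite big_seq [RHS]big_seq; apply: eq_bigr => j ->.
rewrite big_seq [RHS]big_seq; apply: eq_bigr => j jt.
by case: ifP => // js; case: (SS' j (sS _ js) (tS _ jt)).
Qed.

Let block_rect S : block S `<=` <<s rect S >>.
Proof.
apply: smallest_sub; first exact: smallest_sigma_algebra.
move=> A [j Sj FA]; apply: sub_sigma_algebra; exists [:: j], (fun k => if k == j then A else setT); split => //.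
- by move=> k; rewrite inE => /eqP ->.
- by move=> k; case: eqP => [->|].
- apply/seteqP; split => w; first by move=> Aw k /=; rewrite inE => /eqP ->; rewrite eqxx.
  by move=> /(_ j)/=; rewrite inE eqxx; exact.
Qed.

(** As functions of [A], both sides are finite measures with the same total mass, so agreement on a
    pi-system is enough. [block_indep] applies this to each of the two events in turn. *)
Let indep_ext (G : set (set Omega)) (B : set Omega) : measurable B ->
  setI_closed G -> G `<=` measurable ->
  (forall A, G A -> P (A `&` B) = (P A * P B)%E) ->
  forall A, <<s G >> A -> P (A `&` B) = (P A * P B)%E.
Proof.
move=> mB GI Gm GP.
have PB0 : 0 <= fine (P B) by rewrite fine_ge0// measure_ge0.
pose k : {nonneg R} := NngNum PB0.
have PBE : P B = k%:num%:E by rewrite /= fineK// fin_num_measure.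
have HE : [set X | G X /\ X `<=` setT] = G by apply/seteqP; split=> [X []|X].
have := @g_sigma_algebra_measure_unique_trace _ R Omega G setT measurableT _ _
  (mrestr P mB) (mscale k P).
rewrite HE => /(_ Gm GI) h A GA.
have -> : (P A * P B)%E = mscale k P A by rewrite /mscale muleC PBE.
have -> : P (A `&` B) = mrestr P mB A by [].
apply: h => //.
- transitivity (P (setT `&` B)) => //; rewrite setTI.
  rewrite PBE; transitivity (k%:num%:E * P setT)%E => //.
  by rewrite probability_setT mule1.
- move=> X GX; transitivity (P (X `&` B)) => //.
  by rewrite GP// muleC PBE.
- change (P (setT `&` B) < +oo)%E.
  by rewrite setTI (le_lt_trans (probability_le1 _ _)) ?ltry.
Qed.

Let rect_measurable S : rect S `<=` measurable.
Proof.
move=> A [s [E [_ _ EF ->]]]; apply: fin_bigcap_measurable => // j _.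
by apply: Fm; exact: EF.
Qed.

Lemma block_indep (S S' : set J) A B : (forall j, S j -> ~ S' j) ->
  block S A -> block S' B -> P (A `&` B) = (P A * P B)%E.
Proof.
move=> SS' SA SB.
apply: (indep_ext (block_measurable SB) (@rectI S) (@rect_measurable S) _ (block_rect SA)).
move=> {SA}A rA; rewrite setIC muleC.
have mA := rect_measurable rA.
apply: (indep_ext mA (@rectI S') (@rect_measurable S') _ (block_rect SB)).
by move=> {SB}B rB; rewrite setIC muleC; exact: (rect_indep SS').
Qed.

End independent_blocks.

(** * Conditionally independent trials *)

Lemma measure_bigsetU_le d (T : measurableType d) (R : realType)
    (mu : {measure set T -> \bar R}) (I : Type) (s : seq I) (A : I -> set T) :
  (forall i, measurable (A i)) ->
  (mu (\big[setU/set0]_(i <- s) A i) <= \sum_(i <- s) mu (A i))%E.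
Proof.
move=> mA; elim: s => [|i s ih]; first by rewrite !big_nil measure0.
rewrite !big_cons; apply: le_trans (leeD2l _ ih).
by apply: measureU2 => //; exact: bigsetU_measurable.
Qed.

Section conditional_product.
Context d (Omega : measurableType d) (R : realType) (P : probability Omega R).
Context (J : eqType) (F : J -> set (set Omega)).
Hypotheses (Fm : forall j, F j `<=` measurable) (FT : forall j, F j setT)
  (FI : forall j, setI_closed (F j)) (indF : independent P F).
Context (L : eqType) (C : finType) (lab : L -> Omega -> C)
  (G : L -> C -> set Omega) (a : C -> R) (S0 : set J) (Sb : L -> set J).
Hypotheses (labS0 : forall l c, block F S0 [set w | lab l w = c])
  (GSb : forall l c, block F (Sb l) (G l c))
  (a01 : forall c, 0 <= a c <= 1) (aG : forall l c, ((a c)%:E <= P (G l c))%E)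
  (S0Sb : forall l j, S0 j -> ~ Sb l j)
  (SbSb : forall l l' j, l != l' -> Sb l j -> ~ Sb l' j).

Let fail_all (s : seq L) : set Omega := [set w | forall l, l \in s -> ~ G l (lab l w) w].

Let bm S := @block_measurable _ _ _ F Fm S.

Let mlab l c : measurable [set w | lab l w = c].
Proof. exact: bm (labS0 l c). Qed.

Let mG l c : measurable (G l c).
Proof. exact: (block_measurable Fm (@GSb l c)). Qed.

Lemma measurable_fail_all s : measurable (fail_all s).
Proof.
have -> : fail_all s = \bigcap_(l in [set` s]) \bigcap_(c in [set: C])
   (~` ([set w | lab l w = c] `&` G l c)).
  apply/seteqP; split => w.
    by move=> h l /= ls c _ [] /= lc; rewrite -lc; exact: h.
  by move=> h l ls Glw; apply: (h l ls (lab l w) Logic.I).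
apply: fin_bigcap_measurable => // l _; apply: fin_bigcap_measurable => // c _.
by apply: measurableC; apply: measurableI; [exact: mlab|exact: mG].
Qed.

Lemma measurable_fun_lab (f : C -> R) l : measurable_fun setT (fun w => f (lab l w)).
Proof.
move=> _ Y mY; rewrite setTI.
have -> : (fun w => f (lab l w)) @^-1` Y = \bigcup_(c in [set c | Y (f c)]) [set w | lab l w = c].
  by apply/seteqP; split=> [w Yw|w [c Yc /= lc]]; [exists (lab l w)|rewrite /= lc].
by apply: fin_bigcup_measurable.
Qed.

Let mprod s : measurable_fun setT (fun w => (\prod_(l <- s) (1 - a (lab l w)))%:E).
Proof.
apply/measurable_EFinP; apply: measurable_prod => l _.
exact: (measurable_fun_lab (fun c => 1 - a c)).
Qed.

Let prod_ge0 s w : 0 <= \prod_(l <- s) (1 - a (lab l w)).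
Proof. by apply: prodr_ge0 => l _; rewrite subr_ge0; have /andP[] := a01 (lab l w). Qed.

Let part (X : set Omega) l : X = \big[setU/set0]_(c : C) (X `&` [set w | lab l w = c]).
Proof.
apply/seteqP; split => w.
  move=> Xw; rewrite (bigD1 (lab l w))//=; left; split => //.
by elim/big_ind: _ => //= [A B hA hB [/hA|/hB]|c _ []].
Qed.

(** The events [X] and [H] carry the induction. After splitting by the value [c] of [lab l], [X]
    absorbs [lab l = c] within the block of [S0], while [H] absorbs the failure [~ G l c] and its
    block grows from [S] to [S] and [Sb l] together. This replaces conditioning on the labels. *)
Let fail_le s X S H : uniq s -> block F S0 X -> block F S H ->
  (forall j, S0 j -> ~ S j) -> (forall l j, l \in s -> S j -> ~ Sb l j) ->
  (P (X `&` H `&` fail_all s) <=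
   P H * \int[P]_(w in X) (\prod_(l <- s) (1 - a (lab l w)))%:E)%E.
Proof.
elim: s X S H => [|l s ih] X S H us SX SH S0S SSb.
  have -> : fail_all [::] = setT by apply/seteqP; split.
  under eq_integral do rewrite big_nil.
  rewrite setIT integral_cst ?mul1e; last exact: bm SX.
  by rewrite (block_indep Fm FT FI indF _ SX SH)// muleC.
move: us; rewrite /= => /andP[ls us].
have mX := bm SX; have mH := bm SH.
have mXc c : measurable (X `&` [set w | lab l w = c]) by exact: measurableI.
have tX : trivIset setT (fun c => X `&` [set w | lab l w = c]).
  by apply/trivIsetP => c c' _ _ cc'; apply/seteqP; split => // w [[_ /= ->] [_ /= /eqP]]; rewrite (negbTE cc').
have uC : uniq (index_enum C) by exact: index_enum_uniq.
have step c : (P (X `&` H `&` fail_all (l :: s) `&` [set w | lab l w = c]) <=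
  P H * ((1 - a c)%:E * \int[P]_(w in X `&` [set w | lab l w = c]) (\prod_(l <- s) (1 - a (lab l w)))%:E))%E.
  apply: (@le_trans _ _ (P ((X `&` [set w | lab l w = c]) `&` (H `&` ~` G l c) `&` fail_all s))).
    apply: le_measure; rewrite ?inE.
    - by apply: measurableI => //; apply: measurableI; [exact: measurableI|exact: measurable_fail_all].
    - apply: measurableI; last exact: measurable_fail_all.
      by apply: measurableI => //; apply: measurableI => //; apply: measurableC; exact: mG.
    - move=> w [[[Xw Hw] fw] /= lc]; split.
        split => //; split => //= Gc; apply: (fw l); rewrite ?mem_head// lc//.
      by move=> l' l's; apply: fw; rewrite inE l's orbT.
  have SX' : block F S0 (X `&` [set w | lab l w = c]) by exact: blockI.
  have SH' : block F (S `|` Sb l) (H `&` ~` G l c).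
    apply: blockI; first by apply: sub_block SH; exact: subsetUl.
    by apply: blockC; apply: sub_block (@GSb l c); exact: subsetUr.
  apply: (le_trans (ih _ _ _ us SX' SH' _ _)).
  - by move=> j S0j [/(S0S _ S0j)|/(S0Sb S0j)].
  - move=> l' j l's [Sj|Sbj]; first by apply: SSb => //; rewrite inE l's orbT.
    by apply: (@SbSb l l') => //; apply: contraNneq ls => ->.
  rewrite (block_indep Fm FT FI indF _ SH (blockC (@GSb l c))); last first.
    by move=> j Sj; apply: SSb => //; rewrite mem_head.
  rewrite -muleA lee_wpmul2l//; apply: lee_wpmul2r.
    by apply: integral_ge0 => w _; rewrite lee_fin.
  rewrite probability_setC; last exact: mG.
  by rewrite EFinB leeB.
have mf D : measurable_fun D (fun w => (\prod_(l0 <- l :: s) (1 - a (lab l0 w)))%:E).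
  by apply: measurable_funTS; exact: mprod.
apply: (@le_trans _ _ (\sum_(c : C) P (X `&` H `&` fail_all (l :: s) `&` [set w | lab l w = c]))%E).
  rewrite {1}(part (X `&` H `&` fail_all (l :: s)) l).
  apply: measure_bigsetU_le => c; apply: measurableI => //; apply: measurableI.
    exact: measurableI.
  exact: measurable_fail_all.
apply: (@le_trans _ _ (\sum_(c : C) P H * ((1 - a c)%:E * \int[P]_(w in X `&` [set w | lab l w = c]) (\prod_(l <- s) (1 - a (lab l w)))%:E))%E).
  by apply: lee_sum => c _; exact: step.
rewrite [X in (_ <= _ * \int[_]_(_ in X) _)%E](part X l).
rewrite ge0_integral_bigsetU//=; last 2 first.
- by apply: sub_trivIset tX.
- by move=> w _; rewrite lee_fin.
rewrite -ge0_sume_distrr; last first.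
  move=> c _; rewrite mule_ge0 ?lee_fin ?subr_ge0//; first by have /andP[] := a01 c.
  by apply: integral_ge0 => w _; rewrite lee_fin.
rewrite lee_wpmul2l// lee_sum// => c _.
rewrite -ge0_integralZl_EFin//; last 3 first.
- by move=> w _; rewrite lee_fin.
- by apply: measurable_funTS; exact: mprod.
- by rewrite subr_ge0; have /andP[] := a01 c.
rewrite le_eqVlt; apply/orP; left; apply/eqP; apply: eq_integral => w /set_mem[_ /= lc].
by rewrite big_cons lc EFinM.
Qed.

(** In the applications a trial is a potential child: [lab l] tells where it lies, which the
    parent's process determines, and [G l c] is the success of its subtree when it lies at [c]. *)
Lemma fail_all_le s X : uniq s -> block F S0 X ->
  (P (X `&` [set w | forall l, l \in s -> ~ G l (lab l w) w]) <=
   \int[P]_(w in X) (\prod_(l <- s) (1 - a (lab l w)))%:E)%E.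
Proof.
move=> us SX.
have bT : block F set0 setT by exact: blockT.
have := @fail_le s X set0 setT us SX bT (fun _ _ => id) (fun _ _ _ => @False_ind _).
by rewrite setIT probability_setT mul1e.
Qed.

End conditional_product.

(** With [S] the sum of the success probabilities, at least one trial succeeds with probability at
    least [S - S ^ 2]; the loss is of second order when [S] is small. *)
Lemma prod_onem_le (R : realType) (L : Type) (s : seq L) (y : L -> R) :
  (forall l, 0 <= y l <= 1) ->
  \prod_(l <- s) (1 - y l) + \sum_(l <- s) y l <= 1 + (\sum_(l <- s) y l) ^+ 2.
Proof.
move=> y01; elim: s => [|l s ih]; first by rewrite !big_nil addr0 expr0n addr0.
rewrite !big_cons; have /andP[y0 y1] := y01 l.
have S0 : 0 <= \sum_(j <- s) y j by apply: sumr_ge0 => j _; have /andP[] := y01 j.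
set S := \sum_(j <- s) y j in ih S0 *; set Q := \prod_(j <- s) _ in ih *.
have : (1 - y l) * Q <= (1 - y l) * (1 + S ^+ 2 - S).
  by apply: ler_wpM2l; [lra|lra].
nra.
Qed.

(** * Growth of weighted lattice paths *)

(** Bernoulli's inequality for [z = sqrt y] gives the quadratic bound [y ^ n >= (n (z - 1)) ^ 2]. *)
Lemma le_linear_expr (R : realType) (c y : R) : 1 < y ->
  exists N, forall n, (N <= n)%N -> c * n%:R <= y ^+ n.
Proof.
move=> y1; pose z := Num.sqrt y.
have z1 : 1 < z by rewrite -[ltLHS]sqrtr1 ltr_sqrt// (lt_trans _ y1).
have yz : y = z ^+ 2 by rewrite sqr_sqrtr// ltW// (lt_trans _ y1).
have bern n : n%:R * (z - 1) <= z ^+ n.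
  elim: n => [|n ih]; first by rewrite mul0r.
  have zn : 1 <= z ^+ n by rewrite exprn_ege1// ltW.
  by rewrite -natr1 exprS; nra.
have z10 : 0 < (z - 1) ^+ 2 by rewrite exprn_gt0// subr_gt0.
exists (Num.trunc (c / (z - 1) ^+ 2)).+1 => n Nn.
rewrite yz -exprM mulnC exprM.
apply: (@le_trans _ _ ((n%:R * (z - 1)) ^+ 2)); last first.
  by rewrite lerXn2r ?nnegrE ?mulr_ge0 ?subr_ge0 ?exprn_ge0 ?(ltW z1)// ltW// (lt_trans _ z1).
rewrite exprMn expr2 -mulrA mulrC ler_wpM2l// -ler_pdivrMr//.
by rewrite (le_trans (ltW (truncnS_gt _)))// ler_nat.
Qed.

Section lattice.
Context (R : realType) (alpha : R).
Hypothesis alpha0 : 0 < alpha.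
Local Notation omega := (incr_powR alpha).

(* The sum of [omega c_1 * ... * omega c_i] over all [(c_1 + 1) + ... + (c_i + 1) <= b]. *)
Fixpoint wsum (i b : nat) : R :=
  if i is j.+1 then \sum_(c < b) omega c * wsum j (b - c.+1) else 1.

Lemma wsum_ge0 i b : 0 <= wsum i b.
Proof.
elim: i b => [|i ih] b /=; first exact: ler01.
by apply: sumr_ge0 => c _; rewrite mulr_ge0 ?incr_powR_ge0.
Qed.

(** Generating function of the step weights, cut at [T] to be a polynomial: the coefficients of
    [p ^ m] are the weights of paths of [m] steps, and the value at [e ^ (- h)] is a Laplace
    transform, expressed by [gamma_sum]. *)
Let p (T : nat) : {poly R} := \sum_(c < T) omega c *: 'X^(c.+1).

Let pc_ge0 T m j : 0 <= (p T ^+ m)`_j.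
Proof.
elim: m j => [|m ih] j; first by rewrite expr0 coef1; case: eqP.
rewrite exprS coefM; apply: sumr_ge0 => i _; rewrite mulr_ge0// /p coef_sum.
by apply: sumr_ge0 => c _; rewrite coefZ coefXn mulr_ge0 ?incr_powR_ge0.
Qed.

Let psum (T m b : nat) : R := \sum_(j < b.+1) (p T ^+ m)`_j.

(** Both sides satisfy the recursion on the first step; the cut at [T] only drops nonnegative
    terms. *)
Let psum_wsum T m b : psum T m b <= wsum m b.
Proof.
elim: m b => [|m ih] b.
  rewrite /psum expr0 (bigD1 ord0)//= coef1 eqxx big1 ?addr0// => i.
  by rewrite coef1 -val_eqE/= => /negbTE ->.
rewrite /=; have -> : psum T m.+1 b =
    \sum_(c < T) omega c * (if (c < b)%N then psum T m (b - c.+1) else 0).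
  rewrite /psum exprS /p.
  under eq_bigr do rewrite mulr_suml coef_sum.
  rewrite exchange_big/=; apply: eq_bigr => c _.
  under eq_bigr do rewrite -scalerAl coefZ coefXnM.
  rewrite -mulr_sumr; congr *%R.
  rewrite -(big_mkord xpredT (fun j => if (j < c.+1)%N then 0 else (p T ^+ m)`_(j - c.+1)))/=.
  have [cb|bc] := ltnP c b.
    rewrite (@big_cat_nat _ _ _ c.+1)//=; last by rewrite ltnW.
    rewrite big_nat_cond big1 ?add0r; last by move=> i; rewrite andbT => /andP[_ ->].
    rewrite -{1}[c.+1]add0n big_addn subSn// big_mkord.
    by apply: eq_bigr => i _; rewrite addnK ltnNge leq_addl.
  by rewrite big_nat_cond big1// => i; rewrite andbT => /andP[_ ib]; rewrite (leq_trans ib).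
rewrite -(big_mkord xpredT (fun c => omega c * wsum m (b - c.+1))).
rewrite -(big_mkord xpredT (fun c => omega c * (if (c < b)%N then psum T m (b - c.+1) else 0))).
have [Tb|bT] := leqP T b.
  rewrite [leRHS](@big_cat_nat _ _ _ T)//=.
  rewrite -[leLHS]addr0 lerD ?sumr_ge0//.
    by apply: ler_sum => c _; case: ifP => _; rewrite ?mulr0 ?mulr_ge0 ?incr_powR_ge0 ?wsum_ge0// ler_wpM2l ?incr_powR_ge0.
  by move=> c _; rewrite mulr_ge0 ?incr_powR_ge0 ?wsum_ge0.
rewrite (@big_cat_nat _ _ _ b)//=; last exact: ltnW.
rewrite -[leRHS]addr0 lerD//.
  by apply: ler_sum => c _; case: ifP => _; rewrite ?mulr0 ?mulr_ge0 ?incr_powR_ge0 ?wsum_ge0// ler_wpM2l ?incr_powR_ge0.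
rewrite big_nat_cond big1// => i; rewrite andbT => /andP[bi _].
by rewrite ltnNge bi mulr0.
Qed.

Let phorner T h : (p T).[expR (- h)] = \sum_(c < T) omega c * expR (- (c.+1%:R * h)).
Proof.
rewrite /p horner_sum; apply: eq_bigr => c _.
by rewrite hornerZ hornerXn -expRM_natl mulrN.
Qed.

Let phorner_sum T m h N : (size (p T ^+ m) <= N)%N ->
  (p T).[expR (- h)] ^+ m = \sum_(j < N) (p T ^+ m)`_j * expR (- (j%:R * h)).
Proof.
move=> sN; rewrite -horner_exp (horner_coef_wide _ sN).
by apply: eq_bigr => j _; rewrite -expRM_natl mulrN.
Qed.

(* Two-sided Chernoff bound: under the weights [(p ^+ m)`_j x ^+ j] the mass
   outside of the window [[u, v]] is controlled by tilting to [h1] and [h2]. *)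
Let wsum_window T m (h1 h h2 u : R) (b : nat) : 0 <= h -> h1 <= h -> h <= h2 ->
  (p T).[expR (- h)] ^+ m
  - expR (- ((h - h1) * b%:R)) * (p T).[expR (- h1)] ^+ m
  - expR ((h2 - h) * u) * (p T).[expR (- h2)] ^+ m
  <= expR (- (h * u)) * wsum m b.
Proof.
move=> h0 h1h hh2.
pose N := maxn (size (p T ^+ m)) b.+1.
have sN : (size (p T ^+ m) <= N)%N by rewrite leq_maxl.
have bN : (b < N)%N by rewrite leq_maxr.
rewrite !(phorner_sum _ sN).
rewrite lerBlDr lerBlDr.
apply: (@le_trans _ _ (expR (- (h * u)) * psum T m b +
   expR ((h2 - h) * u) * \sum_(j < N) (p T ^+ m)`_j * expR (- (j%:R * h2)) +
   expR (- ((h - h1) * b%:R)) * \sum_(j < N) (p T ^+ m)`_j * expR (- (j%:R * h1)))); last first.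
  by rewrite !lerD2r ler_wpM2l ?expR_ge0.
have -> : psum T m b = \sum_(j < N) (if (j <= b)%N then (p T ^+ m)`_j else 0).
  rewrite /psum (big_ord_widen N (fun j => (p T ^+ m)`_j))// big_mkcond/=.
  by apply: eq_bigr => i _; rewrite ltnS.
rewrite !mulr_sumr -!big_split/=; apply: ler_sum => j _.
rewrite mulrCA [X in _ + X]mulrCA.
have c0 := pc_ge0 T m j; set c := (p T ^+ m)`_j in c0 *.
have t0 : 0 <= expR (- (h * u)) * (if (j <= b)%N then c else 0).
  by case: ifP => _; rewrite ?mulr0// mulr_ge0 ?expR_ge0.
have t2 : 0 <= c * (expR ((h2 - h) * u) * expR (- (j%:R * h2))) by rewrite !mulr_ge0 ?expR_ge0.
have t1 : 0 <= c * (expR (- ((h - h1) * b%:R)) * expR (- (j%:R * h1))) by rewrite !mulr_ge0 ?expR_ge0.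
(* Term by term: [j > b] is paid by the tilt [h1], [j < u] by the tilt [h2], and inside the window
   [e ^ (- h j) <= e ^ (- h u)]. *)
have [jb|bj] := leqP j b; last first.
  apply: (@le_trans _ _ (c * (expR (- ((h - h1) * b%:R)) * expR (- (j%:R * h1))))).
    rewrite ler_wpM2l// -expRD ler_expR.
    have : b%:R <= j%:R :> R by rewrite ler_nat ltnW.
    nra.
  by move: t0; rewrite leqNgt bj/=; lra.
move: t0; rewrite jb => t0.
have [uj|ju] := leP u j%:R.
  apply: (@le_trans _ _ (expR (- (h * u)) * c)); last lra.
  by rewrite mulrC ler_wpM2r// ler_expR; nra.
apply: (@le_trans _ _ (c * (expR ((h2 - h) * u) * expR (- (j%:R * h2))))); last lra.
by rewrite ler_wpM2l// -expRD ler_expR; nra.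
Qed.

Let phorner_gamma_sum T h : 0 < h ->
  (p T).[expR (- h)] = gamma_sum alpha h T * (alpha / h `^ alpha).
Proof.
move=> h0; have hp := powR_gt0 alpha h0; rewrite phorner /gamma_sum.
by field; rewrite !gt_eqF.
Qed.

(* The optimal tilt is [alpha / B]; [r] quantifies the distance to it. *)
Lemma wsum_lower (G r tau : R) (B T m : nat) :
  0 < G -> 0 < r -> 0 < tau < 1 -> (0 < B)%N ->
  (forall h, 0 < h -> gamma_sum alpha h T <= G) ->
  tau ^+ 2 * G <= gamma_sum alpha (alpha * (1 + r) / B%:R) T ->
  ((1 + r) * expR (- r)) `^ alpha <= tau ^+ 4 ->
  (expR (r / (1 + r)) / (1 + r)) `^ alpha <= tau ^+ 4 ->
  2 * tau ^+ (2 * m) <= 2^-1 ->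
  2^-1 * (expR (alpha / (1 + r)) * (tau ^+ 2 * G * (alpha * (B%:R / (alpha * (1 + r))) `^ alpha))) ^+ m
   <= wsum m (m * B).
Proof.
move=> G0 r0 /andP[t0 t1] B0 gsG gs1 rho1 rho2 mtau.
have r1 : 0 < 1 + r by lra.
have BR0 : 0 < B%:R :> R by rewrite ltr0n.
(* Under the tilt [h] a step is approximately Gamma distributed with mean [alpha / h]. The means for
   [h1], [h], [h2] are [B], [B / (1 + r)], [B / (1 + r) ^ 2]: the outer tilts are centred at the
   edges [m B] and [u] of the window, the middle one inside it. *)
pose h1 := alpha / B%:R; pose h := alpha * (1 + r) / B%:R.
pose h2 := alpha * (1 + r) ^+ 2 / B%:R.
pose u : R := (m * B)%:R / (1 + r) ^+ 2.
have h10 : 0 < h1 by rewrite divr_gt0.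
have h0 : 0 < h by rewrite divr_gt0// mulr_gt0.
have h20 : 0 < h2 by rewrite divr_gt0// mulr_gt0// exprn_gt0.
have h1h : h1 <= h by rewrite /h1 /h ler_pM2r ?invr_gt0// ler_peMr ?ltW//; lra.
have hh2 : h <= h2.
  by rewrite /h /h2 ler_pM2r ?invr_gt0// ler_pM2l// expr2 ler_peMr ?ltW//; lra.
have := @wsum_window T m h1 h h2 u (m * B) (ltW h0) h1h hh2.
set P := (p T).[expR (- h)]; set P1 := (p T).[expR (- h1)]; set P2 := (p T).[expR (- h2)].
have gs0 : 0 < gamma_sum alpha h T.
  by apply: lt_le_trans gs1; rewrite mulr_gt0// exprn_gt0.
have PE : P = gamma_sum alpha h T * (alpha / h `^ alpha) by rewrite /P phorner_gamma_sum.
have P0 : 0 < P by rewrite PE mulr_gt0// divr_gt0// powR_gt0.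
(* The powers of the tilts produce [((1 + r) e ^ (- r)) ^ alpha <= tau ^ 4]; comparing the two Gamma
   sums costs [tau ^ (- 2)], so a gain [tau ^ 2] per step remains. [P2le] is the same at the other
   edge. *)
have P1le : expR (- (h - h1) * B%:R) * P1 <= tau ^+ 2 * P.
  rewrite /P1 phorner_gamma_sum// PE.
  have -> : h1 `^ alpha = h `^ alpha / (1 + r) `^ alpha.
    have -> : h = h1 * (1 + r) by rewrite /h /h1 mulrAC.
    by rewrite powRM ?(ltW h10) ?(ltW r1)// mulfK// gt_eqF// powR_gt0.
  have -> : - (h - h1) * B%:R = - r * alpha.
    by rewrite /h /h1; field; rewrite gt_eqF.
  have eE : expR (- r * alpha) = expR (- r) `^ alpha by exact: expRM.
  apply: (@le_trans _ _ (tau ^+ 4 * (G * (alpha / h `^ alpha)))).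
    rewrite eE invf_div.
    have -> : expR (- r) `^ alpha * (gamma_sum alpha h1 T * (alpha * ((1 + r) `^ alpha / h `^ alpha)))
      = ((1 + r) * expR (- r)) `^ alpha * (gamma_sum alpha h1 T * (alpha / h `^ alpha)).
      by rewrite powRM ?(ltW r1) ?expR_ge0//; ring.
    apply: ler_pM => //; first exact: powR_ge0.
    - by rewrite mulr_ge0 ?divr_ge0 ?powR_ge0 ?(ltW alpha0)// /gamma_sum mulr_ge0 ?divr_ge0 ?powR_ge0 ?(ltW alpha0)// sumr_ge0// => i _; rewrite mulr_ge0 ?expR_ge0 ?incr_powR_ge0.
    - by rewrite ler_wpM2r ?gsG// divr_ge0 ?powR_ge0 ?ltW.
  rewrite (exprD _ 2 2) -mulrA ler_wpM2l ?exprn_ge0 ?(ltW t0)// mulrA ler_wpM2r//.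
  by rewrite divr_ge0 ?powR_ge0 ?ltW.
have P2le : expR ((h2 - h) * (B%:R / (1 + r) ^+ 2)) * P2 <= tau ^+ 2 * P.
  rewrite /P2 phorner_gamma_sum// PE.
  have -> : h2 `^ alpha = h `^ alpha * (1 + r) `^ alpha.
    have -> : h2 = h * (1 + r) by rewrite /h /h2; ring.
    by rewrite powRM ?(ltW h0) ?(ltW r1).
  have -> : (h2 - h) * (B%:R / (1 + r) ^+ 2) = r / (1 + r) * alpha.
    by rewrite /h /h2; field; rewrite !gt_eqF.
  have eE : expR (r / (1 + r) * alpha) = expR (r / (1 + r)) `^ alpha by exact: expRM.
  apply: (@le_trans _ _ (tau ^+ 4 * (G * (alpha / h `^ alpha)))).
    have -> : expR (r / (1 + r) * alpha) * (gamma_sum alpha h2 T * (alpha / (h `^ alpha * (1 + r) `^ alpha)))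
      = (expR (r / (1 + r)) / (1 + r)) `^ alpha * (gamma_sum alpha h2 T * (alpha / h `^ alpha)).
      have -> : (expR (r / (1 + r)) / (1 + r)) `^ alpha = expR (r / (1 + r)) `^ alpha / (1 + r) `^ alpha.
        by rewrite powRM ?invr_ge0 ?(ltW r1) ?expR_ge0// powRV// ltW.
      by rewrite eE; field; rewrite !gt_eqF ?powR_gt0.
    apply: ler_pM => //; first exact: powR_ge0.
    - by rewrite mulr_ge0 ?divr_ge0 ?powR_ge0 ?(ltW alpha0)// /gamma_sum mulr_ge0 ?divr_ge0 ?powR_ge0 ?(ltW alpha0)// sumr_ge0// => i _; rewrite mulr_ge0 ?expR_ge0 ?incr_powR_ge0.
    - by rewrite ler_wpM2r ?gsG// divr_ge0 ?powR_ge0 ?ltW.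
  rewrite (exprD _ 2 2) -mulrA ler_wpM2l ?exprn_ge0 ?(ltW t0)// mulrA ler_wpM2r//.
  by rewrite divr_ge0 ?powR_ge0 ?ltW.
have T1 : expR (- ((h - h1) * (m * B)%:R)) * P1 ^+ m <= tau ^+ (2 * m) * P ^+ m.
  have -> : - ((h - h1) * (m * B)%:R) = m%:R * (- (h - h1) * B%:R) by rewrite natrM; ring.
  rewrite expRM_natl -exprMn exprM -exprMn lerXn2r ?nnegrE//.
    by rewrite mulr_ge0 ?expR_ge0// /P1 phorner sumr_ge0// => c _; rewrite mulr_ge0 ?expR_ge0 ?incr_powR_ge0.
  by rewrite mulr_ge0 ?exprn_ge0 ?ltW.
have T2 : expR ((h2 - h) * u) * P2 ^+ m <= tau ^+ (2 * m) * P ^+ m.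
  have -> : (h2 - h) * u = m%:R * ((h2 - h) * (B%:R / (1 + r) ^+ 2)) by rewrite /u natrM; ring.
  rewrite expRM_natl -exprMn exprM -exprMn lerXn2r ?nnegrE//.
    by rewrite mulr_ge0 ?expR_ge0// /P2 phorner sumr_ge0// => c _; rewrite mulr_ge0 ?expR_ge0 ?incr_powR_ge0.
  by rewrite mulr_ge0 ?exprn_ge0 ?ltW.
move=> W.
have Pm0 : 0 < P ^+ m by rewrite exprn_gt0.
(* Together the two tails take at most [2 tau ^ (2 m) <= 1 / 2] of the mass [P ^ m]. *)
have W2 : 2^-1 * P ^+ m <= expR (- (h * u)) * wsum m (m * B) by nra.
have hu : h * u = m%:R * (alpha / (1 + r)).
  by rewrite /h /u natrM; field; rewrite !gt_eqF.
have -> : wsum m (m * B) = expR (h * u) * (expR (- (h * u)) * wsum m (m * B)).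
  by rewrite mulrA -expRD subrr expR0 mul1r.
apply: le_trans (ler_wpM2l (expR_ge0 (h * u)) W2).
rewrite hu expRM_natl exprMn mulrCA ler_wpM2l// ?invr_ge0// ler_wpM2l ?exprn_ge0 ?expR_ge0//.
rewrite lerXn2r ?nnegrE ?(ltW P0)//.
  by rewrite !mulr_ge0 ?exprn_ge0 ?powR_ge0 ?ltW.
rewrite PE; apply: ler_pM => //.
- by rewrite mulr_ge0 ?exprn_ge0 ?ltW.
- by rewrite mulr_ge0 ?powR_ge0 ?ltW.
- rewrite ler_pM2l//.
  have -> : B%:R / (alpha * (1 + r)) = h^-1 by rewrite /h invf_div.
  by rewrite powRV// ltW.
Qed.

(** A weak Stirling bound, [m! <= e m (m / e) ^ m]. The induction step reduces to
    [e <= (1 + 1 / n) ^ (n + 1)]. *)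
Lemma expn_ge_fact (m : nat) : (0 < m)%N ->
  expR m%:R * m`!%:R <= expR 1 * m%:R * m%:R ^+ m :> R.
Proof.
case: m => // m _; elim: m => [|m ih].
  by rewrite expr1 /= !mulr1.
rewrite factS natrM -[in expR _]natr1 expRD.
set n := m.+1 in ih *.
have n0 : 0 < n%:R :> R by rewrite ltr0n.
have key : expR 1 * n%:R ^+ n.+1 <= n.+1%:R ^+ n.+1 :> R.
  have -> : expR 1 = expR n.+1%:R^-1 ^+ n.+1 :> R by rewrite -expRM_natl mulfV// pnatr_eq0.
  rewrite -exprMn lerXn2r ?nnegrE ?mulr_ge0 ?expR_ge0 ?ler0n//.
  have /ler_wpM2l : 1 + - n.+1%:R^-1 <= expR (- n.+1%:R^-1) :> R by exact: expR_ge1Dx.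
  move=> /(_ _ (expR_ge0 n.+1%:R^-1)); rewrite -expRD subrr expR0 => k.
  have -> : expR n.+1%:R^-1 * n%:R = n.+1%:R * (expR n.+1%:R^-1 * (1 - n.+1%:R^-1)) :> R.
    by rewrite mulrCA mulrBr mulr1 mulfV ?pnatr_eq0// -natr1 addrK.
  by rewrite -[leRHS]mulr1 ler_wpM2l.
rewrite [leLHS](_ : _ = expR 1 * n.+1%:R * (expR n%:R * n`!%:R)); last by ring.
rewrite -mulrA -[leRHS]mulrA ler_wpM2l ?expR_ge0// ler_wpM2l//.
apply: le_trans ih _; rewrite -mulrA -exprS.
exact: key.
Qed.

(** The binomial coefficient counts the admissible time coordinates of a path of [m] steps; the
    bound follows from [(m A - m) ^ m <= m! 'C(m A, m)] and Stirling, up to the polynomial factor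
    [e m]. *)
Lemma bin_ge_expn (A m : nat) : (0 < A)%N -> (0 < m)%N ->
  (A%:R - 1) ^+ m * expR m%:R / (expR 1 * m%:R) <= 'C(m * A, m)%:R :> R.
Proof.
move=> A0 m0.
have mR : 0 < m%:R :> R by rewrite ltr0n.
have f0 : 0 < m`!%:R :> R by rewrite ltr0n fact_gt0.
have ff (n k : nat) : ((n - k) ^ k <= n ^_ k)%N.
  elim: k n => [|k ih] n; first by rewrite expn0 ffactn0.
  rewrite expnS ffactnSr mulnC leq_mul//; last by rewrite leq_sub2l.
  by apply: leq_trans (ih n); case: (posnP k) => [->//|k0]; rewrite leq_exp2r// leq_sub2l.
have h1 : (m%:R * (A%:R - 1)) ^+ m <= 'C(m * A, m)%:R * m`!%:R :> R.
  rewrite -natrM bin_ffact.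
  have -> : m%:R * (A%:R - 1) = (m * A - m)%:R :> R.
    by rewrite natrB ?leq_pmulr// natrM mulrBr mulr1.
  by rewrite -natrX ler_nat ff.
rewrite ler_pdivrMr ?mulr_gt0 ?expR_gt0// -(ler_pM2r f0).
have A1 : 0 <= (A%:R - 1) ^+ m :> R by rewrite exprn_ge0// subr_ge0 ler1n.
have := expn_ge_fact m0 => h2.
apply: (@le_trans _ _ ((A%:R - 1) ^+ m * (expR 1 * m%:R * m%:R ^+ m))).
  by rewrite -[leLHS]mulrA ler_wpM2l.
rewrite [leRHS](_ : _ = expR 1 * m%:R * ('C(m * A, m)%:R * m`!%:R)); last by ring.
rewrite [leLHS](_ : _ = expR 1 * m%:R * (m%:R * (A%:R - 1)) ^+ m); last by rewrite exprMn; ring.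
by rewrite ler_wpM2l// mulr_ge0 ?expR_ge0 ?ltW.
Qed.

(** Here [e] stands for a partial sum of the [e_k], close to [1 / G]. The binomial grows like
    [(e A) ^ m] with Euler's [e], and [wsum] like [(e ^ alpha G alpha (B / alpha) ^ alpha) ^ m], so
    [A], [B], [G] cancel and the rate in the hypothesis remains, up to factors close to 1 and a
    polynomial one. *)
Lemma lattice_growth (G C : R) :
  Gamma alpha = G%:E -> 0 < G -> 0 < C -> 1 < C `^ alpha * expR (1 + alpha) / alpha `^ alpha ->
  exists2 tau : R, 0 < tau < 1 & exists A B m : nat,
    [/\ (0 < A)%N, (0 < B)%N, (0 < m)%N &
     forall e, tau <= e * G ->
     2 <= (C `^ alpha / (A%:R * B%:R `^ alpha) * e / alpha) ^+ m
          * 'C(m * A, m)%:R * wsum m (m * B)].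
Proof.
move=> GG G0 C0; set x := _ / _ => x1.
have aa0 : 0 < alpha `^ alpha by rewrite powR_gt0.
have pw1 : 1 `^ alpha = 1 by rewrite powR1.
have lx : 0 < ln x by rewrite ln_gt0.
(* Shifting the tilt costs two factors [e ^ (- alpha r)], one from [e ^ (alpha / (1 + r))] and one
   from [(1 + r) ^ (- alpha)]. With this [r], [main] is still at least [sqrt x]. *)
pose r := ln x / (4 * alpha).
have r0 : 0 < r by rewrite divr_gt0// mulr_gt0.
have r1 : 0 < 1 + r by lra.
pose main := C `^ alpha * expR 1 * expR (alpha / (1 + r)) / (alpha * (1 + r)) `^ alpha.
pose rho1 := ((1 + r) * expR (- r)) `^ alpha.
pose rho2 := (expR (r / (1 + r)) / (1 + r)) `^ alpha.
have main1 : 1 < main.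
  have : expR (ln x / 2) <= main.
    have -> : ln x / 2 = ln x - alpha * r - alpha * r by rewrite /r; field; rewrite gt_eqF.
    rewrite !expRD lnK ?posrE ?(lt_trans _ x1)// /x /main.
    rewrite powRM ?(ltW alpha0) ?(ltW r1)// expRD.
    have h1 : expR alpha * expR (- (alpha * r)) <= expR (alpha / (1 + r)).
      rewrite -expRD ler_expR ler_pdivlMr//.
      have : 0 <= alpha * r ^+ 2 by rewrite mulr_ge0 ?sqr_ge0// ltW.
      by nra.
    have h2 : (1 + r) `^ alpha * expR (- (alpha * r)) <= 1.
      rewrite (mulrC alpha) -mulNr expRM -powRM ?(ltW r1) ?expR_ge0//.
      rewrite -[leRHS]pw1 ge0_ler_powR ?nnegrE ?(ltW alpha0) ?mulr_ge0 ?(ltW r1) ?expR_ge0//.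
      rewrite expRN ler_pdivrMr ?expR_gt0// mul1r; exact: expR_ge1Dx.
    have p0 : 0 < (1 + r) `^ alpha by rewrite powR_gt0.
    rewrite [leRHS](_ : _ = C `^ alpha * expR 1 / alpha `^ alpha * (expR (alpha / (1 + r)) / (1 + r) `^ alpha)); last first.
      by field; rewrite !gt_eqF.
    rewrite [leLHS](_ : _ = C `^ alpha * expR 1 / alpha `^ alpha * (expR alpha * expR (- (alpha * r)) * expR (- (alpha * r)))); last first.
      by field; rewrite !gt_eqF.
    rewrite ler_wpM2l ?mulr_ge0 ?powR_ge0 ?expR_ge0 ?invr_ge0 ?powR_ge0//.
    rewrite ler_pdivlMr// -[leLHS]mulrA -[leRHS]mulr1 ler_pM ?mulr_ge0 ?expR_ge0 ?powR_ge0//.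
    by rewrite mulrC.
  by apply: lt_le_trans; rewrite expR_gt1 divr_gt0.
have rho1_1 : rho1 < 1.
  rewrite /rho1 -[ltRHS]pw1 gt0_ltr_powR ?nnegrE ?mulr_ge0 ?(ltW r1) ?expR_ge0//.
  rewrite expRN ltr_pdivrMr ?expR_gt0// mul1r.
  by apply: expR_gt1Dx; rewrite gt_eqF.
have rho2_1 : rho2 < 1.
  rewrite /rho2 -[ltRHS]pw1 gt0_ltr_powR ?nnegrE ?divr_ge0 ?(ltW r1) ?expR_ge0//.
  rewrite ltr_pdivrMr// mul1r -[X in expR X]opprK expRN invf_plt ?posrE ?expR_gt0//.
  apply: le_lt_trans (expR_gt1Dx _); last by rewrite oppr_eq0 gt_eqF// divr_gt0.
  rewrite -(@ler_pM2r _ (1 + r))// mulVf ?gt_eqF// mulrBl mul1r divfK ?gt_eqF//; lra.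
pose M := Num.max main^-1 (Num.max rho1 rho2).
have main0 : 0 < main by exact: lt_trans main1.
have M1 : M < 1 by rewrite !gt_max invf_lt1// main1 rho1_1 rho2_1.
have M0 : 0 < M by rewrite lt_max invr_gt0 main0.
(* Bernoulli gives [tau ^ 4 >= 1 - 4 (1 - M) / 5 > M]. *)
pose tau := 1 - (1 - M) / 5.
have t01 : 0 < tau < 1 by rewrite /tau; lra.
have tM : M < tau ^+ 4.
  have -> : tau ^+ 4 = (tau ^+ 2) ^+ 2 by rewrite -exprM.
  have h1 : 1 - 2 * ((1 - M) / 5) <= tau ^+ 2 by rewrite /tau; nra.
  have h2 : (1 - 2 * ((1 - M) / 5)) ^+ 2 <= (tau ^+ 2) ^+ 2.
    by rewrite lerXn2r ?nnegrE ?exprn_ge0//; lra.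
  by apply: lt_le_trans h2; nra.
have [t0 t1] := andP t01.
have y1 : 1 < main * tau ^+ 4.
  rewrite -ltr_pdivrMl// mulr1; apply: le_lt_trans tM.
  by rewrite le_max lexx.
pose A := (Num.trunc (1 - tau)^-1).+1.
have tau10 : 0 < 1 - tau by rewrite subr_gt0.
have A0 : 0 < A%:R :> R by rewrite ltr0n.
have At : tau <= (A%:R - 1) / A%:R.
  rewrite mulrBl mulfV ?gt_eqF// mul1r lerBrDr -lerBrDl.
  by rewrite invf_ple ?posrE// ltW// truncnS_gt.
pose B := (Num.trunc (alpha * (1 + r) / (1 - tau))).+1.
have BR0 : 0 < B%:R :> R by rewrite ltr0n.
pose h := alpha * (1 + r) / B%:R.
have h0 : 0 < h by rewrite divr_gt0// mulr_gt0.
have ht : tau <= expR (- h).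
  apply: le_trans (expR_ge1Dx _); rewrite lerBrDr -lerBrDl.
  by rewrite /h ler_pdivrMr// [leRHS]mulrC -ler_pdivrMr// ltW// truncnS_gt.
have [T gsT] : exists T, tau * G < expR h * gamma_sum alpha h T.
  have cG : ((tau * G)%:E < Gamma alpha)%E by rewrite GG lte_fin gtr_pMl.
  have [N _ NT] := gamma_sum_ge alpha0 h0 cG.
  by exists N; apply: NT => /=.
have gs1 : tau ^+ 2 * G <= gamma_sum alpha h T.
  rewrite expr2 -mulrA; apply: (@le_trans _ _ (expR (- h) * (tau * G))).
    by rewrite ler_wpM2r// mulr_ge0 ?ltW.
  rewrite -(ler_pM2l (expR_gt0 h)) mulrA -expRD subrr expR0 mul1r.
  exact: ltW.
have [N1 hN1] := le_linear_expr (4 * expR 1) y1.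
have [N2 hN2] : exists N, forall n, (N <= n)%N -> 4 <= ((tau ^+ 2)^-1) ^+ n.
  have t2 : 1 < (tau ^+ 2)^-1 by rewrite invf_gt1 ?exprn_gt0// expr_lt1// ltW.
  have [N hN] := le_linear_expr 4 t2.
  exists N.+1 => n Nn; apply: le_trans (hN n (ltnW Nn)).
  by rewrite ler_peMr// ler1n; case: n Nn.
pose m := (maxn N1 N2).+1.
have m0 : 0 < m%:R :> R by rewrite ltr0n.
have mtau : 2 * tau ^+ (2 * m) <= 2^-1.
  have := hN2 m (leqW (leq_maxr _ _)).
  have p0 : 0 < (tau ^+ 2) ^+ m by rewrite !exprn_gt0.
  rewrite exprVn exprM -(ler_pM2r p0) mulVf ?gt_eqF//; lra.
have rho1t : rho1 <= tau ^+ 4 by rewrite ltW// (le_lt_trans _ tM)// !le_max lexx ?orbT.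
have rho2t : rho2 <= tau ^+ 4 by rewrite ltW// (le_lt_trans _ tM)// !le_max lexx ?orbT.
have gsG h' : 0 < h' -> gamma_sum alpha h' T <= G.
  by move=> h'0; rewrite -lee_fin -GG gamma_sum_le.
exists tau => //; exists A, B, m; split => // e teG.
have W := @wsum_lower G r tau B T m G0 r0 t01 isT gsG gs1 rho1t rho2t mtau.
have bn := @bin_ge_expn A m isT isT.
have a1 : 0 < (alpha * (1 + r)) `^ alpha by rewrite powR_gt0// mulr_gt0.
have Ba : 0 < B%:R `^ alpha by rewrite powR_gt0.
have e0 : 0 < e by rewrite -(pmulr_lgt0 _ G0) (lt_le_trans t0).
have A1 : 0 <= A%:R - 1 :> R by rewrite subr_ge0 ler1n.
set K := C `^ alpha / _ * e / alpha.
have K0 : 0 <= K by rewrite /K !mulr_ge0 ?invr_ge0 ?powR_ge0 ?mulr_ge0 ?powR_ge0 ?ltW.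
apply: le_trans (ler_pM _ _ (ler_wpM2l _ bn) W); last 3 first.
- by nonneg.
- by rewrite mulr_ge0 ?invr_ge0 ?exprn_ge0// !mulr_ge0 ?expR_ge0 ?exprn_ge0 ?powR_ge0 ?ltW.
- by rewrite exprn_ge0.
have em : expR m%:R = expR 1 ^+ m :> R by rewrite -expRM_natl mulr1.
rewrite em.
(* The four factors [tau] are spent here: two on the Gamma sum, one on [e * G], one on
   [(A - 1) / A]. *)
pose Z := main * tau ^+ 2 * (e * G) * ((A%:R - 1) / A%:R).
rewrite [leRHS](_ : _ = Z ^+ m / (2 * expR 1 * m%:R)); last first.
  have -> : Z = K * (A%:R - 1) * expR 1 * (expR (alpha / (1 + r)) * (tau ^+ 2 * G * (alpha * (B%:R / (alpha * (1 + r))) `^ alpha))).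
    have -> : (B%:R / (alpha * (1 + r))) `^ alpha = B%:R `^ alpha / (alpha * (1 + r)) `^ alpha.
      have ar : 0 <= alpha * (1 + r) by rewrite mulr_ge0 ?(ltW alpha0) ?(ltW r1).
      by rewrite [LHS]powRM ?invr_ge0// powRV.
    by rewrite /Z /K /main; field; rewrite !gt_eqF.
  rewrite !exprMn; field; rewrite !gt_eqF//; exact: expR_gt0.
rewrite ler_pdivlMr ?mulr_gt0 ?expR_gt0//.
have -> : 2 * (2 * expR 1 * m%:R) = 4 * expR 1 * m%:R :> R by ring.
apply: le_trans (hN1 m (leqW (leq_maxl _ _))) _.
have le_mainZ : main * tau ^+ 4 <= Z.
  have -> : main * tau ^+ 4 = main * tau ^+ 2 * (tau * tau) by ring.
  rewrite /Z -[leRHS]mulrA; apply: ler_wpM2l; first by nonneg.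
  by apply: ler_pM => //; nonneg.
have y0 : 0 <= main * tau ^+ 4 by nonneg.
by rewrite lerXn2r// nnegrE// (le_trans y0).
Qed.

End lattice.

(** * Rounded subtrees *)

Lemma measure_bigcup_le d (T : measurableType d) (R : realType)
    (mu : {measure set T -> \bar R}) (A : nat -> set T) :
  (forall n, measurable (A n)) ->
  (mu (\bigcup_n A n) <= \sum_(0 <= n <oo) mu (A n))%E.
Proof.
by move=> mA; apply: measure_sigma_subadditive => //; exact: bigcupT_measurable.
Qed.

Lemma measure_bigcup_le_sum d (T : measurableType d) (R : realType)
    (mu : {measure set T -> \bar R}) (A : nat -> set T) (f : nat -> R) (M : R) :
  (forall n, measurable (A n)) -> (forall n, (mu (A n) <= (f n)%:E)%E) ->
  (forall n, 0 <= f n) -> (forall N, \sum_(n < N) f n <= M) ->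
  (mu (\bigcup_n A n) <= M%:E)%E.
Proof.
move=> mA Af f0 fM.
apply: (le_trans (measure_bigcup_le mu mA)).
apply: (@le_trans _ _ (\sum_(0 <= n <oo) (f n)%:E)%E).
  by apply: lee_nneseries => // n _.
apply: lime_le; first by apply: is_cvg_nneseries => n _ _; rewrite lee_fin.
by apply: nearW => N; rewrite big_mkord sumEFin lee_fin.
Qed.

Section branching.
Context (R : realType) (alpha : R) (lambda : {finite_measure set (pstar R) -> \bar R})
  d (Omega : measurableType d) (P : probability Omega R)
  (xi : seq (nat * nat) -> Omega -> nat -> option (R * pstar R)).
Hypotheses (alpha0 : 0 < alpha) (c_fin : (c_const alpha lambda < +oo)%E)
  (xi_poisson : forall u, poisson_process P (xi u) (intensity alpha lambda))
  (xi_indep : independent P (fun u => sigma_atoms (xi u))).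
Local Notation word := (seq (nat * nat)).
Local Notation F := (fun u => sigma_atoms (xi u)).

Lemma sigma_atoms_measurable u : F u `<=` measurable.
Proof.
apply: smallest_sub; first exact: sigma_algebra_measurable.
exact: (poisson_measurable (xi_poisson u)).
Qed.

Lemma sigma_atomsT u : F u setT.
Proof.
rewrite -setC0 -setTD.
by have [+ + _] := smallest_sigma_algebra setT (atom_events (xi u)); move=> h0; exact.
Qed.

Lemma sigma_atomsI u : setI_closed (F u).
Proof.
have [_ hC hU] := smallest_sigma_algebra setT (atom_events (xi u)).
move=> A B FA FB; rewrite -[_ `&` _]setCK setCI -setTD; apply: (hC).
rewrite -bigcup2E; apply: (hU) => -[|[|n]]//=; rewrite -?setTD; [exact: hC..|].
by rewrite -(setDT setT); apply: (hC); exact: sigma_atomsT.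
Qed.

Definition emeanR k : R := fine (emean alpha lambda k).

Lemma emean_ge0 k : (0 <= emean alpha lambda k)%E.
Proof. by apply: integral_ge0 => x _; exact: inv_power_ge0. Qed.

Lemma emeanE k : emean alpha lambda k = (emeanR k)%:E.
Proof.
rewrite /emeanR fineK// ge0_fin_numE ?emean_ge0//.
apply: le_lt_trans c_fin; rewrite c_constE (@nneseriesD1 _ _ k)//.
  by rewrite leeDl// nneseries_ge0// => n _ _; exact: emean_ge0.
by move=> n _; exact: emean_ge0.
Qed.

Lemma emeanR_ge0 k : 0 <= emeanR k.
Proof. by rewrite fine_ge0// emean_ge0. Qed.

(** Only the first entry is constrained. The box serves to count the children of the root, and to
    dominate the trials of all layers by one Poisson count. *)
Definition box (s v : R) : set (R * pstar R) := `]0, s]%classic `*` layer 0 0 v.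

Lemma measurable_box s v : measurable (box s v).
Proof. by apply: measurableX; [exact: measurable_itv|exact: measurable_layer]. Qed.

Lemma intensity_itv_layer (k : nat) (s t u v : R) : 0 <= s <= t -> 0 <= u <= v ->
  intensity alpha lambda (`]s, t]%classic `*` layer k u v) =
  ((t - s) * ((v `^ alpha - u `^ alpha) / alpha * emeanR k))%:E.
Proof.
move=> /andP[s0 st] uv.
rewrite intensityX; last exact: measurable_itv.
rewrite Lambda_star_layer// emeanE -EFinM.
rewrite setIidl; last first.
  by move=> x /=; rewrite !in_itv/= andbT => /andP[sx _]; exact: le_lt_trans sx.
rewrite lebesgue_measure_itv/= lte_fin.
move: st; rewrite le_eqVlt => /orP[/eqP <-|st]; first by rewrite ltxx subrr mul0r mul0e.
by rewrite st -EFinD -EFinM.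
Qed.

Definition box_mean (s v : R) : R := s * (v `^ alpha / alpha * emeanR 0).

Lemma box_mean_ge0 s v : 0 <= s -> 0 <= box_mean s v.
Proof.
move=> s0; rewrite /box_mean !mulr_ge0 ?emeanR_ge0 ?invr_ge0 ?powR_ge0//; exact: ltW.
Qed.

Lemma intensity_box s v : 0 <= s -> 0 <= v ->
  intensity alpha lambda (box s v) = (box_mean s v)%:E.
Proof.
move=> s0 v0; rewrite intensity_itv_layer ?lexx//.
by rewrite subr0 powR0 ?gt_eqF// subr0.
Qed.

Section lattice_cells.
Context (ht hz : R).
Hypotheses (ht0 : 0 < ht) (hz0 : 0 < hz).

Definition cell (k a b : nat) : set (R * pstar R) :=
  `]a%:R * ht, a.+1%:R * ht]%classic `*` layer k (b%:R * hz) (b.+1%:R * hz).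

Lemma measurable_cell k a b : measurable (cell k a b).
Proof. by apply: measurableX; [exact: measurable_itv|exact: measurable_layer]. Qed.

Lemma intensity_cell k a b : intensity alpha lambda (cell k a b) =
  (ht * (hz `^ alpha * incr_powR alpha b / alpha * emeanR k))%:E.
Proof.
have le_h (h : R) n : 0 < h -> 0 <= n%:R * h <= n.+1%:R * h.
  by move=> h0; rewrite ler_pM2r// ler_nat leqnSn mulr_ge0// ltW.
rewrite intensity_itv_layer ?le_h//; congr EFin.
rewrite !powRM ?(ltW hz0)// /incr_powR -[a.+1%:R]natr1.
by field; rewrite gt_eqF.
Qed.

Lemma cell_inj k a b a' b' x : cell k a b x -> cell k a' b' x -> (a, b) = (a', b').
Proof.
have key (h y : R) n m : 0 < h -> n%:R * h < y -> y <= m.+1%:R * h -> (n <= m)%N.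
  by move=> h0 ny ym; have := lt_le_trans ny ym; rewrite ltr_pM2r// ltr_nat ltnS.
case: x => t x [/=]; rewrite in_itv/= /layer/= => /andP[a1 a2] /andP[b1 b2].
move=> [/=]; rewrite in_itv/= => /andP[a3 a4] /andP[b3 b4].
have [r xr] : exists r, pseq x k = r%:E.
  by case: (pseq x k) b1 b2 => [r| |]//; exists r.
move: b1 b2 b3 b4; rewrite xr !lte_fin !lee_fin => b1 b2 b3 b4.
congr pair; apply/eqP; rewrite eqn_leq.
  by rewrite (key _ _ _ _ ht0 a1 a4) (key _ _ _ _ ht0 a3 a2).
by rewrite (key _ _ _ _ hz0 b1 b4) (key _ _ _ _ hz0 b3 b2).
Qed.

Definition atom_in_cell (u : word) (i k a b : nat) : set Omega :=
  atom_event (xi u) (cell k a b) i.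

(* Lattice version of the event that the subtree of [u] has an individual of
   generation [n] in [[0, a ht] * [0, b hz]]: displacements are rounded to the
   lower corner of their cell if [e = 0] and to the upper one if [e = 1]. *)
Fixpoint hit (e n : nat) (u : word) (a b : nat) : set Omega :=
  if n is n'.+1 then
    \bigcup_k \bigcup_a' \bigcup_b' \bigcup_i
      (if (a' + e <= a)%N && (b' + e <= b)%N then
         atom_in_cell u i k a' b' `&` hit e n' ((i, k) :: u) (a - e - a') (b - e - b')
       else set0)
  else setT.

Definition subtree (u : word) : set word := [set v | exists t, v = t ++ u].

Lemma block_atom_event u B i : measurable B -> block F [set u] (atom_event (xi u) B i).
Proof.
move=> mB; apply: (@block_gen _ _ _ _ _ u) => //.
by apply: sub_sigma_algebra; exists i, B.
Qed.

Arguments block_atom_event : clear implicits.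

Lemma block0 S : block F S set0.
Proof. by rewrite -setCT; apply: blockC; exact: blockT. Qed.

Lemma block_hit e n u a b : block F (subtree u) (hit e n u a b).
Proof.
elim: n u a b => [|n ih] u a b /=; first exact: blockT.
apply: block_bigcup => k; apply: block_bigcup => x; apply: block_bigcup => y.
apply: block_bigcup => i; case: ifP => _; last exact: block0.
apply: blockI.
  apply: sub_block (block_atom_event u _ _ (measurable_cell _ _ _)) => v /= ->.
  by exists [::].
by apply: sub_block (ih _ _ _) => v [t ->]; exists (rcons t (i, k)); rewrite cat_rcons.
Qed.

Arguments block_hit : clear implicits.

Lemma measurable_hit e n u a b : measurable (hit e n u a b).
Proof. exact: (block_measurable sigma_atoms_measurable (block_hit e n u a b)). Qed.

Lemma notin_subtree u ik : ~ subtree (ik :: u) u.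
Proof.
move=> [t]; move/(congr1 size); rewrite size_cat /=; lia.
Qed.

Lemma subtree_disj u (l l' : nat * nat) j : l != l' -> subtree (l :: u) j -> ~ subtree (l' :: u) j.
Proof.
move=> ll' [t ->] [t' tt'].
have /eqP := tt'; have := congr1 size tt'; rewrite !size_cat /= => st.
have {}st : size t = size t' by apply/eqP; rewrite -(eqn_add2r (size u).+1) st.
rewrite -!cat_rcons eqseq_cat ?size_rcons ?st//.
by rewrite eqxx andbT eqseq_rcons (negbTE ll') andbF.
Qed.

Lemma hit_mono n u a b a' b' : (a <= a')%N -> (b <= b')%N ->
  hit 1 n u a b `<=` hit 1 n u a' b'.
Proof.
elim: n u a b a' b' => [//|n ih] u a b a' b' aa bb w /= [k _ [x _ [y _ [i _]]]].
case: ifP => // /andP[xa yb] [wc wh].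
exists k => //; exists x => //; exists y => //; exists i => //.
rewrite (leq_trans xa aa) (leq_trans yb bb)/=; split => //.
by apply: ih wh; rewrite leq_sub2r// leq_sub2r.
Qed.

Lemma atom_hit_indep e n u i k a b x y :
  P (atom_in_cell u i k x y `&` hit e n ((i, k) :: u) a b) =
  (P (atom_in_cell u i k x y) * P (hit e n ((i, k) :: u) a b))%E.
Proof.
apply: (block_indep sigma_atoms_measurable sigma_atomsT sigma_atomsI xi_indep _
  (block_atom_event u _ _ (measurable_cell _ _ _)) (block_hit _ _ _ _ _)).
by move=> j /= ->; exact: notin_subtree.
Qed.

Lemma sum_atom_in_cell u k x y :
  (\sum_(0 <= i <oo) P (atom_in_cell u i k x y) =
   (ht * (hz `^ alpha * incr_powR alpha y / alpha * emeanR k))%:E)%E.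
Proof.
apply: (sum_atom_event (xi_poisson u) (measurable_cell k x y)).
  exact: intensity_cell.
rewrite !mulr_ge0 ?emeanR_ge0 ?invr_ge0 ?powR_ge0 ?incr_powR_ge0//; exact: ltW.
Qed.

(** Union bound over layer, cell and label of the first child, then induction. The exponential
    weight factorizes over the coordinates: times contribute about [1 / theta], displacements about
    [G / vt ^ alpha], and the layers [1 / G], which cancels [G]. *)
Lemma hit0_le (theta vt G : R) n u a b : 0 < theta -> 0 < vt ->
  Gamma alpha = G%:E -> 0 < G -> (forall K, \sum_(k < K) emeanR k <= G^-1) ->
  (P (hit 0 n u a b) <=
   ((expR (theta * ht + vt * hz) / (theta * vt `^ alpha)) ^+ n
    * expR (theta * ht * a%:R + vt * hz * b%:R))%:E)%E.
Proof.
move=> th0 vt0 GG G0 sumG; set A := _ / _.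
have vta0 : 0 < vt `^ alpha by rewrite powR_gt0.
have A0 : 0 < A by rewrite divr_gt0 ?expR_gt0// mulr_gt0.
elim: n u a b => [|n ih] u a b.
  rewrite /= probability_setT lee_fin expr0 mul1r -[leLHS]expR0 ler_expR.
  by apply: addr_ge0; nonneg.
pose E0 := A ^+ n * expR (theta * ht * a%:R + vt * hz * b%:R).
have E00 : 0 <= E0 by rewrite mulr_ge0 ?expR_ge0// exprn_ge0// ltW.
pose ey (y : nat) := hz `^ alpha * incr_powR alpha y / alpha * expR (- (y%:R * (vt * hz))).
have ey0 y : 0 <= ey y.
  by rewrite /ey !mulr_ge0 ?expR_ge0 ?invr_ge0 ?powR_ge0 ?incr_powR_ge0// ltW.
pose ex (x : nat) := ht * expR (- (x%:R * (theta * ht))).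
have ex0 x : 0 <= ex x by rewrite /ex mulr_ge0 ?expR_ge0// ltW.
(* [gamma_sum] evaluates the exponential at right ends of cells, whereas rounding down uses left
   ends; this shift is the factor [e ^ (vt hz)]. *)
have sum_ey N : \sum_(y < N) ey y <= expR (vt * hz) * G / vt `^ alpha.
  have := gamma_sum_le alpha0 (mulr_gt0 vt0 hz0) N; rewrite GG lee_fin => h.
  apply: (@le_trans _ _ (expR (vt * hz) * gamma_sum alpha (vt * hz) N / vt `^ alpha)); last first.
    by rewrite ler_pM2r ?invr_gt0// ler_pM2l ?expR_gt0.
  rewrite le_eqVlt; apply/orP; left; apply/eqP.
  rewrite /gamma_sum mulr_suml mulr_sumr mulr_suml; apply: eq_bigr => y _.
  have -> : - (y.+1%:R * (vt * hz)) = - (vt * hz) - y%:R * (vt * hz) by rewrite -natr1; ring.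
  rewrite expRD expRN powRM ?(ltW vt0) ?(ltW hz0)// /ey.
  by field; rewrite !gt_eqF ?expR_gt0.
(* A geometric sum, bounded by telescoping with [theta ht <= e ^ (theta ht) - 1]. *)
have sum_ex N : \sum_(x < N) ex x <= expR (theta * ht) / theta.
  rewrite ler_pdivlMr//.
  suff : (\sum_(x < N) ex x) * theta <= expR (theta * ht) * (1 - expR (- (N%:R * (theta * ht)))).
    move=> h; apply: le_trans h _.
    have := expR_ge0 (theta * ht); have := expR_ge0 (- (N%:R * (theta * ht))).
    set e1 := expR _; set e2 := expR _; nra.
  elim: N => [|N ihN]; first by rewrite big_ord0 !mul0r oppr0 expR0 subrr mulr0.
  rewrite big_ord_recr/= mulrDl.
  apply: le_trans (lerD ihN (lexx _)) _.
  have -> : - (N.+1%:R * (theta * ht)) = - (N%:R * (theta * ht)) - theta * ht by rewrite -natr1; ring.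
  rewrite expRD [expR (- (theta * ht))]expRN.
  have h1 : theta * ht <= expR (theta * ht) - 1 by rewrite lerBrDl expR_ge1Dx.
  have := ler_wpM2r (expR_ge0 (- (N%:R * (theta * ht)))) h1.
  have := expR_gt0 (theta * ht); set e1 := expR (theta * ht) => e10.
  rewrite /ex; set e2 := expR _ => h2.
  have -> : e1 * (1 - e2 * e1^-1) = e1 - e2 by field; rewrite gt_eqF.
  nra.
have mset k x y i : measurable (if (x + 0 <= a)%N && (y + 0 <= b)%N then
    atom_in_cell u i k x y `&` hit 0 n ((i, k) :: u) (a - 0 - x) (b - 0 - y) else set0).
  case: ifP => // _; apply: measurableI; last exact: measurable_hit.
  by apply: (measurable_atom_event (xi_poisson u)); exact: measurable_cell.
have le_i k x y : (P (\bigcup_i (if (x + 0 <= a)%N && (y + 0 <= b)%N then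
    atom_in_cell u i k x y `&` hit 0 n ((i, k) :: u) (a - 0 - x) (b - 0 - y) else set0))
    <= (ex x * ey y * (emeanR k * E0))%:E)%E.
  apply: (le_trans (measure_bigcup_le _ (mset k x y))).
  apply: (@le_trans _ _ (\sum_(0 <= i <oo) ((A ^+ n * expR (theta * ht * (a%:R - x%:R) + vt * hz * (b%:R - y%:R)))%:E * P (atom_in_cell u i k x y)))%E).
    apply: lee_nneseries => // i _; case: ifP => [|_]; last first.
      by rewrite measure0 mule_ge0 ?measure_ge0// lee_fin mulr_ge0 ?expR_ge0// exprn_ge0// ltW.
    rewrite !addn0 !subn0 => /andP[xa yb].
    apply: (@le_trans _ _ (P (atom_in_cell u i k x y) * P (hit 0 n ((i, k) :: u) (a - x) (b - y)))%E).
      by rewrite le_eqVlt; apply/orP; left; apply/eqP; exact: atom_hit_indep.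
    rewrite muleC lee_wpmul2r ?measure_ge0//.
    by apply: (le_trans (ih _ _ _)); rewrite !natrB.
  rewrite nneseriesZl; last by move=> i _; exact: measure_ge0.
  rewrite sum_atom_in_cell -EFinM lee_fin le_eqVlt; apply/orP; left; apply/eqP.
  rewrite /ex /ey /E0.
  have -> : theta * ht * (a%:R - x%:R) + vt * hz * (b%:R - y%:R) =
    (theta * ht * a%:R + vt * hz * b%:R) + (- (x%:R * (theta * ht)) + - (y%:R * (vt * hz))) by ring.
  rewrite [expR (_ + (_ - _))]expRD [expR (- _ - _)]expRD; ring.
have le_y k x : (P (\bigcup_y \bigcup_i (if (x + 0 <= a)%N && (y + 0 <= b)%N then
    atom_in_cell u i k x y `&` hit 0 n ((i, k) :: u) (a - 0 - x) (b - 0 - y) else set0))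
    <= (ex x * (expR (vt * hz) * G / vt `^ alpha) * (emeanR k * E0))%:E)%E.
  apply: (measure_bigcup_le_sum _ (le_i k x)) => [y|y|N].
  - by apply: bigcupT_measurable => i; exact: mset.
  - exact: mulr_ge0 (mulr_ge0 (ex0 x) (ey0 y)) (mulr_ge0 (emeanR_ge0 k) E00).
  - rewrite -mulr_suml -mulr_sumr; apply: ler_wpM2r; first exact: mulr_ge0 (emeanR_ge0 k) E00.
    exact: ler_wpM2l (ex0 x) _ _ (sum_ey N).
have le_x k : (P (\bigcup_x \bigcup_y \bigcup_i (if (x + 0 <= a)%N && (y + 0 <= b)%N then
    atom_in_cell u i k x y `&` hit 0 n ((i, k) :: u) (a - 0 - x) (b - 0 - y) else set0))
    <= (expR (theta * ht) / theta * (expR (vt * hz) * G / vt `^ alpha) * (emeanR k * E0))%:E)%E.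
  have c0 : 0 <= expR (vt * hz) * G / vt `^ alpha.
    by rewrite divr_ge0 ?(ltW vta0)// mulr_ge0 ?expR_ge0 ?(ltW G0).
  apply: (measure_bigcup_le_sum _ (le_y k)) => [x|x|N].
  - by do 2 (apply: bigcupT_measurable => ?); exact: mset.
  - exact: mulr_ge0 (mulr_ge0 (ex0 x) c0) (mulr_ge0 (emeanR_ge0 k) E00).
  - rewrite -2!mulr_suml; apply: ler_wpM2r; first exact: mulr_ge0 (emeanR_ge0 k) E00.
    exact: ler_wpM2r c0 _ _ (sum_ex N).
apply: (measure_bigcup_le_sum _ le_x) => [k|k|N].
- by do 3 (apply: bigcupT_measurable => ?); exact: mset.
- apply: mulr_ge0; last exact: mulr_ge0 (emeanR_ge0 k) E00.
  exact: ltW (mulr_gt0 (divr_gt0 (expR_gt0 _) th0) (divr_gt0 (mulr_gt0 (expR_gt0 _) G0) vta0)).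
- rewrite -mulr_sumr -mulr_suml mulrA.
  have -> : A ^+ n.+1 * expR (theta * ht * a%:R + vt * hz * b%:R) = A * E0 by rewrite exprS -mulrA.
  rewrite ler_wpM2r//.
  apply: (@le_trans _ _ (expR (theta * ht) / theta * (expR (vt * hz) * G / vt `^ alpha) * G^-1)).
    apply: ler_wpM2l; last exact: sumG.
    exact: ltW (mulr_gt0 (divr_gt0 (expR_gt0 _) th0) (divr_gt0 (mulr_gt0 (expR_gt0 _) G0) vta0)).
  rewrite /A expRD le_eqVlt; apply/orP; left; apply/eqP.
  by field; rewrite !gt_eqF.
Qed.

Lemma atom_in_cell_inj u i k x y x' y' w :
  atom_in_cell u i k x y w -> atom_in_cell u i k x' y' w -> (x, y) = (x', y').
Proof. by move=> [p cp xp] [p' cp' xp']; apply: cell_inj cp _; have [<-] : Some p' = Some p by rewrite -xp -xp'. Qed.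

(** Entries are non-decreasing, so the first entry is at most the [k]-th one, whatever the layer
    [k]. *)
Lemma atom_in_cell_box u i k x y a b w : (x < a)%N -> (y < b)%N ->
  atom_in_cell u i k x y w -> atom_event (xi u) (box (a%:R * ht) (b%:R * hz)) i w.
Proof.
move=> xa yb [[t p] [/= tx py] e]; exists (t, p) => //; split => /=.
  move: tx; rewrite !in_itv/= => /andP[xt tx].
  rewrite (le_lt_trans _ xt) ?mulr_ge0 ?(ltW ht0)//=.
  by rewrite (le_trans tx)// ler_pM2r// ler_nat.
move: py => /andP[yp py]; rewrite /layer/= pseq_gt0/=.
apply: (le_trans (pseq_nd _ (leq0n k))); apply: (le_trans py).
by rewrite lee_fin ler_pM2r// ler_nat.
Qed.

Lemma block_bigsetU S (I : Type) (r : seq I) (A : I -> set Omega) :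
  (forall i, block F S (A i)) -> block F S (\big[setU/set0]_(i <- r) A i).
Proof.
move=> bA; elim/big_ind: _ => [|B C|i _]; [exact: block0|exact: blockU|exact: bA].
Qed.

(** The trials are the pairs [(i, k)] with [i < I], [k < K]. By [fail_all_le] and [prod_onem_le] one
    of them succeeds with probability at least [E S - E S ^ 2], where [S] sums the lower bounds [g]
    at the remaining room. As [S] is at most [delta K] times the count of one box, the Poisson
    second moment bounds the loss uniformly in [I]; then [I] tends to infinity. *)
Lemma hit1_step (g : nat -> nat -> R) (delta : R) (K a0 b0 a b n : nat) u :
  (forall x y, 0 <= g x y <= delta) -> delta <= 1 ->
  (forall v x y, (x < a)%N -> (y < b)%N ->
    ((g x y)%:E <= P (hit 1 n v (a0 + x) (b0 + y)))%E) ->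
  ((ht * hz `^ alpha / alpha * (\sum_(k < K) emeanR k) *
     (\sum_(x < a) \sum_(y < b) incr_powR alpha y * g (a - x.+1)%N (b - y.+1)%N))%:E
   <= P (hit 1 n.+1 u (a0 + a) (b0 + b)) + (delta ^+ 2 * K%:R ^+ 2 *
     (box_mean (a%:R * ht) (b%:R * hz) + box_mean (a%:R * ht) (b%:R * hz) ^+ 2))%:E)%E.
Proof.
move=> g01 d1 gP; set m := box_mean _ _.
pose C := option ('I_a * 'I_b).
(* [None] means that entry [k] of atom [i] yields no child in the [a * b] cells; such a trial counts
   as failed. *)
pose lab (l : nat * nat) (w : Omega) : C :=
  [pick c : 'I_a * 'I_b | `[< atom_in_cell u l.1 l.2 c.1 c.2 w >]].
pose A (c : C) : R := if c is Some xy then g (a - xy.1.+1)%N (b - xy.2.+1)%N else 0.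
pose G (l : nat * nat) (c : C) : set Omega :=
  if c is Some xy then hit 1 n (l :: u) (a0 + a - 1 - xy.1) (b0 + b - 1 - xy.2) else set0.
have labSome l c : [set w | lab l w = Some c] = atom_in_cell u l.1 l.2 c.1 c.2.
  apply/seteqP; split => w; rewrite /lab/=; case: pickP => [c' /asboolP h|h]//.
    by move=> [<-].
  move=> h'; congr Some; have [e1 e2] := atom_in_cell_inj h h'.
  by case: c c' e1 e2 {h h'} => c1 c2 [c1' c2'] /= /val_inj -> /val_inj ->.
  by move=> h'; have := h c; rewrite asboolT.
have bcell i k x y : block F [set u] (atom_in_cell u i k x y).
  by apply: block_atom_event; exact: measurable_cell.
have labNone l : [set w | lab l w = None] =
    ~` (\big[setU/set0]_(c : 'I_a * 'I_b) atom_in_cell u l.1 l.2 c.1 c.2).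
  apply/seteqP; split => w; rewrite /lab/= -bigcup_seq; case: pickP => [c' /asboolP h|h]//.
    by move=> _ [c _ /= hc]; have := h c; rewrite asboolT.
  by move=> []; exists c' => //=; rewrite mem_index_enum.
have labS0 l c : block F [set u] [set w | lab l w = c].
  case: c => [c|]; first by rewrite labSome.
  by rewrite labNone; apply: blockC; apply: block_bigsetU => c.
have GSb l c : block F (subtree (l :: u)) (G l c).
  by case: c => [c|] /=; [exact: block_hit|exact: block0].
have A01 c : 0 <= A c <= 1.
  case: c => [c|] /=; last by rewrite lexx ler01.
  by have /andP[-> h] := g01 (a - c.1.+1)%N (b - c.2.+1)%N; rewrite (le_trans h).
have AG l c : ((A c)%:E <= P (G l c))%E.
  case: c => [[x y]|] /=; last by rewrite measure0.
  have -> : (a0 + a - 1 - x = a0 + (a - x.+1))%N by have := ltn_ord x; lia.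
  have -> : (b0 + b - 1 - y = b0 + (b - y.+1))%N by have := ltn_ord y; lia.
  by apply: gP; have := ltn_ord x; have := ltn_ord y; lia.
have S0Sb (l : nat * nat) j : [set u] j -> ~ subtree (l :: u) j by move=> /= ->; exact: notin_subtree.
pose s I := [seq (i, k) | i <- index_iota 0 I, k <- index_iota 0 K].
have us I : uniq (s I) by apply: allpairs_uniq; rewrite ?iota_uniq// => -[? ?] [? ?].
pose B0 := box (a%:R * ht) (b%:R * hz).
have mB0 : measurable B0 by exact: measurable_box.
pose fail I := [set w | forall l, l \in s I -> ~ G l (lab l w) w].
have failP I : (P (fail I) <= \int[P]_w (\prod_(l <- s I) (1 - A (lab l w)))%:E)%E.
  have bT : block F [set u] setT by exact: blockT.
  have := fail_all_le sigma_atoms_measurable sigma_atomsT sigma_atomsI xi_indep labS0 GSb A01 AG S0Sb (@subtree_disj u) (us I) bT.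
  by rewrite setTI.
have mfail I : measurable (fail I).
  exact: (measurable_fail_all sigma_atoms_measurable labS0 GSb).
have hit_fail I : (1 <= P (hit 1 n.+1 u (a0 + a) (b0 + b)) + P (fail I))%E.
  rewrite -(probability_setT P); apply: le_trans (measureU2 _ _ _) => //; last exact: measurable_hit.
  apply: le_measure; rewrite ?inE//.
    by apply: measurableU => //; exact: measurable_hit.
  move=> w _; have [fw|nfw] := pselect (fail I w); [by right|left].
  move: nfw => /existsNP[[i k]] /not_implyP[_ /contrapT].
  case elab : (lab (i, k) w) => [[x y]|]//= hw.
  have cw : atom_in_cell u i k x y w by have : [set w | lab (i, k) w = Some (x, y)] w := elab; rewrite labSome.
  exists k => //; exists x => //; exists y => //; exists i => //.
  by rewrite ifT//; have := ltn_ord x; have := ltn_ord y; lia.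
have mA (f : C -> R) l : measurable_fun setT (fun w => f (lab l w)).
  exact: (measurable_fun_lab sigma_atoms_measurable labS0).
pose E (l : nat * nat) (c : 'I_a * 'I_b) := atom_in_cell u l.1 l.2 c.1 c.2.
have mE l c : measurable (E l c).
  by apply: (measurable_atom_event (xi_poisson u)); exact: measurable_cell.
have AE l w : A (lab l w) = \sum_c A (Some c) * \1_(E l c) w.
  case elab : (lab l w) => [c|].
    have cw : E l c w by have : [set w | lab l w = Some c] w := elab; rewrite labSome.
    rewrite (bigD1 c)//= indicE mem_set// mulr1 big1 ?addr0// => c' c'c.
    rewrite indicE memNset ?mulr0// => c'w.
    have [e1 e2] := atom_in_cell_inj cw c'w; move/eqP: c'c; apply.
    by case: c c' e1 e2 {elab cw c'w} => c1 c2 [c1' c2'] /= /val_inj -> /val_inj ->.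
  rewrite big1// => c _; rewrite indicE memNset ?mulr0// => c'w.
  have : [set w | lab l w = Some c] w by rewrite labSome.
  by rewrite /= elab.
have intA l : (\int[P]_w (A (lab l w))%:E = \sum_c (A (Some c))%:E * P (E l c))%E.
  under eq_integral do rewrite AE -sumEFin.
  rewrite ge0_integral_sum//; last 2 first.
  - by move=> c; apply/measurable_EFinP; apply: measurable_funM => //; exact: measurable_indic.
  - by move=> c w _; rewrite lee_fin mulr_ge0//; have /andP[] := A01 (Some c).
  apply: eq_bigr => c _; under eq_integral do rewrite EFinM.
  rewrite ge0_integralZl_EFin ?integral_indic ?setIT//.
  - by apply/measurable_EFinP; exact: measurable_indic.
  - by have /andP[] := A01 (Some c).
pose D := delta ^+ 2 * K%:R ^+ 2 * (m + m ^+ 2).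
pose prodA I w := \prod_(l <- s I) (1 - A (lab l w)).
have prodA0 I w : 0 <= prodA I w.
  by apply: prodr_ge0 => l _; rewrite subr_ge0; have /andP[] := A01 (lab l w).
have mprodA I : measurable_fun setT (fun w => (prodA I w)%:E).
  apply/measurable_EFinP; apply: measurable_prod => l _; exact: (mA (fun c => 1 - A c)).
have sumA0 I w : 0 <= \sum_(l <- s I) A (lab l w).
  by apply: sumr_ge0 => l _; have /andP[] := A01 (lab l w).
have delta0 : 0 <= delta by have /andP[h1 h2] := g01 0%N 0%N; exact: le_trans h2.
have sumA I w : \sum_(l <- s I) A (lab l w) <= delta * K%:R * truncated_count R (xi u) B0 I w.
  rewrite /s big_allpairs_dep/= /truncated_count mulr_sumr -(big_mkord xpredT (fun i => delta * K%:R * \1_(atom_event (xi u) B0 i) w)).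
  apply: ler_sum => i _.
  apply: (@le_trans _ _ (\sum_(0 <= k < K) delta * \1_(atom_event (xi u) B0 i) w)); last first.
    by rewrite sumr_const_nat subn0 -[leLHS]mulr_natr [leLHS]mulrAC lexx.
  apply: ler_sum => k _; case elab : (lab (i, k) w) => [[x y]|]/=; last by rewrite mulr_ge0.
  have cw : atom_in_cell u i k x y w by have : [set w | lab (i, k) w = Some (x, y)] w := elab; rewrite labSome.
  rewrite indicE mem_set ?mulr1; last exact: atom_in_cell_box cw.
  by have /andP[] := g01 (a - x.+1)%N (b - y.+1)%N.
have m0 : 0 <= m by apply: box_mean_ge0; nonneg.
have muB0 : intensity alpha lambda B0 = m%:E by apply: intensity_box; nonneg.
have bound I : (\int[P]_w (prodA I w)%:E + \sum_(l <- s I) \sum_c (A (Some c))%:E * P (E l c) <= 1 + D%:E)%E.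
  under eq_bigr do rewrite -intA.
  rewrite -ge0_integral_sum//; last 2 first.
  - by move=> l; apply/measurable_EFinP; exact: mA.
  - by move=> l w _; rewrite lee_fin; have /andP[] := A01 (lab l w).
  rewrite -ge0_integralD//; last 3 first.
  - by move=> w _; rewrite lee_fin.
  - by move=> w _; rewrite sumEFin lee_fin.
  - by apply: emeasurable_sum => l; apply/measurable_EFinP; exact: mA.
  apply: (@le_trans _ _ (\int[P]_w (1 + (delta * K%:R) ^+ 2 * truncated_count R (xi u) B0 I w ^+ 2)%:E)%E).
    apply: ge0_le_integral => //.
    - by move=> w _; rewrite sumEFin lee_fin addr_ge0.
    - apply: emeasurable_funD => //.
      by apply: emeasurable_sum => l; apply/measurable_EFinP; exact: mA.
    - apply/measurable_EFinP; apply: measurable_funD => //; apply: measurable_funM => //.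
      by apply: measurable_funX; exact: (measurable_truncated_count (xi_poisson u)).
    - move=> w _; rewrite sumEFin lee_fin.
      apply: le_trans (prod_onem_le _ _) _; first by move=> l; exact: A01.
      rewrite lerD2l -exprMn lerXn2r ?nnegrE// ?mulr_ge0//.
      exact: truncated_count_ge0.
  under eq_integral do rewrite EFinD EFinM.
  rewrite ge0_integralD//; last 2 first.
  - by move=> w _; rewrite -EFinM lee_fin mulr_ge0// sqr_ge0.
  - apply: emeasurable_funM => //; apply/measurable_EFinP.
    by apply: measurable_funX; exact: (measurable_truncated_count (xi_poisson u)).
  rewrite integral_cst//= probability_setT mule1 leeD2l//.
  rewrite ge0_integralZl_EFin ?sqr_ge0//; last 2 first.
  - by move=> w _; rewrite lee_fin sqr_ge0.
  - apply/measurable_EFinP.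
    by apply: measurable_funX; exact: (measurable_truncated_count (xi_poisson u)).
  apply: (@le_trans _ _ (((delta * K%:R) ^+ 2)%:E * (m + m ^+ 2)%:E)%E); last first.
    by rewrite -EFinM lee_fin exprMn.
  apply: lee_wpmul2l; first by rewrite lee_fin sqr_ge0.
  exact: (integral_truncated_count_sqr (xi_poisson u) mB0 muB0 m0).
have sum_ge0 I : (0 <= \sum_(l <- s I) \sum_c (A (Some c))%:E * P (E l c))%E.
  apply: sume_ge0 => l _; apply: sume_ge0 => c _; rewrite mule_ge0// lee_fin.
  by have /andP[] := A01 (Some c).
have boundS I : (\sum_(l <- s I) \sum_c (A (Some c))%:E * P (E l c) <=
    P (hit 1 n.+1 u (a0 + a) (b0 + b)) + D%:E)%E.
  (* Finiteness allows this integral to be cancelled on both sides. *)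
  have fI : (\int[P]_w (prodA I w)%:E)%E \is a fin_num.
    rewrite ge0_fin_numE; last by apply: integral_ge0 => w _; rewrite lee_fin.
    apply: (@le_lt_trans _ _ (1 + D%:E)%E); last exact: ltry.
    by apply: le_trans (bound I); rewrite leeDl.
  rewrite -(leeD2lE _ _ fI); apply: le_trans (bound I) _.
  rewrite addeA leeD2r//; apply: le_trans (hit_fail I) _.
  by rewrite [leRHS]addeC; apply: leeD => //; exact: failP.
(* The bound is uniform in [I], so it passes to the series over all labels, where [sum_atom_in_cell]
   yields the intensities of the cells. *)
apply: (@le_trans _ _ (\sum_(0 <= i <oo) \sum_(0 <= k < K) \sum_c (A (Some c))%:E * P (E (i, k) c))%E); last first.
  apply: lime_le.
    apply: is_cvg_nneseries => i _ _; apply: sume_ge0 => k _; apply: sume_ge0 => c _.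
    by rewrite mule_ge0// lee_fin; have /andP[] := A01 (Some c).
  by apply: nearW => I; have := boundS I; rewrite /s big_allpairs_dep.
rewrite nneseries_sum_nat; last first.
  move=> i k; apply: sume_ge0 => c _.
  by rewrite mule_ge0// lee_fin; have /andP[] := A01 (Some c).
rewrite big_mkord.
have sumk (k : 'I_K) : (\sum_(0 <= i <oo) \sum_c (A (Some c))%:E * P (E (i, nat_of_ord k) c) =
    (\sum_c A (Some c) * (ht * (hz `^ alpha * incr_powR alpha c.2 / alpha * emeanR k)))%:E)%E.
  rewrite nneseries_sum; last first.
    by move=> c i _; rewrite mule_ge0// lee_fin; have /andP[] := A01 (Some c).
  rewrite -sumEFin; apply: eq_bigr => c _.
  by rewrite nneseriesZl// /E sum_atom_in_cell -EFinM.
rewrite (eq_bigr _ (fun k _ => sumk k)) sumEFin lee_fin.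
rewrite -[leLHS]mulrA mulr_suml mulr_sumr le_eqVlt; apply/orP; left; apply/eqP.
apply: eq_bigr => k _.
rewrite pair_big/= !mulr_sumr; apply: eq_bigr => -[x y] _ /=; ring.
Qed.

(** Either fewer than [r] atoms of the root fall in the box, or at least [r] independent subtrees
    all fail. Using only the first entry of each atom assigns one subtree to each label, and the
    first step needs no rounding. *)
Lemma hit1_boost (q s v : R) (n a b r : nat) : 0 <= q <= 1 -> 0 <= s -> 0 <= v ->
  (forall u, (q%:E <= P (hit 1 n u a b))%E) ->
  (P (~` \bigcup_i (atom_event (xi [::]) (box s v) i `&` hit 1 n [:: (i, 0%N)] a b)) <=
   (\sum_(j < r) poisson_weight (box_mean s v) j + (1 - q) ^+ r)%:E)%E.
Proof.
move=> q01 s0 v0 qP; have /andP[q0 q1] := q01.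
pose lab (i : nat) (w : Omega) : bool := `[< atom_event (xi [::]) (box s v) i w >].
pose A (c : bool) : R := if c then q else 0.
pose G (i : nat) (c : bool) : set Omega := if c then hit 1 n [:: (i, 0%N)] a b else set0.
have bE i : block F [set [::]] (atom_event (xi [::]) (box s v) i).
  by apply: block_atom_event; exact: measurable_box.
have labS0 i c : block F [set [::]] [set w | lab i w = c].
  case: c.
    have -> : [set w | lab i w = true] = atom_event (xi [::]) (box s v) i.
      by apply/seteqP; split => w /= => [/asboolP|/asboolP].
    exact: bE.
  have -> : [set w | lab i w = false] = ~` atom_event (xi [::]) (box s v) i.
    apply/seteqP; split => w; rewrite /lab/=; last exact: asboolF.
    by move=> h iw; rewrite asboolT in h.
  by apply: blockC; exact: bE.
have GSb i c : block F (subtree [:: (i, 0%N)]) (G i c).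
  by case: c => /=; [exact: block_hit|exact: block0].
have A01 c : 0 <= A c <= 1 by case: c; rewrite //= lexx ler01.
have AG i c : ((A c)%:E <= P (G i c))%E by case: c => /=; rewrite ?measure0.
have S0Sb (i : nat) (j : word) : [set [::]] j -> ~ subtree [:: (i, 0%N)] j.
  by move=> /= ->; exact: notin_subtree.
have SbSb (i i' : nat) (j : word) : i != i' -> subtree [:: (i, 0%N)] j -> ~ subtree [:: (i', 0%N)] j.
  by move=> ii'; apply: subtree_disj; rewrite xpair_eqE negb_and ii'.
have mB : measurable (box s v) by exact: measurable_box.
(* The slack [e] pays for restricting to finitely many labels. *)
apply/lee_addgt0Pr => e e0.
have m0 : 0 <= box_mean s v by exact: box_mean_ge0.
have [I PI] := truncated_count_lt (xi_poisson [::]) mB (intensity_box s0 v0) m0 r e0.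
have bT : block F [set [::]] setT by exact: blockT.
have := fail_all_le sigma_atoms_measurable sigma_atomsT sigma_atomsI xi_indep labS0 GSb A01 AG S0Sb SbSb (iota_uniq 0 I) bT.
rewrite setTI => failP.
have mfail := measurable_fail_all sigma_atoms_measurable labS0 GSb (iota 0 I).
apply: (le_trans _ (le_trans failP _)).
  apply: le_measure; rewrite ?inE//.
    apply: measurableC; apply: bigcupT_measurable => i; apply: measurableI; last exact: measurable_hit.
    exact: (measurable_atom_event (xi_poisson [::])).
  move=> w hw i _; rewrite /G; case: ifPn => [/asboolP iw hitw|_ []].
  by apply: hw; exists i.
have mT : measurable [set w | truncated_count R (xi [::]) (box s v) I w < r%:R].
  have -> : [set w | truncated_count R (xi [::]) (box s v) I w < r%:R] =
      setT `&` truncated_count R (xi [::]) (box s v) I @^-1` `]-oo, r%:R[.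
    by apply/seteqP; split=> w /=; rewrite in_itv//= => -[].
  exact: (measurable_truncated_count (xi_poisson [::])).
apply: (@le_trans _ _ (\int[P]_w ((\1_[set w | truncated_count R (xi [::]) (box s v) I w < r%:R] w)%:E + ((1 - q) ^+ r)%:E))%E).
  apply: ge0_le_integral => //.
  - by move=> w _; rewrite lee_fin; apply: prodr_ge0 => i _; rewrite subr_ge0; have /andP[] := A01 (lab i w).
  - apply/measurable_EFinP; apply: measurable_prod => i _.
    exact: (measurable_fun_lab sigma_atoms_measurable labS0 (fun c => 1 - A c)).
  - by apply: emeasurable_funD => //; apply/measurable_EFinP; exact: measurable_indic.
  - move=> w _; rewrite -EFinD lee_fin indicE; case: (boolP (w \in _)) => wr.
      apply: (@le_trans _ _ 1); last by rewrite lerDl exprn_ge0// subr_ge0.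
      by apply: prodr_ile1 => i _; case: (lab i w) => /=; rewrite ?subr0 ?lexx ?ler01// subr_ge0 gerBl q0 q1.
    have {}wr : r%:R <= truncated_count R (xi [::]) (box s v) I w.
      by rewrite leNgt; apply/negP => h; move/negP: wr; apply; apply/mem_set.
    have prodE J : \prod_(i <- J) (1 - A (lab i w)) = (1 - q) ^+ (\sum_(i <- J) lab i w).
      elim: J => [|i J ih]; first by rewrite !big_nil expr0.
      by rewrite !big_cons ih; case: (lab i w); rewrite /= ?exprS ?subr0 ?mul1r.
    rewrite prodE add0r ler_wiXn2l ?subr_ge0// ?gerBl//.
    rewrite -(ler_nat R); apply: le_trans wr _.
    rewrite /truncated_count natr_sum -(big_mkord xpredT (fun i => \1_(atom_event (xi [::]) (box s v) i) w)).
    rewrite /index_iota subn0; apply: ler_sum => i _; rewrite indicE ler_nat.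
    by case: (boolP (w \in _)) => // /set_mem iw; rewrite /lab asboolT.
rewrite ge0_integralD//; last 2 first.
- by apply/measurable_EFinP; exact: measurable_indic.
- by move=> w _; rewrite lee_fin exprn_ge0// subr_ge0.
rewrite integral_indic// setIT integral_cst//= probability_setT mule1.
rewrite EFinD -addeA [X in (_ <= _ + X)%E]addeC addeA; apply: leeD2r.
by rewrite -EFinD.
Qed.

End lattice_cells.

End branching.

(** * Positions of individuals *)

Section option_measurable.
Context d (Omega : measurableType d).

(** Measurability of a partially defined random variable; [B = setT] gives its domain. *)
Definition option_measurable d1 (T1 : measurableType d1) (Y : Omega -> option T1) :=
  forall B, measurable B -> measurable [set w | exists2 x, B x & Y w = Some x].

Lemma option_measurable_odflt d1 (T1 : measurableType d1) (Y : Omega -> option T1) x0 :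
  option_measurable Y -> measurable_fun setT (fun w => odflt x0 (Y w)).
Proof.
move=> mY _ B mB; rewrite setTI.
have -> : (fun w => odflt x0 (Y w)) @^-1` B =
    [set w | exists2 x, B x & Y w = Some x] `|`
    (if x0 \in B then ~` [set w | exists2 x, setT x & Y w = Some x] else set0).
  apply/seteqP; split=> w /=.
    case e : (Y w) => [x|] /= Bx; first by left; exists x.
    by right; rewrite mem_set// => -[x _]; rewrite e.
  case: (boolP (x0 \in B)) => [/set_mem xB|_] [[x Bx ->]//|]//=.
  by case: (Y w) => //= x []; exists x.
apply: measurableU; first exact: mY.
by case: ifP => // _; apply: measurableC; exact: mY.
Qed.

Lemma option_measurable_map2 d1 (T1 : measurableType d1) d2 (T2 : measurableType d2)
    d3 (T3 : measurableType d3) (h : T1 * T2 -> T3) Y1 Y2 (x1 : T1) (x2 : T2) :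
  measurable_fun setT h -> option_measurable Y1 -> option_measurable Y2 ->
  option_measurable (fun w => if (Y1 w, Y2 w) is (Some p, Some q) then Some (h (p, q)) else None).
Proof.
move=> mh m1 m2 B mB.
(* The defaults make [f] total; intersecting with the two domains removes their effect. *)
pose f w := h (odflt x1 (Y1 w), odflt x2 (Y2 w)).
have mf : measurable_fun setT f.
  apply: (@measurableT_comp _ _ _ _ _ _ h _ (fun w => (odflt x1 (Y1 w), odflt x2 (Y2 w)))) => //.
  by apply: measurable_fun_pair; exact: option_measurable_odflt.
have -> : [set w | exists2 x, B x & (if (Y1 w, Y2 w) is (Some p, Some q) then Some (h (p, q)) else None) = Some x] =
    [set w | exists2 x, setT x & Y1 w = Some x] `&` [set w | exists2 x, setT x & Y2 w = Some x]
    `&` (setT `&` f @^-1` B).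
  apply/seteqP; split=> w /=; rewrite /f.
    case: (Y1 w) => [p|]; last by case=> ? _.
    case: (Y2 w) => [q|]; last by case=> ? _.
    by move=> [x Bx [ex]]; split; [split; [exists p|exists q]|rewrite /= ex].
  by move=> [[[p _ ->] [q _ ->]]] /= [_ Bh]; exists (h (p, q)).
by apply: measurableI; [apply: measurableI; [exact: m1|exact: m2]|exact: mf].
Qed.

End option_measurable.

Section positions.
Context (R : realType) (alpha : R) (lambda : {finite_measure set (pstar R) -> \bar R})
  d (Omega : measurableType d) (P : probability Omega R)
  (xi : seq (nat * nat) -> Omega -> nat -> option (R * pstar R)).
Hypotheses (xi_poisson : forall u, poisson_process P (xi u) (intensity alpha lambda)).
Local Notation word := (seq (nat * nat)).
Local Notation off w := (fun u => spread (xi u w)).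

Definition origin_box (z : R) : set (R * R) := `[0, 1]%classic `*` `[0, z]%classic.

Lemma option_measurable_spread u ik : option_measurable (fun w => spread (xi u w) ik).
Proof.
move=> B mB.
pose B' := [set tx : R * pstar R | (pseq tx.2 ik.2 < +oo)%E /\ B (tx.1, fine (pseq tx.2 ik.2))].
have mq : measurable_fun setT (fun tx : R * pstar R => pseq tx.2 ik.2).
  apply: (@measurableT_comp _ _ _ _ _ _ (fun x : pstar R => pseq x ik.2) _ snd) => //.
  exact: measurable_pseq.
have mB' : measurable B'.
  have -> : B' = (setT `&` [set tx | (pseq tx.2 ik.2 < +oo)%E]) `&`
      (setT `&` (fun tx : R * pstar R => (tx.1, fine (pseq tx.2 ik.2))) @^-1` B).
    by apply/seteqP; split => tx /=; [move=> []|move=> [[_ ?] [_ ?]]].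
  apply: measurableI; first exact: emeasurable_fun_infty_o.
  apply: (measurable_fun_pair _ _) => //.
  exact: (@measurableT_comp _ _ _ _ _ _ fine _ (fun tx : R * pstar R => pseq tx.2 ik.2)).
have -> : [set w | exists2 x, B x & spread (xi u w) ik = Some x] = atom_event (xi u) B' ik.1.
  apply/seteqP; split=> w /=; rewrite /spread.
    case e : (xi u w ik.1) => [tx|]; last by case=> ? _.
    case eq : (pseq tx.2 ik.2) => [r| |]; try by case=> ? _.
    by move=> [x Bx [ex]]; exists tx => //; split => /=; rewrite eq ?ltry//= ex.
  move=> [tx [/= fx Bx] ->]; move: fx Bx; have := pseq_gt0 tx.2 ik.2.
  by case: (pseq tx.2 ik.2) => [r| |]//= _ _ Bx; exists (tx.1, r).
exact: (measurable_atom_event (xi_poisson u)).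
Qed.

Lemma option_measurable_position u : option_measurable (fun w => position (off w) u).
Proof.
elim: u => [|ik v ih].
  move=> B mB; have [B0|B0] := pselect (B (0, 0)).
    have -> : [set w | exists2 x, B x & @position R _ (off w) [::] = Some x] = setT.
      by apply/seteqP; split=> w //= _; exists (0, 0).
    exact: measurableT.
  have -> : [set w | exists2 x, B x & @position R _ (off w) [::] = Some x] = set0.
    by apply/seteqP; split=> w //= [x Bx [e]]; apply: B0; rewrite e.
  exact: measurable0.
apply: (@option_measurable_map2 _ _ _ _ _ _ _ _ (fun pq : (R * R) * (R * R) => (pq.1.1 + pq.2.1, pq.1.2 + pq.2.2))
  (fun w => position (off w) v) (fun w => spread (xi v w) ik) (0, 0) (0, 0)) => //.
  have mm (f : R * R -> R) (g : (R * R) * (R * R) -> R * R) : measurable_fun setT f -> measurable_fun setT g ->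
    measurable_fun setT (f \o g) by move=> mf mg; exact: measurableT_comp.
  apply: measurable_fun_pair; apply: measurable_funD.
  - by apply: (mm fst fst).
  - by apply: (mm fst snd).
  - by apply: (mm snd fst).
  - by apply: (mm snd snd).
exact: option_measurable_spread.
Qed.

Lemma count_atoms_eq0 (I : choiceType) (T : Type) (a : I -> option T) (B : set T) :
  count_atoms R a B = 0%E <-> forall i, ~ atoms_in a B i.
Proof.
rewrite /count_atoms /counting; case: asboolP => [fin|nfin]; split => //.
- move=> [] /eqP; rewrite pnatr_eq0 finmap.cardfs_eq0 => /eqP e i ai.
  by move: ai; rewrite -(fset_setK fin) e set_fset0.
- move=> h; have -> : atoms_in a B = set0 by apply/seteqP; split => i //; exact: h.
  by rewrite fset_set0 finmap.cardfs0.
- move=> h; exfalso; apply: nfin; suff -> : atoms_in a B = set0 by exact: finite_set0.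
  by apply/seteqP; split => i //; exact: h.
Qed.

Lemma brw_box_eq0 w n z : brw (off w) n (origin_box z) = 0%E <->
  forall u, size u = n -> forall p, position (off w) u = Some p -> ~ origin_box z p.
Proof.
rewrite /brw count_atoms_eq0; split=> [h u un p up zp|h u [p zp up]].
  have un' : size u == n by exact/eqP.
  by apply: (h (Tuple un')); exists p.
by apply: h up zp; rewrite size_tuple.
Qed.

Lemma brw_box_le w n z z' : z <= z' ->
  brw (off w) n (origin_box z') = 0%E -> brw (off w) n (origin_box z) = 0%E.
Proof.
move=> zz' /brw_box_eq0 h; apply/brw_box_eq0 => u un p up zp; apply: (h _ un _ up).
case: zp => /= h1; rewrite in_itv/= => /andP[h2 h3]; split => //=.
by rewrite in_itv/= h2 (le_trans h3).
Qed.

Lemma measurable_brw_box n z : measurable [set w | brw (off w) n (origin_box z) = 0%E].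
Proof.
have -> : [set w | brw (off w) n (origin_box z) = 0%E] =
    ~` \bigcup_(u in [set: n.-tuple (nat * nat)])
      [set w | exists2 x, origin_box z x & position (off w) u = Some x].
  apply/seteqP; split=> w /=.
    by move=> /brw_box_eq0 h [u _ [p zp up]]; apply: h up zp; rewrite size_tuple.
  move=> h; apply/brw_box_eq0 => u un p up zp; apply: h.
  have un' : size u == n by exact/eqP.
  by exists (Tuple un') => //; exists p.
apply: measurableC; apply: countable_bigcupT_measurable; first exact: countableP.
move=> u; apply: option_measurable_position.
by apply: measurableX; exact: measurable_itv.
Qed.

(** Emptiness of the box is monotone in [z], so the supremum exceeds [r] exactly when some rational
    [z > r] has an empty box. *)
Lemma measurable_frontier n : measurable_fun setT (fun w => frontier (brw (off w) n)).
Proof.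
apply: (measurability _ (ErealGenOInfty.measurableE R)) => //= _ [_ [r ->] <-].
rewrite setTI.
have -> : (fun w => frontier (brw (off w) n)) @^-1` `]r%:E, +oo[ =
    \bigcup_(q : rat) (if r < ratr q then [set w | brw (off w) n (origin_box (ratr q)) = 0%E] else set0).
  apply/seteqP; split=> w /=; rewrite in_itv/= andbT.
    move=> /ereal_sup_gt[_ [z zw <-]]; rewrite lte_fin => /rat_in_itvoo[q /itvP h].
    by exists q => //; rewrite h; apply: brw_box_le zw; rewrite h.
  move=> [q _]; case: ifP => // rq qw; apply: (@lt_le_trans _ _ (ratr q)%:E).
    by rewrite lte_fin.
  by apply: ereal_sup_ubound; exists (ratr q).
apply: bigcupT_measurable_rat => q; case: ifP => // _; exact: measurable_brw_box.
Qed.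

Lemma frontier_gt w n z : (z%:E < frontier (brw (off w) n))%E -> brw (off w) n (origin_box z) = 0%E.
Proof.
move=> /ereal_sup_gt[_ [z' zw <-]]; rewrite lte_fin => zz'; exact: brw_box_le (ltW zz') zw.
Qed.

Lemma frontier_lt w n z : (frontier (brw (off w) n) < z%:E)%E -> brw (off w) n (origin_box z) <> 0%E.
Proof.
move=> fz z0; have : (z%:E <= frontier (brw (off w) n))%E by apply: ereal_sup_ubound; exists z.
by rewrite leNgt fz.
Qed.

(** For [z < 0] the interval [[0, z]] is empty. *)
Lemma frontier_ge0 w n : (0 <= frontier (brw (off w) n))%E.
Proof.
apply/lee_subgt0Pr => e e0; rewrite sub0e -EFinN; apply: ereal_sup_ubound; exists (- e) => //=.
apply/brw_box_eq0 => u un p up [_] /=; rewrite in_itv/= => /andP[p0 pe].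
by have := le_trans p0 pe; rewrite oppr_ge0 leNgt e0.
Qed.

Lemma position_child w u i k t x r q : xi u w i = Some (t, x) -> pseq x k = r%:E ->
  position (off w) u = Some q -> position (off w) ((i, k) :: u) = Some (q.1 + t, q.2 + r).
Proof. by move=> /= h1 h2 ->; rewrite /spread/= h1/= h2. Qed.

Lemma natr_subS (x a : nat) : (x + 1 <= a)%N -> x.+1%:R + (a - 1 - x)%:R = a%:R :> R.
Proof. by move=> xa; rewrite -natrD; congr (_%:R); lia. Qed.

(** Rounding up overestimates displacements, so a hit on the grid is realized by a true individual;
    the lower bounds on [p] keep it in the quadrant. *)
Lemma hit1_position (ht hz : R) : 0 < ht -> 0 < hz -> forall n u a b w q,
  hit xi ht hz 1 n u a b w -> position (off w) u = Some q ->
  exists v, size v = n /\ exists p, [/\ position (off w) (v ++ u) = Some p,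
    q.1 <= p.1 <= q.1 + a%:R * ht & q.2 <= p.2 <= q.2 + b%:R * hz].
Proof.
move=> ht0 hz0; elim=> [|n ih] u a b w q.
  move=> _ uq; exists [::]; split => //; exists q; split => //.
    by rewrite lexx lerDl mulr_ge0// ltW.
  by rewrite lexx lerDl mulr_ge0// ltW.
move=> /= [k _ [x _ [y _ [i _]]]]; case: ifP => // /andP[xa yb] [] [[t s] [/= tx sy] uw] hw uq.
move: tx; rewrite in_itv/= => /andP[t1 t2]; move: sy => /andP[].
case er : (pseq s k) => [r| |]//; rewrite lte_fin lee_fin => r1 r2.
have qk := position_child uw er uq.
have [v [sv [p [vp /andP[p1 p2] /andP[p3 p4]]]]] := ih _ _ _ _ _ hw qk.
exists (rcons v (i, k)); split; first by rewrite size_rcons sv.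
exists p; rewrite cat_rcons; move: p1 p2 p3 p4 => /= p1 p2 p3 p4; split => //.
  have ea : a%:R * ht = x.+1%:R * ht + (a - 1 - x)%:R * ht by rewrite -mulrDl natr_subS.
  have : 0 <= x%:R * ht by rewrite mulr_ge0// ltW.
  by move=> h1; rewrite ea; apply/andP; split; lra.
have eb : b%:R * hz = y.+1%:R * hz + (b - 1 - y)%:R * hz by rewrite -mulrDl natr_subS.
have : 0 <= y%:R * hz by rewrite mulr_ge0// ltW.
by move=> h1; rewrite eb; apply/andP; split; lra.
Qed.

(** Times of atoms are positive only almost surely. Positivity makes positions increase along
    lineages, so that the ancestors of an individual in a box satisfy the same upper bounds. *)
Definition positive_atoms : set Omega :=
  [set w | forall u i tx, xi u w i = Some tx -> 0 < tx.1].

Lemma position_suffix w (v u : word) p : positive_atoms w -> position (off w) (v ++ u) = Some p ->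
  exists2 q, position (off w) u = Some q & q.1 <= p.1 /\ q.2 <= p.2.
Proof.
move=> pw; elim: v p => [|ik v ih] p /=; first by exists p.
case e : (position _ _) => [p'|]//; have [q uq [h1 h2]] := ih _ e.
rewrite /spread; case ea : (xi _ _ _) => [tx|]//; case er : (pseq _ _) => [r| |]// [<-].
exists q => //=; split.
  by rewrite (le_trans h1)// lerDl ltW//; exact: pw ea.
by rewrite (le_trans h2)// lerDl ltW// -lte_fin -er pseq_gt0.
Qed.

Lemma grid_cell (h t : R) : 0 < h -> 0 < t -> exists n : nat, n%:R * h < t <= n.+1%:R * h.
Proof.
move=> h0 t0; have ex : exists n : nat, t <= n.+1%:R * h.
  have /archi_boundP := ltW (divr_gt0 t0 h0); set m := Num.bound _ => hm.
  exists m; rewrite -ler_pdivrMr// (le_trans (ltW hm))// ler_nat.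
  by rewrite leqnSn.
case: (ex_minnP ex) => n nt nmin; exists n; rewrite nt andbT.
case: n nt nmin => [|n] _ nmin; first by rewrite mul0r.
by rewrite ltNge; apply/negP => /nmin; rewrite ltnn.
Qed.

(** Rounding down underestimates displacements. The strict bounds with [a.+1] and [b.+1] allow [a]
    and [b] to be integer parts of the available room divided by the mesh. *)
Lemma position_hit0 (ht hz : R) : 0 < ht -> 0 < hz -> forall (v u : word) a b w q p,
  positive_atoms w -> position (off w) u = Some q -> position (off w) (v ++ u) = Some p ->
  p.1 < q.1 + a.+1%:R * ht -> p.2 < q.2 + b.+1%:R * hz -> hit xi ht hz 0 (size v) u a b w.
Proof.
(* The child of [u] on the way to [v ++ u] is the last letter of [v], hence the induction from that
   end. *)
move=> ht0 hz0; elim/last_ind=> [//|v [i k] ih] u a b w q p pw uq.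
rewrite cat_rcons size_rcons => vp p1 p2.
have [q' kq' [h1 h2]] := position_suffix pw vp.
have := kq'; rewrite /= uq /spread/=; case ea : (xi u w i) => [[t x]|]//=.
case er : (pseq x k) => [r| |]// [eq'].
have t0 : 0 < t := pw _ _ _ ea.
have r0 : 0 < r by rewrite -lte_fin -er pseq_gt0.
have [a' /andP[t1 t2]] := grid_cell ht0 t0.
have [b' /andP[r1 r2]] := grid_cell hz0 r0.
have q1 : q'.1 = q.1 + t by rewrite -eq'.
have q2 : q'.2 = q.2 + r by rewrite -eq'.
have aa : (a' <= a)%N.
  rewrite -ltnS -(ltr_nat R) -(ltr_pM2r ht0) (lt_trans t1)//; lra.
have bb : (b' <= b)%N.
  rewrite -ltnS -(ltr_nat R) -(ltr_pM2r hz0) (lt_trans r1)//; lra.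
exists k => //; exists a' => //; exists b' => //; exists i => //.
rewrite !addn0 !subn0 aa bb/=; split.
  exists (t, x) => //; split => /=; first by rewrite in_itv/= t1 t2.
  by rewrite /layer/= er lte_fin lee_fin r1 r2.
apply: (ih _ _ _ _ q' p) => //.
  rewrite q1 -subSn// natrB ?leqW//; lra.
rewrite q2 -subSn// natrB ?leqW//; lra.
Qed.

(** Nonpositive times have intensity 0, so by [sum_atom_event] every label has probability 0 of such
    an atom, and there are countably many individuals and labels. *)
Lemma negative_atoms_negligible : exists2 N, measurable N /\ P N = 0%E & ~` positive_atoms `<=` N.
Proof.
pose B : set (R * pstar R) := `]-oo, 0%R]%classic `*` setT.
have mB : measurable B by apply: measurableX => //; exact: measurable_itv.
have B0 : intensity alpha lambda B = 0%:E.
  rewrite intensityX//.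
  suff -> : `]-oo, 0%R]%classic `&` `]0%R, +oo[%classic = set0 :> set R by rewrite measure0 mul0e.
  apply/seteqP; split => x //= []; rewrite !in_itv/= andbT => h1 h2.
  by have := le_lt_trans h1 h2; rewrite ltxx.
have ev0 u i : P (atom_event (xi u) B i) = 0%E.
  have s0 : (\sum_(0 <= i <oo) P (atom_event (xi u) B i) = 0)%E.
    exact: (sum_atom_event (xi_poisson u) mB B0 (lexx _)).
  apply/eqP; rewrite eq_le measure_ge0 andbT -s0 (@nneseriesD1 _ _ i)//.
  by rewrite leeDl// nneseries_ge0.
have mev u i : measurable (atom_event (xi u) B i).
  exact: (measurable_atom_event (xi_poisson u)).
pose N := \bigcup_(ui : word * nat) atom_event (xi ui.1) B ui.2.
exists N; last first.
  move=> w /existsNP[u /existsNP[i /existsNP[tx /not_implyP[e /negP]]]].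
  by rewrite -leNgt => t0; exists (u, i) => //; exists tx => //; split => //=; rewrite in_itv.
pose g j : set Omega := if (unpickle j : option (word * nat)) is Some ui then atom_event (xi ui.1) B ui.2 else set0.
have NE : N = \bigcup_j g j.
  apply/seteqP; split => w [j _].
    by move=> h; exists (pickle j) => //; rewrite /g pickleK.
  by rewrite /g; case: (unpickle j) => [ui|]// h; exists ui.
have mg j : measurable (g j) by rewrite /g; case: (unpickle j).
split; first by rewrite NE; exact: bigcupT_measurable.
apply/eqP; rewrite eq_le measure_ge0 andbT NE (le_trans (measure_bigcup_le _ mg))//.
rewrite eseries0// => j _ _; rewrite /g; case: (unpickle j) => [ui|]; [exact: ev0|exact: measure0].
Qed.

End positions.

(** * Survival of the rounded branching random walk *)

Section offspring_constants.
Context (R : realType) (alpha : R) (lambda : {finite_measure set (pstar R) -> \bar R}).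
Hypotheses (c_fin : (c_const alpha lambda < +oo)%E)
  (normalized : (c_const alpha lambda * Gamma alpha = 1)%E).

(** Finiteness of [Gamma alpha] is read off the normalization: a nonnegative constant times [+oo] is
    0 or [+oo], never 1. *)
Lemma normalized_emean : exists G : R, [/\ Gamma alpha = G%:E, 0 < G,
  forall K, \sum_(k < K) emeanR alpha lambda k <= G^-1 &
  forall tau, tau < 1 -> exists K, tau <= (\sum_(k < K) emeanR alpha lambda k) * G].
Proof.
have e0 k : (0 <= emean alpha lambda k)%E := emean_ge0 alpha lambda k.
have c0 : (0 <= c_const alpha lambda)%E by rewrite c_constE nneseries_ge0.
have G0 : (0 <= Gamma alpha)%E.
  by apply: integral_ge0 => x _; rewrite lee_fin mulr_ge0 ?powR_ge0 ?expR_ge0.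
have [c cE] : exists c, c_const alpha lambda = c%:E.
  by exists (fine (c_const alpha lambda)); rewrite fineK// ge0_fin_numE.
move: normalized G0 c0; rewrite cE; case eG : (Gamma alpha) => [G| |]//; last first.
  rewrite mulry => + _; rewrite lee_fin le_eqVlt => + /orP[/eqP c0|c0].
    by rewrite -c0 sgr0 mul0e => /eqP; rewrite eqe eq_sym oner_eq0.
  by rewrite gtr0_sg// mul1e.
rewrite -EFinM => -[cG]; rewrite !lee_fin => G0 c0.
have Gp : 0 < G.
  by rewrite lt_neqAle G0 andbT; apply/eqP => h; move/eqP: cG; rewrite -h mulr0 eq_sym oner_eq0.
have cGV : c = G^-1 by apply: (mulIf (lt0r_neq0 Gp)); rewrite cG mulVf ?gt_eqF.
have sumE K : (\sum_(0 <= k < K) emean alpha lambda k = (\sum_(k < K) emeanR alpha lambda k)%:E)%E.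
  by rewrite big_mkord -sumEFin; apply: eq_bigr => k _; exact: emeanE.
exists G; split => // [K|tau tau1].
  rewrite -cGV -lee_fin -cE c_constE -sumE; exact: nneseries_lim_ge.
apply: contrapT => /forallNP h.
have : (c_const alpha lambda <= (tau * c)%:E)%E.
  rewrite c_constE; apply: lime_le; first exact: is_cvg_nneseries.
  apply: nearW => K; rewrite sumE lee_fin cGV ler_pdivlMr//.
  by have /negP := h K; rewrite -ltNge => /ltW.
rewrite cE lee_fin; have : 0 < c by rewrite cGV invr_gt0.
by nra.
Qed.

(** The first entry is finite, so its inverse power is positive everywhere and its integral vanishes
    only if [lambda] does. This gives the root many children in large boxes. *)
Lemma emeanR0_gt0 : lambda setT <> 0%E -> 0 < emeanR alpha lambda 0.
Proof.
move=> l0; rewrite lt_neqAle emeanR_ge0 andbT; apply/eqP => h; apply: l0.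
have : (\int[lambda]_x `|inv_power alpha (pseq x 0)|)%E = 0%E.
  have <- : emean alpha lambda 0 = 0%E by rewrite (emeanE c_fin) -h.
  by apply: eq_integral => x _; rewrite gee0_abs// inv_power_ge0.
have mf : measurable_fun setT (fun x : pstar R => inv_power alpha (pseq x 0)).
  by apply: measurableT_comp; [exact: measurable_inv_power|exact: measurable_pseq].
move/(ae_eq_integral_abs lambda measurableT mf) => [N [mN N0 sN]].
apply/eqP; rewrite eq_le measure_ge0 andbT -N0; apply: le_measure; rewrite ?inE//.
move=> x _; apply: sN => /= /(_ I).
have := pseq_gt0 x 0; have := pseq0_fin x; case: (pseq x 0) => [r| |]//= _.
by rewrite lte_fin => r0 [] /eqP; rewrite gt_eqF// powR_gt0.
Qed.

End offspring_constants.

Section lattice_sum.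
Context (R : realType) (alpha : R).
Hypothesis alpha0 : 0 < alpha.

Lemma sum_bin (i a : nat) : (\sum_(x < a) 'C(a - x.+1, i) = 'C(a, i.+1))%N.
Proof.
elim: a => [|a ih]; first by rewrite big_ord0.
by rewrite big_ord_recl/= subn1/= binS -ih addnC.
Qed.

Lemma wsumS i b : wsum alpha i.+1 b = \sum_(y < b) incr_powR alpha y * wsum alpha i (b - y.+1).
Proof. by []. Qed.

Lemma sum_incr_powR (b : nat) : \sum_(y < b) incr_powR alpha y = b%:R `^ alpha.
Proof.
elim: b => [|b ih]; first by rewrite big_ord0 powR0// gt_eqF.
by rewrite big_ord_recr/= ih /incr_powR -natr1 addrC subrK.
Qed.

Lemma wsum_gt0 i b : (i <= b)%N -> 0 < wsum alpha i b.
Proof.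
elim: i b => [|i ih] b ib; first exact: ltr01.
rewrite wsumS; case: b ib => // b; rewrite ltnS => ib.
rewrite big_ord_recl/= subn1/=; apply: ltr_wpDr.
  by apply: sumr_ge0 => y _; rewrite mulr_ge0 ?incr_powR_ge0 ?wsum_ge0.
apply: mulr_gt0; last exact: ih.
by rewrite /incr_powR (_ : 1%:R = 1)// powR1 powR0 ?gt_eqF// subr0.
Qed.

(** Expected number of descendants of generation [i] in a box of [a * b] cells after rounding up,
    for mean cell contents [kappa * omega]: the binomial counts time coordinates
    [(x_1 + 1) + ... + (x_i + 1) <= a], and [wsum] weighs the spatial ones. *)
Definition mean_hits (kappa : R) (i a b : nat) : R :=
  kappa ^+ i * 'C(a, i)%:R * wsum alpha i b.

Lemma mean_hitsS kappa i a b : mean_hits kappa i.+1 a b =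
  kappa * \sum_(x < a) \sum_(y < b) incr_powR alpha y * mean_hits kappa i (a - x.+1) (b - y.+1).
Proof.
rewrite /mean_hits wsumS -sum_bin natr_sum exprS -!mulrA; congr (_ * _).
rewrite mulr_suml mulr_sumr; apply: eq_bigr => x _.
by rewrite !mulr_sumr; apply: eq_bigr => y _; ring.
Qed.

Lemma mean_hits_ge0 kappa i a b : 0 <= kappa -> 0 <= mean_hits kappa i a b.
Proof. by move=> k0; rewrite !mulr_ge0 ?exprn_ge0 ?wsum_ge0. Qed.

Lemma mean_hits_bounded kappa i a b : 0 <= kappa -> exists2 M, 1 <= M &
  forall x y, (x <= a)%N -> (y <= b)%N -> mean_hits kappa i x y <= M.
Proof.
move=> k0; pose f (x y : nat) := mean_hits kappa i x y.
have f0 x y : 0 <= f x y by exact: mean_hits_ge0.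
exists (1 + \sum_(x < a.+1) \sum_(y < b.+1) f x y).
  by rewrite lerDl; apply: sumr_ge0 => x _; exact: sumr_ge0.
move=> x y xa yb; apply: ler_wpDl => //.
rewrite (bigD1 (inord x))//= inordK// (bigD1 (inord y))//= inordK//.
rewrite -addrA lerDl addr_ge0//; first exact: sumr_ge0.
by apply: sumr_ge0 => z _; exact: sumr_ge0.
Qed.

End lattice_sum.

Section survival.
Context (R : realType) (alpha : R) (lambda : {finite_measure set (pstar R) -> \bar R})
  d (Omega : measurableType d) (P : probability Omega R)
  (xi : seq (nat * nat) -> Omega -> nat -> option (R * pstar R)).
Hypotheses (alpha0 : 0 < alpha) (c_fin : (c_const alpha lambda < +oo)%E)
  (xi_poisson : forall u, poisson_process P (xi u) (intensity alpha lambda))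
  (xi_indep : independent P (fun u => sigma_atoms (xi u))).
Context (kappa : R) (K : nat).
Hypothesis kappa0 : 0 < kappa.
Local Notation word := (seq (nat * nat)).
Let eK : R := kappa / alpha * \sum_(k < K) emeanR alpha lambda k.

Let eK0 : 0 <= eK.
Proof.
rewrite /eK mulr_ge0 ?divr_ge0 ?(ltW kappa0) ?(ltW alpha0)//.
by apply: sumr_ge0 => k _; exact: emeanR_ge0.
Qed.

(* The constants do not depend on the number [n] of generations already
   survived, nor on the mesh as long as the mean number of points per cell is fixed. *)
Lemma hit1_mean (A B i : nat) : exists2 C, 0 <= C & exists2 eta0, 0 < eta0 &
  forall ht hz, 0 < ht -> 0 < hz -> ht * hz `^ alpha = kappa ->
  forall eta, 0 <= eta <= eta0 -> forall n a0 b0,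
  (forall u, (eta%:E <= P (hit xi ht hz 1 n u a0 b0))%E) ->
  forall a b u, (a <= A)%N -> (b <= B)%N ->
  ((eta * mean_hits alpha eK i a b - C * eta ^+ 2)%:E <=
   P (hit xi ht hz 1 (n + i) u (a0 + a) (b0 + b)))%E.
Proof.
elim: i => [|i [C C0 [eta0 eta00 ih]]].
  exists 0 => //; exists 1 => // ht hz ht0 hz0 _ eta _ n a0 b0 h a b u _ _.
  rewrite /mean_hits expr0 bin0 !mul1r mulr1 mul0r subr0 addn0.
  apply: (le_trans (h u)); apply: le_measure; rewrite ?inE; try exact: (measurable_hit xi_poisson).
  by apply: hit_mono; exact: leq_addr.
have [M M1 MP] := mean_hits_bounded alpha0 i A B eK0.
have M0 : 0 < M by exact: lt_le_trans M1.
pose mu := kappa / alpha * emeanR alpha lambda 0 * (A%:R * B%:R `^ alpha).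
have mu0 : 0 <= mu.
  by rewrite /mu !mulr_ge0 ?emeanR_ge0 ?powR_ge0 ?invr_ge0 ?(ltW kappa0) ?(ltW alpha0).
(* The inherited error is multiplied by the mean number of children in the box; the second term is
   the new error from [hit1_step] with [delta = eta M]. *)
exists (C * (eK * (A%:R * B%:R `^ alpha)) + M ^+ 2 * K%:R ^+ 2 * (mu + mu ^+ 2)).
  apply: addr_ge0.
    exact: mulr_ge0 C0 (mulr_ge0 eK0 (mulr_ge0 (ler0n _ _) (powR_ge0 _ _))).
  exact: mulr_ge0 (mulr_ge0 (sqr_ge0 _) (sqr_ge0 _)) (addr_ge0 mu0 (sqr_ge0 _)).
exists (Num.min eta0 M^-1); first by rewrite lt_min eta00 invr_gt0.
move=> ht hz ht0 hz0 kE eta /andP[eta_ge0]; rewrite le_min => /andP[eta_le etaM] n a0 b0 h a b u aA bB.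
(* The inductive lower bound may be negative, hence the maximum with 0; the cut-off outside the box
   makes [g <= eta M] hold everywhere. *)
pose g x y := if (x <= A)%N && (y <= B)%N then
  Num.max 0 (eta * mean_hits alpha eK i x y - C * eta ^+ 2) else 0.
have g01 x y : 0 <= g x y <= eta * M.
  rewrite /g; case: ifP => [/andP[xA yB]|_]; last by rewrite lexx mulr_ge0// ltW.
  rewrite le_max lexx/= ge_max mulr_ge0 ?(ltW M0)//= lerBlDr ler_wpDr ?mulr_ge0 ?sqr_ge0//.
  by rewrite ler_wpM2l// MP.
have etaM1 : eta * M <= 1 by rewrite -ler_pdivlMr// mul1r.
have gP v x y : (x < a)%N -> (y < b)%N ->
    ((g x y)%:E <= P (hit xi ht hz 1 (n + i) v (a0 + x) (b0 + y)))%E.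
  move=> xa yb; rewrite /g; case: ifP => [/andP[xA yB]|_]; last exact: measure_ge0.
  rewrite EFin_max ge_max measure_ge0/=; apply: (ih ht hz) => //.
  by rewrite eta_ge0.
have := hit1_step alpha0 c_fin xi_poisson xi_indep ht0 hz0 K u g01 etaM1 gP.
rewrite kE -/eK addnS; set m := box_mean _ _ _ _ => step.
have ab_AB : a%:R * b%:R `^ alpha <= A%:R * B%:R `^ alpha.
  by rewrite ler_pM ?powR_ge0 ?ler_nat// ge0_ler_powR ?nnegrE ?ler_nat// ltW.
have mE : m = kappa / alpha * emeanR alpha lambda 0 * (a%:R * b%:R `^ alpha).
  by rewrite /m /box_mean powRM ?(ltW hz0)// -kE; ring.
have m0 : 0 <= m by apply: box_mean_ge0 => //; rewrite mulr_ge0// ltW.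
have mmu : m <= mu.
  by rewrite mE /mu ler_wpM2l// mulr_ge0 ?emeanR_ge0// divr_ge0// ltW.
set X := eK * _ in step; set E := (eta * M) ^+ 2 * K%:R ^+ 2 * (m + m ^+ 2) in step.
apply: (@le_trans _ _ (X - E)%:E); last by rewrite EFinB leeBlDr.
rewrite lee_fin.
have XE : eta * mean_hits alpha eK i.+1 a b - C * eta ^+ 2 * (eK * (a%:R * b%:R `^ alpha)) <= X.
  rewrite mean_hitsS -(sum_incr_powR alpha0) /X.
  have -> : a%:R * (\sum_(y < b) incr_powR alpha y) = \sum_(x < a) \sum_(y < b) incr_powR alpha y.
    by rewrite sumr_const card_ord mulr_natl.
  rewrite [leLHS](_ : _ = eK * (\sum_(x < a) \sum_(y < b) incr_powR alpha y *
      (eta * mean_hits alpha eK i (a - x.+1) (b - y.+1) - C * eta ^+ 2))); last first.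
    rewrite mulrCA [C * _ * _]mulrCA -mulrBr; congr (_ * _).
    rewrite !mulr_sumr -sumrB; apply: eq_bigr => x _.
    by rewrite !mulr_sumr -sumrB; apply: eq_bigr => y _; ring.
  rewrite ler_wpM2l//; apply: ler_sum => x _; apply: ler_sum => y _.
  rewrite ler_wpM2l ?incr_powR_ge0// /g !ifT ?le_max ?lexx ?orbT//.
  by rewrite (leq_trans (leq_subr _ _) aA) (leq_trans (leq_subr _ _) bB).
have EE : E <= M ^+ 2 * K%:R ^+ 2 * (mu + mu ^+ 2) * eta ^+ 2.
  rewrite /E exprMn [leRHS](_ : _ = eta ^+ 2 * M ^+ 2 * K%:R ^+ 2 * (mu + mu ^+ 2)); last by ring.
  by rewrite ler_wpM2l ?lerD ?lerXn2r ?nnegrE//; nonneg.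
have CC : C * eta ^+ 2 * (eK * (a%:R * b%:R `^ alpha)) <= C * eta ^+ 2 * (eK * (A%:R * B%:R `^ alpha)).
  by rewrite ler_wpM2l ?ler_wpM2l//; nonneg.
lra.
Qed.

(** For small [eta] the quadratic loss takes at most half of the linear term. *)
Lemma hit1_half (A B i : nat) : 0 < eK -> (i <= A)%N -> (i <= B)%N -> exists2 eta0, 0 < eta0 &
  forall eta, 0 < eta <= eta0 -> forall ht hz, 0 < ht -> 0 < hz -> ht * hz `^ alpha = kappa ->
  forall n a0 b0, (forall u, (eta%:E <= P (hit xi ht hz 1 n u a0 b0))%E) ->
  forall u, ((eta * (mean_hits alpha eK i A B / 2))%:E <=
   P (hit xi ht hz 1 (n + i) u (a0 + A) (b0 + B)))%E.
Proof.
move=> eKp iA iB; have [C C0 [eta0 eta00 h]] := hit1_mean A B i.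
have D0 : 0 < mean_hits alpha eK i A B.
  by rewrite !mulr_gt0 ?exprn_gt0 ?wsum_gt0 ?ltr0n ?bin_gt0.
set D := mean_hits _ _ _ _ _ in D0 *.
exists (Num.min eta0 (D / (2 * (C + 1)))).
  by rewrite lt_min eta00 divr_gt0// mulr_gt0//; lra.
move=> eta /andP[eta_gt0]; rewrite le_min => /andP[eta_le etaD] ht hz ht0 hz0 kE n a0 b0 base u.
apply: (le_trans _ (h ht hz ht0 hz0 kE eta _ n a0 b0 base A B u _ _)) => //; last first.
  by rewrite (ltW eta_gt0).
rewrite lee_fin -/D; move: etaD; rewrite ler_pdivlMr; last by lra.
by move=> etaD; nra.
Qed.

Lemma uniform_threshold (Q : nat -> R -> Prop) (m : nat) :
  (forall i, (i <= m)%N -> exists2 e0, 0 < e0 & forall e, 0 < e <= e0 -> Q i e) ->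
  exists2 e0, 0 < e0 & forall i, (i <= m)%N -> forall e, 0 < e <= e0 -> Q i e.
Proof.
elim: m => [|m ih] h.
  have [e0 e00 e0Q] := h 0%N (leqnn _); exists e0 => // i; rewrite leqn0 => /eqP ->; exact: e0Q.
have [|e0 e00 e0Q] := ih; first by move=> i im; apply: h; exact: leqW.
have [e1 e10 e1Q] := h m.+1 (leqnn _).
exists (Num.min e0 e1); first by rewrite lt_min e00.
move=> i im e /andP[e_gt0]; rewrite le_min => /andP[ee0 ee1].
move: im; rewrite leq_eqVlt => /orP[/eqP ->|]; first by apply: e1Q; rewrite e_gt0.
by rewrite ltnS => im; apply: e0Q => //; rewrite e_gt0.
Qed.

(** As the mean is at least 2, half of it is at least 1: a success probability [eta] below the
    threshold reproduces itself every [m] generations, each time with [m A] by [m B] additional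
    cells. *)
Lemma hit1_survive (A B m : nat) : 0 < eK -> (0 < A)%N -> (0 < B)%N -> (0 < m)%N ->
  2 <= mean_hits alpha eK m (m * A) (m * B) ->
  exists2 q, 0 < q <= 1 & forall ht hz, 0 < ht -> 0 < hz -> ht * hz `^ alpha = kappa ->
  forall n u, (q%:E <= P (hit xi ht hz 1 n u ((n + m) * A) ((n + m) * B)))%E.
Proof.
move=> eKp A0 B0 m0 D2.
have iA i : (i <= m)%N -> (i <= m * A)%N by move=> im; rewrite (leq_trans im)// leq_pmulr.
have iB i : (i <= m)%N -> (i <= m * B)%N by move=> im; rewrite (leq_trans im)// leq_pmulr.
have [e0 e00 e0Q] := uniform_threshold (fun i im => hit1_half eKp (iA i im) (iB i im)).
pose eta := Num.min e0 1.
have eta0 : 0 < eta by rewrite lt_min e00 ltr01.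
have eta_e0 : 0 < eta <= e0 by rewrite eta0 ge_min lexx.
have [q0 q00 qP] : exists2 q0, 0 < q0 & forall i, (i <= m)%N -> forall e, 0 < e <= q0 ->
    e <= eta * (mean_hits alpha eK i (m * A) (m * B) / 2).
  apply: uniform_threshold => i im; exists (eta * (mean_hits alpha eK i (m * A) (m * B) / 2)).
    by rewrite mulr_gt0 ?divr_gt0// !mulr_gt0 ?exprn_gt0 ?wsum_gt0 ?ltr0n ?bin_gt0 ?iA ?iB.
  by move=> e /andP[].
exists (Num.min q0 1); first by rewrite lt_min q00 ltr01 ge_min lexx orbT.
move=> ht hz ht0 hz0 kE.
have base j u : (eta%:E <= P (hit xi ht hz 1 (j * m) u (j * (m * A)) (j * (m * B))))%E.
  elim: j u => [|j ih] u; first by rewrite mul0n /= probability_setT lee_fin ge_min lexx orbT.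
  have := e0Q m (leqnn m) eta eta_e0 ht hz ht0 hz0 kE _ _ _ ih u.
  rewrite -!mulSnr; apply: le_trans; rewrite lee_fin ler_peMr ?(ltW eta0)//.
  by rewrite ler_pdivlMr// mul1r.
move=> n u.
(* The remaining [n %% m] generations cost a factor bounded below uniformly in the remainder, and
   one more box; this accounts for [n + m] in the statement. *)
have nm : (n %% m <= m)%N by rewrite ltnW// ltn_mod.
have := e0Q _ nm eta eta_e0 ht hz ht0 hz0 kE _ _ _ (base (n %/ m)%N) u.
rewrite -divn_eq -!mulSnr => h.
apply: (@le_trans _ _ (P (hit xi ht hz 1 n u ((n %/ m).+1 * (m * A)) ((n %/ m).+1 * (m * B))))).
  apply: (le_trans _ h); rewrite lee_fin; apply: (qP _ nm).
  by rewrite lt_min q00 ltr01 ge_min lexx.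
apply: le_measure; rewrite ?inE; try exact: (measurable_hit xi_poisson).
by apply: hit_mono; rewrite mulnA leq_mul2r mulSnr leq_add2r leq_divM orbT.
Qed.

End survival.

(** * Convergence of the frontier *)

Section frontier_limit.
Context (R : realType) (alpha : R).
Hypothesis alpha0 : 0 < alpha.
Local Notation beta := ((alpha + 1) / alpha).
Local Notation c_alpha := (alpha * expR (- beta)).

Lemma eventually_expr_le (w e : R) : 0 <= w < 1 -> 0 < e ->
  exists n0 : nat, forall n, (n0 <= n)%N -> w ^+ n <= e.
Proof.
move=> /andP[w0 w1] e0.
have /cvgrPdist_le/(_ e e0)[n0 _ h] := @cvg_expr R w ltac:(by rewrite ger0_norm).
by exists n0 => n nn; have := h n nn; rewrite /= sub0r normrN ger0_norm// exprn_ge0.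
Qed.

Lemma one_powR (a : R) : 1 `^ a = 1.
Proof. by rewrite powR1. Qed.

Lemma powR_beta (x : R) : 0 < x -> (x `^ beta) `^ alpha = x * x `^ alpha.
Proof.
move=> x0; rewrite -powRrM divfK ?gt_eqF// powRD ?gt_eqF ?implybT//.
  by rewrite powRr1 ?(ltW x0)// mulrC.
by rewrite ltr_wpDr.
Qed.

(** [c_alpha] is the value of [C] at which the growth rate equals 1, the boundary between
    [box_empty] and [box_occupied]. *)
Lemma c_alpha_powR : c_alpha `^ alpha * expR (1 + alpha) / alpha `^ alpha = 1.
Proof.
rewrite powRM ?expR_ge0 ?(ltW alpha0)// -expRM mulNr divfK ?gt_eqF//.
rewrite -[_ * expR (1 + alpha)]mulrA -expRD addrC [1 + alpha]addrC subrr expR0 mulr1.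
by rewrite divff// gt_eqF// powR_gt0.
Qed.

Context (lambda : {finite_measure set (pstar R) -> \bar R})
  d (Omega : measurableType d) (P : probability Omega R)
  (xi : seq (nat * nat) -> Omega -> nat -> option (R * pstar R)).
Hypotheses (lambda0 : lambda setT <> 0%E) (c_fin : (c_const alpha lambda < +oo)%E)
  (normalized : (c_const alpha lambda * Gamma alpha = 1)%E)
  (xi_poisson : forall u, poisson_process P (xi u) (intensity alpha lambda))
  (xi_indep : independent P (fun u => sigma_atoms (xi u))).
Local Notation off w := (fun u => spread (xi u w)).
Local Notation box n C := (origin_box (C * n%:R `^ beta)).

Lemma box_empty (C e : R) : 0 < C < c_alpha -> 0 < e -> exists n0 : nat,
  forall n, (n0 <= n)%N -> (P [set w | brw (off w) n (box n C) <> 0%E] <= e%:E)%E.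
Proof.
move=> /andP[C0 Cc] e0.
have [G [GG G0 sumG _]] := normalized_emean c_fin normalized.
have aa0 : 0 < alpha `^ alpha by rewrite powR_gt0.
pose w0 := C `^ alpha * expR (1 + alpha) / alpha `^ alpha.
have w00 : 0 < w0 by rewrite /w0 divr_gt0// mulr_gt0 ?expR_gt0 ?powR_gt0.
have w01 : w0 < 1.
  rewrite -c_alpha_powR /w0 ltr_pM2r ?invr_gt0// ltr_pM2r ?expR_gt0//.
  by rewrite gt0_ltr_powR// nnegrE ltW// (lt_trans C0).
(* With [theta ht = vt hz = delta], rounding costs [e ^ (2 delta) = w0 ^ (- 1 / 2)] per generation,
   which leaves the rate [sqrt w0 < 1]. *)
pose delta := - ln w0 / 4.
have delta0 : 0 < delta by rewrite divr_gt0// oppr_gt0 ln_lt0// w00.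
have wE : expR (delta + delta) * w0 = expR (- (delta + delta)).
  rewrite -{1}[w0]lnK ?posrE// -expRD; congr expR; rewrite /delta; by field.
have w1 : 0 <= expR (- (delta + delta)) < 1 by rewrite expR_ge0 expR_lt1 oppr_lt0 addr_gt0.
have [n0 n0P] := eventually_expr_le w1 e0.
exists n0.+1 => n nn0; have n_gt0 : (0 < n)%N by exact: leq_ltn_trans nn0.
have nR : 0 < n%:R :> R by rewrite ltr0n.
set z := C * n%:R `^ beta.
have z0 : 0 < z by rewrite mulr_gt0 ?powR_gt0.
(* Minimizes [e ^ (vt z) / vt ^ (alpha n)], just as [theta = n] minimizes
   [e ^ theta / theta ^ n]. *)
pose vt := n%:R * alpha / z.
have vt0 : 0 < vt := divr_gt0 (mulr_gt0 nR alpha0) z0.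
pose ht := delta / n%:R; pose hz := delta / vt.
have ht0 : 0 < ht by rewrite divr_gt0.
have hz0 : 0 < hz by rewrite divr_gt0.
have cut (h y : R) : 0 < h -> 0 < y -> exists a : nat, a%:R * h <= y < a.+1%:R * h.
  move=> h0 y0; have /truncn_itv/andP[h1 h2] := ltW (divr_gt0 y0 h0).
  by exists (Num.trunc (y / h)); rewrite -ler_pdivlMr// h1 -ltr_pdivrMr.
have [a /andP[a1 a2]] := cut ht 1 ht0 ltr01.
have [b /andP[b1 b2]] := cut hz z hz0 z0.
have [N [mN N0] sN] := negative_atoms_negligible xi_poisson.
have mhit := measurable_hit xi_poisson ht hz 0 n [::] a b.
have mnon : measurable [set w | brw (off w) n (origin_box z) <> 0%E].
  rewrite [X in measurable X](_ : _ = ~` [set w | brw (off w) n (origin_box z) = 0%E])//.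
  by apply: measurableC; exact: (measurable_brw_box xi_poisson).
apply: (@le_trans _ _ (P (hit xi ht hz 0 n [::] a b `|` N))).
  apply: le_measure; rewrite ?inE//; first exact: measurableU.
  move=> w /= nz; have [pw|] := pselect (positive_atoms xi w); last by right; exact: sN.
  left; move: nz; rewrite (brw_box_eq0 _ _ _ _) => /existsNP[u /not_implyP[un]].
  move=> /existsNP[p /not_implyP[up /contrapT[]]].
  rewrite /= !in_itv/= => /andP[_ p1] /andP[_ p2].
  rewrite -un; apply: (@position_hit0 _ _ _ xi ht hz ht0 hz0 u [::] a b w (0, 0) p pw) => //.
  - by rewrite cats0.
  - by rewrite add0r (le_lt_trans p1).
  - by rewrite add0r (le_lt_trans p2).
apply: (le_trans (measureU2 _ mhit mN)).
apply: (@le_trans _ _ (P (hit xi ht hz 0 n [::] a b) + 0)%E); first by apply: leeD => //; rewrite le_eqVlt; apply/orP; left; apply/eqP; exact: N0.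
rewrite adde0.
have := hit0_le alpha0 c_fin xi_poisson xi_indep ht0 hz0 n [::] a b nR vt0 GG G0 sumG.
move=> /le_trans; apply; rewrite lee_fin.
have e1 : n%:R * ht = delta by rewrite /ht mulrC divfK// gt_eqF.
have e2 : vt * hz = delta by rewrite /hz mulrC divfK// gt_eqF.
apply: le_trans (n0P n (ltnW nn0)); rewrite -wE.
have -> : w0 = expR (1 + alpha) / (n%:R * vt `^ alpha).
  rewrite /vt /z powRM ?invr_ge0 ?(ltW z0) ?mulr_ge0 ?(ltW nR) ?(ltW alpha0)//.
  rewrite powRV ?(ltW z0)// [(C * _) `^ _]powRM ?(ltW C0) ?powR_ge0// powR_beta// powRM ?(ltW nR) ?(ltW alpha0)//.
  by rewrite /w0; field; rewrite !gt_eqF ?powR_gt0.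
rewrite e1 e2 mulrCA [leRHS]exprMn mulrC ler_pM ?expR_ge0 ?exprn_ge0 ?divr_ge0 ?expR_ge0 ?mulr_ge0 ?powR_ge0 ?(ltW nR)//.
rewrite -expRM_natr ler_expR mulrDl mul1r; apply: lerD.
  have -> : delta * a%:R = n%:R * (a%:R * ht) by rewrite -e1; ring.
  by rewrite -[leRHS]mulr1 ler_pM2l.
have -> : delta * b%:R = vt * (b%:R * hz) by rewrite -e2; ring.
have -> : alpha * n%:R = vt * z by rewrite /vt divfK ?gt_eqF// mulrC.
by rewrite ler_pM2l.
Qed.

(** The grid is built from an intermediate [C']; the gap between [C'] and [C] pays for the step of
    the root and for the extra boxes of [hit1_survive]. *)
Lemma box_occupied (C e : R) : c_alpha < C -> 0 < e -> exists n0 : nat,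
  forall n, (n0 <= n)%N -> (P [set w | brw (off w) n (box n C) = 0%E] <= e%:E)%E.
Proof.
move=> cC e0.
have [G [GG G0 _ sumG]] := normalized_emean c_fin normalized.
have aa0 : 0 < alpha `^ alpha by rewrite powR_gt0.
have c0 : 0 < c_alpha by rewrite mulr_gt0 ?expR_gt0.
have [C' cC' C'C] : exists2 C', c_alpha < C' & C' < C.
  by exists ((c_alpha + C) / 2); rewrite midf_lt.
have C'0 : 0 < C' by exact: lt_trans cC'.
have supercritical : 1 < C' `^ alpha * expR (1 + alpha) / alpha `^ alpha.
  rewrite -[ltLHS]c_alpha_powR ltr_pM2r ?invr_gt0// ltr_pM2r ?expR_gt0//.
  by rewrite gt0_ltr_powR// nnegrE ltW.
have [tau /andP[tau0 tau1] [A [B [m [A0 B0 m0 growth]]]]] :=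
  lattice_growth alpha0 GG G0 C'0 supercritical.
have [K tauK] := sumG _ tau1.
set E := \sum_(k < K) _ in tauK.
have E0 : 0 < E by rewrite -(pmulr_lgt0 _ G0) (lt_le_trans tau0).
have AR : 0 < A%:R :> R by rewrite ltr0n.
have BR : 0 < B%:R :> R by rewrite ltr0n.
have BaR : 0 < B%:R `^ alpha by rewrite powR_gt0.
pose kappa := C' `^ alpha / (A%:R * B%:R `^ alpha).
have kappa0 : 0 < kappa by rewrite divr_gt0 ?powR_gt0// mulr_gt0.
have eK0 : 0 < kappa / alpha * E by rewrite mulr_gt0// divr_gt0.
have hits2 : 2 <= mean_hits alpha (kappa / alpha * E) m (m * A) (m * B).
  by have := growth _ tauK; rewrite -/kappa (mulrAC kappa).
have [q /andP[q0 q1] qP] :=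
  hit1_survive alpha0 c_fin xi_poisson xi_indep kappa0 eK0 A0 B0 m0 hits2.
(* Chosen so that [C' (1 + eta) ^ 2 + eta <= C]: one factor [t = 1 + eta] pays for the time reserved
   for the root, the other for having [L = N + m] rows of boxes instead of [n = N + 1], and the last
   [eta] for the displacement of the root's child. *)
pose eta := Num.min 1 ((C - C') / (3 * C' + 1)).
have eta0 : 0 < eta by rewrite lt_min ltr01 divr_gt0//; lra.
have eta1 : eta <= 1 by rewrite ge_min lexx.
have etaC : eta * (3 * C' + 1) <= C - C'.
  by rewrite -ler_pdivlMr; [rewrite ge_min lexx orbT|lra].
pose t := 1 + eta.
have t1 : 1 < t by rewrite /t ltrDl.
have t0 : 0 < t by exact: lt_trans t1.
have tC : C' * (t * t) + eta <= C.
  have : C' * (eta * eta) <= C' * eta by rewrite ler_pM2l// ler_piMr// ltW.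
  by rewrite /t; lra.
(* Time reserved for the child of the root. The subtrees have [t ^ (- alpha)] left; as
   [ht * hz ^ alpha] is fixed, this stretches space by [t]. *)
pose s := 1 - (t `^ alpha)^-1.
have ta1 : 1 < t `^ alpha by rewrite -[ltLHS](one_powR alpha) gt0_ltr_powR// nnegrE// ltW.
have ta0 : 0 < t `^ alpha by exact: lt_trans ta1.
have s0 : 0 < s by rewrite subr_gt0 invf_lt1.
have q01 : 0 <= 1 - q < 1 by rewrite subr_ge0 q1/= ltrBlDr ltrDl.
have [r rP] := eventually_expr_le q01 (divr_gt0 e0 (ltr0n R 2)).
pose c1 := s * (eta `^ alpha / alpha * emeanR alpha lambda 0).
have c10 : 0 < c1.
  by rewrite mulr_gt0// mulr_gt0 ?emeanR0_gt0// divr_gt0// powR_gt0.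
have beta0 : 0 < beta by rewrite divr_gt0// ltr_wpDr.
have tb1 : 1 < t `^ beta^-1 by rewrite -[ltLHS](one_powR beta^-1) gt0_ltr_powR ?nnegrE ?invr_gt0// ltW.
(* Once the Poisson mean of the box is at least [M], [poisson_tail] bounds the probability of fewer
   than [r] atoms by [e / 2]. That mean is at least [c1 n]. *)
pose M := 1 + r%:R * r`!%:R / (e / 2).
have M1 : 1 <= M.
  by rewrite lerDl; exact: divr_ge0 (mulr_ge0 (ler0n _ _) (ler0n _ _)) (ltW (divr_gt0 e0 (ltr0n R 2))).
exists (Num.bound (M / c1) + Num.bound (m%:R / (t `^ beta^-1 - 1))).+1 => -[//|N] nn0.
have nR : 0 < N.+1%:R :> R by rewrite ltr0n.
have Mn : M <= c1 * N.+1%:R.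
  rewrite mulrC -ler_pdivrMr//; have /archi_boundP/ltW/le_trans := divr_ge0 (le_trans ler01 M1) (ltW c10).
  by apply; rewrite ler_nat (leq_trans _ nn0)// leqW// leq_addr.
have tb0 : 0 < t `^ beta^-1 - 1 by rewrite subr_gt0.
have mn : (N + m)%:R <= t `^ beta^-1 * N.+1%:R.
  have : m%:R <= (t `^ beta^-1 - 1) * N.+1%:R.
    rewrite mulrC -ler_pdivrMr//; have /archi_boundP/ltW/le_trans := divr_ge0 (ler0n R m) (ltW tb0).
    by apply; rewrite ler_nat (leq_trans _ nn0)// leqW// leq_addl.
  rewrite natrD mulrBl mul1r -natr1; lra.
set L := (N + m)%N in mn.
have L0 : (0 < L)%N by rewrite addn_gt0 m0 orbT.
have LR : 0 < L%:R :> R by rewrite ltr0n.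
(* [ht] makes [L A] cells fill the time [t ^ (- alpha)]; [hz] is then determined by
   [ht * hz ^ alpha = kappa]. *)
pose ht := (t `^ alpha)^-1 / (L%:R * A%:R).
pose hz := C' * t / B%:R * L%:R `^ alpha^-1.
have ht0 : 0 < ht by rewrite divr_gt0 ?invr_gt0// mulr_gt0.
have hz0 : 0 < hz by rewrite mulr_gt0 ?powR_gt0// divr_gt0// mulr_gt0.
have kE : ht * hz `^ alpha = kappa.
  rewrite /ht /hz powRM ?powR_ge0 ?divr_ge0 ?mulr_ge0 ?(ltW C'0) ?(ltW t0)//.
  rewrite -powRrM mulVf ?gt_eqF// powRr1 ?(ltW LR)//.
  rewrite powRM ?invr_ge0 ?mulr_ge0 ?(ltW C'0) ?(ltW t0)// powRM ?(ltW C'0) ?(ltW t0)//.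
  rewrite powRV// /kappa; field.
  by rewrite !gt_eqF.
have htE : (L * A)%:R * ht = (t `^ alpha)^-1.
  by rewrite natrM /ht; field; rewrite !gt_eqF.
have hzE : (L * B)%:R * hz <= C' * (t * t) * N.+1%:R `^ beta.
  have -> : (L * B)%:R * hz = C' * t * (L%:R * L%:R `^ alpha^-1).
    by rewrite natrM /hz; field; rewrite !gt_eqF.
  rewrite mulrA -[C' * t * t * _]mulrA ler_pM2l ?mulr_gt0//.
  have -> : L%:R * L%:R `^ alpha^-1 = L%:R `^ beta.
    rewrite -{1}(powRr1 (ltW LR)) -powRD; last by rewrite (gt_eqF LR) implybT.
    by congr (_ `^ _); field; rewrite gt_eqF.
  have -> : t * N.+1%:R `^ beta = (t `^ beta^-1 * N.+1%:R) `^ beta.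
    by rewrite powRM ?powR_ge0// -powRrM mulVf ?gt_eqF// powRr1// ltW.
  apply: ge0_ler_powR; rewrite ?nnegrE ?(ltW beta0)//.
  exact: mulr_ge0 (powR_ge0 _ _) (ltW nR).
pose v := eta * N.+1%:R `^ beta.
have v0 : 0 <= v by rewrite mulr_ge0 ?powR_ge0// ltW.
have q_01 : 0 <= q <= 1 by rewrite (ltW q0).
have boost := hit1_boost alpha0 c_fin xi_poisson xi_indep ht0 hz0 r q_01 (ltW s0) v0
  (qP ht hz ht0 hz0 kE N).
apply: (@le_trans _ _ (\sum_(j < r) poisson_weight (box_mean alpha lambda s v) j + (1 - q) ^+ r)%:E); last first.
  rewrite lee_fin [leRHS](splitr e); apply: lerD; last exact: rP.
  have bm : M <= box_mean alpha lambda s v.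
    apply: (le_trans Mn).
    rewrite /box_mean /v powRM ?powR_ge0 ?(ltW eta0)// powR_beta//.
    have n1 : 1 <= N.+1%:R `^ alpha.
      by rewrite -[leLHS](one_powR alpha) ge0_ler_powR ?nnegrE ?(ltW alpha0)// ler1n.
    rewrite [leRHS](_ : _ = c1 * N.+1%:R * N.+1%:R `^ alpha); last by rewrite /c1; ring.
    by rewrite ler_peMr// mulr_ge0// ltW.
  have b1 := le_trans M1 bm; have b0 := lt_le_trans ltr01 b1.
  apply: (le_trans (poisson_tail r b1)); rewrite mulrA ler_pdivrMr// -ler_pdivrMl ?divr_gt0//.
  by rewrite mulrC; apply: le_trans bm; rewrite /M lerDr.
apply: le_trans boost; apply: le_measure; rewrite ?inE.
- exact: (measurable_brw_box xi_poisson).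
- apply: measurableC; apply: bigcupT_measurable => i; apply: measurableI; last exact: (measurable_hit xi_poisson).
  by apply: (measurable_atom_event (xi_poisson [::])); exact: measurable_box.
move=> w /= /(brw_box_eq0 _ _ _ _) empty [i _ [[[t1' x] [/= t1s x0v] xw] hw]].
move: t1s x0v; rewrite in_itv/= => /andP[t1'0 t1's] /andP[].
case er : (pseq x 0) => [r0| |]//; rewrite lte_fin lee_fin => r00 r0v.
have pc : position (off w) [:: (i, 0%N)] = Some (0 + t1', 0 + r0).
  by apply: (position_child (q := (0, 0)) xw er).
have [u [su [p [up /andP[p1 p2] /andP[p3 p4]]]]] := hit1_position ht0 hz0 hw pc.
apply: (empty (u ++ [:: (i, 0%N)]) _ p up); first by rewrite size_cat/= su addn1.
move: p1 p2 p3 p4; rewrite /= !add0r htE => p1 p2 p3 p4; split; rewrite /= in_itv/=.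
  rewrite (le_trans (ltW t1'0))//= (le_trans p2)//; rewrite /s in t1's; lra.
rewrite (le_trans (ltW r00))//= (le_trans p4)// (le_trans (lerD r0v hzE))//.
rewrite /v -mulrDl ler_pM2r ?powR_gt0//; lra.
Qed.

Lemma measurable_scaled_frontier n :
  measurable_fun setT (fun w => (frontier (brw (off w) n) * ((n%:R `^ beta)^-1)%:E)%E).
Proof.
under eq_fun do rewrite muleC.
by apply: measurable_funeM; exact: (measurable_frontier xi_poisson).
Qed.

Lemma measurable_deviation (e : R) n : measurable [set w | (e%:E <
  `|frontier (brw (off w) n) * ((n%:R `^ beta)^-1)%:E - c_alpha%:E|)%E].
Proof.
rewrite -[X in measurable X]setTI; apply: emeasurable_fun_o_infty => //.
apply: measurableT_comp; first exact: abse_measurable.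
by apply: emeasurable_funB => //; exact: measurable_scaled_frontier.
Qed.

Lemma frontier_deviation (e e' : R) : 0 < e -> 0 < e' -> exists n0 : nat,
  forall n, (n0 <= n)%N -> (P [set w | e%:E <
    `|frontier (brw (off w) n) * ((n%:R `^ beta)^-1)%:E - c_alpha%:E|]%E <= e'%:E)%E.
Proof.
move=> e0 e'0; have e'2 : 0 < e' / 2 by rewrite divr_gt0.
have c0 : 0 < c_alpha by rewrite mulr_gt0 ?expR_gt0.
have [n0 n0P] : exists n0 : nat, forall n, (n0 <= n)%N ->
    (P [set w | brw (off w) n (box n (c_alpha + e)) = 0%E] <= (e' / 2)%:E)%E.
  by apply: box_occupied => //; rewrite ltrDl.
have [n1 n1P] : exists n1 : nat, forall n, (n1 <= n)%N -> e < c_alpha ->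
    (P [set w | brw (off w) n (box n (c_alpha - e)) <> 0%E] <= (e' / 2)%:E)%E.
  case: (ltP e c_alpha) => [ec|ce]; last by exists 0%N.
  have [|n1 n1P] := @box_empty (c_alpha - e) _ _ e'2; last by exists n1 => n nn _; exact: n1P.
  by rewrite subr_gt0 ec gtrBl.
exists (n0 + n1).+1 => n nn; have n_gt0 : (0 < n)%N by exact: leq_ltn_trans nn.
have nb : 0 < n%:R `^ beta by rewrite powR_gt0// ltr0n.
pose A := [set w | brw (off w) n (box n (c_alpha + e)) = 0%E].
(* For [e >= c_alpha] no deviation from below can occur, the frontier being nonnegative. *)
pose B := if e < c_alpha then [set w | brw (off w) n (box n (c_alpha - e)) <> 0%E] else set0.
have mA : measurable A by exact: (measurable_brw_box xi_poisson).
have mB : measurable B.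
  rewrite /B; case: ifP => // _.
  rewrite [X in measurable X](_ : _ = ~` [set w | brw (off w) n (box n (c_alpha - e)) = 0%E])//.
  by apply: measurableC; exact: (measurable_brw_box xi_poisson).
have PA : (P A <= (e' / 2)%:E)%E by apply: n0P; rewrite (leq_trans _ nn)// leqW// leq_addr.
have PB : (P B <= (e' / 2)%:E)%E.
  rewrite /B; case: ifP => [ec|_]; last by rewrite measure0 lee_fin ltW.
  by apply: n1P => //; rewrite (leq_trans _ nn)// leqW// leq_addl.
apply: (@le_trans _ _ (P (A `|` B))); last first.
  apply: (le_trans (measureU2 _ mA mB)); apply: (le_trans (leeD PA PB)).
  by rewrite -EFinD -splitr.
apply: le_measure; rewrite ?inE.
- exact: measurable_deviation.
- exact: measurableU.
move=> w /=; have f0 := frontier_ge0 xi w n.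
have gt := @frontier_gt _ _ _ xi w n ((c_alpha + e) * n%:R `^ beta).
have lt := @frontier_lt _ _ _ xi w n ((c_alpha - e) * n%:R `^ beta).
rewrite /A /B; move: (frontier _) f0 gt lt => -[r|_ gt _ _|//].
  rewrite lee_fin !lte_fin => r0 gt lt dev.
  have : (e%:E < `|(r / n%:R `^ beta - c_alpha)%:E|)%E by exact: dev.
  rewrite lte_fin ltr_normr => /orP[h|h]; [left|right].
    by apply: gt; rewrite -ltr_pdivlMr// addrC -ltrBDr.
  have rb : 0 <= r / n%:R `^ beta by rewrite divr_ge0// ltW.
  rewrite ifT; last by lra.
  by apply: lt; rewrite -ltr_pdivrMr//; lra.
(* An infinite frontier leaves every box empty, in particular the larger one. *)
by left; apply: gt; exact: ltry.
Qed.

End frontier_limit.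

Theorem proposition4p3 (R : realType) (alpha : R)
    (lambda : {finite_measure set (pstar R) -> \bar R})
    (d : measure_display) (Omega : measurableType d) (P : probability Omega R)
    (xi : seq (nat * nat) -> Omega -> nat -> option (R * pstar R)) :
  0 < alpha ->
  lambda setT <> 0%E ->
  (c_const alpha lambda < +oo)%E ->
  (c_const alpha lambda * Gamma alpha = 1)%E ->
  (forall u, poisson_process P (xi u) (intensity alpha lambda)) ->
  independent P (fun u => sigma_atoms (xi u)) ->
  cvg_in_probability P
    (fun n w =>
       (frontier (brw (fun u => spread (xi u w)) n) *
        ((n%:R `^ ((alpha + 1) / alpha))^-1)%:E)%E)
    (alpha * expR (- ((alpha + 1) / alpha))).
Proof.
move=> alpha0 lambda0 c_fin normalized xi_poisson xi_indep; split.
  by move=> n; exact: (measurable_scaled_frontier xi_poisson).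
move=> e e0; apply/fine_cvgP; split.
  by apply: nearW => n; apply: fin_num_measure; exact: (measurable_deviation xi_poisson).
apply/cvgrPdist_le => e' e'0.
have [n0 n0P] := frontier_deviation alpha0 lambda0 c_fin normalized xi_poisson xi_indep e0 e'0.
exists n0 => // n nn /=; rewrite sub0r normrN ger0_norm ?fine_ge0//.
rewrite -lee_fin fineK; first exact: n0P.
by apply: fin_num_measure; exact: (measurable_deviation xi_poisson).
Qed.
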